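(* Let $N\ge 1$. Let $\{a_n\}_{n=1}^\infty$, $a_n\in\mathbb{C}$, be supported on the integers $n\le N$. Let $Q_0\ge 10^5$ and $Q\ge 20000\,Q_0$. Assume that $a_n=0$ for every $n$ for which there is a prime $p\le Q$ dividing $n$. Let $S(\alpha)=\sum_n a_n e(\alpha n)$ for $\alpha\in\mathbb{R}/\mathbb{Z}$. Then, if $Q_0\le Q^{0.6}$, $$\sum_{q\le Q_0}\ \sum_{\substack{a \bmod q\\ (a,q)=1}} |S(a/q)|^2 \ \le\ \frac{\log Q_0+c_+}{\log Q+c_E}\,(N+Q^2)\sum_n|a_n|^2,$$ where $c_+=1.36$ and $c_E=\gamma+\sum_{p}\frac{\log p}{p(p-1)}=1.3325822\dotsc$ (the sum being over all primes $p$).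
   Context: $e(t)=e^{2\pi i t}$; $\gamma$ is Euler's constant; $(a,q)$ is the greatest common divisor; $q$ ranges over positive integers, and $Q_0,Q$ are real numbers. *)

(* Defs.v *)
From HB Require Import structures.
From mathcomp Require Import all_boot all_order all_algebra.
From mathcomp Require Import complex.
From mathcomp Require Import all_classical all_reals all_analysis.

Set Implicit Arguments.
Unset Strict Implicit.
Unset Printing Implicit Defensive.

Import Order.TTheory GRing.Theory Num.Theory.
Import numFieldNormedType.Exports.

Local Open Scope classical_set_scope.
Local Open Scope ring_scope.

Definition e2pi (R : realType) (t : R) : R[i] :=
  (cos (2 * pi * t) +i* sin (2 * pi * t))%C.

(* The modulus as an element of R; the norm of R[i] takes its values in R[i]. *)
Definition cmod (R : realType) (z : R[i]) : R := ComplexField.Normc.normc z.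

(* Sums over [set n | _] range over the (finite) support of the summand.
   The sequence starts at n = 1: the value a 0 is never used. *)
Definition trig_sum (R : realType) (a : nat -> R[i]) (alpha : R) : R[i] :=
  \sum_(n \in [set n : nat | (0 < n)%N]) a n * e2pi (alpha * n%:R).

Definition euler_gamma (R : realType) : R :=
  limn (fun n : nat => \sum_(1 <= k < n.+1) (k%:R : R)^-1 - ln (n%:R : R)).

Definition c_plus (R : realType) : R := 136 / 100.

Definition c_E (R : realType) : R :=
  euler_gamma R +
  limn (fun n : nat =>
    \sum_(0 <= p < n | prime p) ln (p%:R : R) / (p%:R * (p%:R - 1))).

(* Main.v *)
(** Let [G_d(x)] be the sum of [1 / phi(r)] over the squarefree [r <= x] prime to [d]. Because [a]
    is supported on integers without prime factors up to [Q], the sum of the Farey energies over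
    [q <= X] equals the sum over [d <= X] of [T_d G_d(X / d)] for every [X <= Q], where [T_d >= 0]
    does not depend on [X]. For [X = Q] the large sieve with the constant [N + Q^2] (from the
    Hilbert inequality of Montgomery and Vaughan) bounds it, so it suffices to compare [G_d(Q0 / d)]
    with [rho G_d(Q / d)], [rho = (log Q0 + c_+) / (log Q + c_E)], for each [d] separately.

    Put [X_d = d / phi(d) G_d]. If [d | 6] then [X_d(x) = log x + c_E + sum_(p | d) log p / p] up to
    an explicit multiple of [1 / sqrt x]: each prime enters through a recursion that starts from the
    sum of [1 / n] over odd [n], and no cancellation between primes is needed. A further prime [p]
    raises [X_d(x)] by at most [(X_d(x) - X_d(x / p)) / (p - 1)]; this loss is paid by
    [(1 - rho) log d], as [rho <= 5 / 8]. The remaining [x <= 1000] are checked numerically in exact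
    integer arithmetic, with [1 / phi(r)] and the logarithms rounded in the safe direction. *)
Require Import Defs.
From HB Require Import structures.
From Stdlib Require Import ZArith.
From mathcomp Require Import all_boot all_order all_algebra.
From mathcomp Require Import complex.
From mathcomp Require Import all_classical all_reals all_analysis.
From mathcomp Require Import ring lra zify ssrZ.
Set Implicit Arguments.
Unset Strict Implicit.
Unset Printing Implicit Defensive.

Import Order.TTheory GRing.Theory Num.Theory.
Import numFieldNormedType.Exports.

Local Open Scope classical_set_scope.
Local Open Scope ring_scope.

(** The energy at denominator q is a quadratic form whose kernel is the Ramanujan sum c_q(n - n'),
    multiplicative in q. On integers prime to p the kernel of p stays positive semidefinite after 1
    / (p - 1) is subtracted. Multiplying out over the primes of q, the subtracted constants become 1
    / phi(r) and the remaining factors form the kernel behind T_d.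

    The estimate of X_d is shaped by a divergence. Passing from 1 / n to mu^2(n) / phi(n) at p
    brings in the errors at x / p and x / p^2 with weight 1 / (p (p - 1)). For an error c / sqrt x
    the shift by p^2 alone would cost a factor 1 + 1 / (p - 1) per prime, and that product diverges.
    So the induction bounds the sum over odd j of j^-2 times the error at x / j^2, which is still
    O(1 / sqrt x); the factor per prime is then 1 + O(p^(-3/2)).

    The constant 1.36 is nearly used up at d = 1, where log d gives nothing: 1.34 + 6.02 / 316 is
    above 1.359. For d > 1 the allowance .375 log d is split as .26 + .115: the first part pays for
    the primes of d that are at least 5, the second for the error terms. *)

Ltac field_nz := field; repeat (apply/andP; split); rewrite // ?gt_eqF //.

(** * Cosecant inequalities and the sum of the inverse squares *)

Section TrigBounds.
Variable R : realType.
Implicit Types x y : R.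

Lemma ge0_of_derivative_itv (f df : R -> R) (b : R) :
  (forall x, 0 <= x <= b -> is_derive x 1 f (df x)) -> (forall x, 0 <= x <= b -> 0 <= df x) ->
  f 0 = 0 -> forall x, 0 <= x <= b -> 0 <= f x.
Proof.
move=> hf hdf f0 x /andP[x0 xb].
have hx y : y \in `[0, x]%R -> 0 <= y <= b.
  by rewrite in_itv /= => /andP[-> yx] /=; apply: le_trans xb.
have cf : {within `[0, x], continuous f}.
  apply: derivable_within_continuous => y /hx yb.
  by have [] := hf y yb.
have [|c cin] := MVT_segment x0 _ cf (df := df).
  move=> y yin; apply: hf; apply: hx; move: yin; rewrite !in_itv /= => /andP[? ?].
  by rewrite !ltW.
by rewrite f0 !subr0 => ->; rewrite mulr_ge0 // hdf // hx.
Qed.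

Lemma ge0_of_derivative (f df : R -> R) :
  (forall x, is_derive x 1 f (df x)) -> (forall x, 0 <= x -> 0 <= df x) ->
  f 0 = 0 -> forall x, 0 <= x -> 0 <= f x.
Proof.
move=> hf hdf f0 x x0; apply: (@ge0_of_derivative_itv f df x) => //; last by rewrite x0 lexx.
by move=> y /andP[y0 _]; apply: hdf.
Qed.

Lemma sin_le_id x : 0 <= x -> sin x <= x.
Proof.
move=> x0; rewrite -subr_ge0.
apply: (@ge0_of_derivative (fun x => x - sin x) (fun x => 1 - cos x)) => //.
by rewrite sin0 subr0.
Qed.

Lemma cos_ge_quadratic x : 0 <= x -> 1 - x ^+ 2 / 2 <= cos x.
Proof.
move=> x0; rewrite -subr_ge0.
apply: (@ge0_of_derivative (fun x => cos x - (1 - x ^+ 2 / 2))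
  (fun x => x - sin x)) => //.
- move=> y; apply: is_derive_eq.
  by rewrite /GRing.scale /=; lra.
- by move=> y y0; rewrite subr_ge0 sin_le_id.
- by rewrite cos0; lra.
Qed.

Lemma sin_ge_cubic x : 0 <= x -> x - x ^+ 3 / 6 <= sin x.
Proof.
move=> x0; rewrite -subr_ge0.
apply: (@ge0_of_derivative (fun x => sin x - (x - x ^+ 3 / 6))
  (fun x => cos x - (1 - x ^+ 2 / 2))) => //.
- move=> y; apply: is_derive_eq.
  by rewrite /GRing.scale /=; lra.
- by move=> y y0; rewrite subr_ge0 cos_ge_quadratic.
- by rewrite sin0; lra.
Qed.

Lemma cos_le_quartic x : 0 <= x -> cos x <= 1 - x ^+ 2 / 2 + x ^+ 4 / 24.
Proof.
move=> x0; rewrite -subr_ge0.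
apply: (@ge0_of_derivative (fun x => 1 - x ^+ 2 / 2 + x ^+ 4 / 24 - cos x)
  (fun x => sin x - (x - x ^+ 3 / 6))) => //.
- move=> y; apply: is_derive_eq.
  by rewrite /GRing.scale /=; lra.
- by move=> y y0; rewrite subr_ge0 sin_ge_cubic.
- by rewrite cos0; lra.
Qed.

(** With the quartic bound for [cos] and the cubic bound for [sin], both sides become 3 x^2 (1 - x^2
    / 6)^2. The range covers (0, pi / 2] and keeps x - x^3 / 6 nonnegative, so that squaring is
    monotone. *)
Lemma one_plus_2cos_le_sin2 x : 0 <= x -> x <= 2 ->
  (1 + 2 * cos x) * x ^+ 2 <= 3 * sin x ^+ 2.
Proof.
move=> x0 x2; have c4 := cos_le_quartic x0; have s3 := sin_ge_cubic x0.
have pos : 0 <= x - x ^+ 3 / 6.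
  have -> : x - x ^+ 3 / 6 = x * (6 - x ^+ 2) / 6 by field.
  by rewrite divr_ge0 // mulr_ge0 //; nra.
have : (x - x ^+ 3 / 6) ^+ 2 <= sin x ^+ 2 by rewrite lerXn2r ?nnegrE // (le_trans pos).
have : (1 + 2 * cos x) * x ^+ 2 <= (1 + 2 * (1 - x ^+ 2 / 2 + x ^+ 4 / 24)) * x ^+ 2.
  by rewrite ler_wpM2r ?sqr_ge0 //; lra.
have -> : (1 + 2 * (1 - x ^+ 2 / 2 + x ^+ 4 / 24)) * x ^+ 2 = 3 * (x - x ^+ 3 / 6) ^+ 2.
  by field.
lra.
Qed.

Lemma pi_lt4 : pi < 4 :> R.
Proof. by have := @pihalf_lt2 R; lra. Qed.

(* csc^2 + 2 |csc cot| at the distance y = pi t, with t the representative in [-1/2, 1/2]. *)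
Lemma csc_weight_le (t : R) : t != 0 -> `|t| <= 1 / 2 ->
  (1 + 2 * `|cos (pi * t)|) / sin (pi * t) ^+ 2 <= 3 / (pi * t) ^+ 2.
Proof.
move=> t0 th; have pp := @pi_gt0 R; have p4 := pi_lt4.
wlog tp : t t0 th / 0 < t.
  move=> H; have [tp|tn] := ltP 0 t; first exact: H.
  have := H (- t); rewrite oppr_eq0 normrN mulrN sinN cosN !sqrrN; apply=> //.
  by rewrite oppr_gt0 lt_neqAle t0.
rewrite gtr0_norm // in th.
have xp : 0 < pi * t by rewrite mulr_gt0.
have xh : pi * t <= pi / 2 by rewrite (_ : pi / 2 = pi * (1 / 2)) ?ler_pM2l //; field.
have cp : 0 <= cos (pi * t) by apply: cos_ge0_pihalf; lra.
have sp : 0 < sin (pi * t) by apply: sin_gt0_pi; lra.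
rewrite ger0_norm // ler_pdivrMr ?exprn_gt0 // mulrAC ler_pdivlMr ?exprn_gt0 //.
by apply: one_plus_2cos_le_sin2; lra.
Qed.

(** For the half angle this is 1 / s^2 + 1 / c^2 = 1 / (s c)^2. Iterated from the single angle pi /
    2 it evaluates the cosecant sums that dominate sums of inverse squares, with the sharp
    constant. *)
Lemma csc2_doubling x : sin x != 0 ->
  (sin (x / 2)) ^- 2 + (sin ((x + pi) / 2)) ^- 2 = 4 * (sin x) ^- 2.
Proof.
move=> sx; have -> : (x + pi) / 2 = x / 2 + pi / 2 by field.
rewrite sinDpihalf.
have e : sin x = 2 * (sin (x / 2) * cos (x / 2)).
  rewrite {1}(splitr x) sinD; move: (sin (x / 2)) (cos (x / 2)) => s c; ring.
have cs := cos2Dsin2 (x / 2).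
have [s0 c0] : sin (x / 2) != 0 /\ cos (x / 2) != 0.
  by split; apply: contraNneq sx; rewrite e => ->; rewrite ?mulr0 ?mul0r ?mulr0.
rewrite e; move: cs s0 c0; move: (sin (x / 2)) (cos (x / 2)) => s c cs s0 c0.
transitivity ((c ^+ 2 + s ^+ 2) / (s * c) ^+ 2); first by field; rewrite s0 c0.
by rewrite cs; field; rewrite s0 c0.
Qed.

(** The odd multiples of pi / 2^(n+1) in (0, pi). Level n + 1 consists of a / 2 and (a + pi) / 2 for
    a in level n, which is the shape of [csc2_doubling]. *)
Definition dyadic_angle (n j : nat) : R := (2 * j%:R + 1) * pi / 2 ^+ n.+1.

Lemma dyadic_angle_itv n j : (j < 2 ^ n)%N -> 0 < dyadic_angle n j < pi.
Proof.
move=> jn; have pp := @pi_gt0 R; have p2 : 0 < 2 ^+ n.+1 :> R by rewrite exprn_gt0.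
apply/andP; split; first by rewrite divr_gt0 // mulr_gt0 //; have := ler0n R j; lra.
rewrite ltr_pdivrMr // mulrC ltr_pM2l //.
have : j.+1%:R <= 2 ^+ n :> R by rewrite -natrX ler_nat.
by rewrite -natr1 exprS; lra.
Qed.

Lemma sin_dyadic_gt0 n j : (j < 2 ^ n)%N -> 0 < sin (dyadic_angle n j).
Proof. by move=> /dyadic_angle_itv; apply: sin_gt0_pi. Qed.

Lemma dyadic_csc2_split n :
  \sum_(j < 2 ^ n) ((sin (dyadic_angle n j / 2)) ^- 2
     + (sin ((dyadic_angle n j + pi) / 2)) ^- 2)
  = 4 * \sum_(j < 2 ^ n) (sin (dyadic_angle n j)) ^- 2.
Proof.
rewrite mulr_sumr; apply: eq_bigr => j _.
by rewrite csc2_doubling // gt_eqF // sin_dyadic_gt0.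
Qed.

Lemma sum_dyadic_csc2 n : \sum_(j < 2 ^ n) (sin (dyadic_angle n j)) ^- 2 = 4 ^+ n.
Proof.
elim: n => [|n IH].
  rewrite expn0 big_ord1 /dyadic_angle mulr0 add0r mul1r expr1 sin_pihalf.
  by rewrite !expr0 expr1n invr1.
rewrite exprS -IH -dyadic_csc2_split expnS mul2n -addnn big_split_ord big_split /=.
have p2 : 2 ^+ n.+1 != 0 :> R by rewrite expf_neq0.
congr (_ + _); apply: eq_bigr => j _; congr ((sin _) ^- 2); rewrite /dyadic_angle.
  by rewrite [2 ^+ n.+2]exprS; field.
by rewrite natrD natrX [2 ^+ n.+2]exprS [2 ^+ n.+1]exprS; field; rewrite expf_neq0.
Qed.

(** The reflection j -> 2^n - 1 - j exchanges the families a / 2 and (a + pi) / 2, because sin (pi -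
    t) = sin t. Each family therefore carries half of 4 * 4^n. *)
Lemma sum_dyadic_csc2_half n :
  \sum_(j < 2 ^ n) (sin (dyadic_angle n j / 2)) ^- 2 = 2 * 4 ^+ n.
Proof.
have := dyadic_csc2_split n; rewrite sum_dyadic_csc2 big_split /=.
suff -> : \sum_(j < 2 ^ n) (sin ((dyadic_angle n j + pi) / 2)) ^- 2
    = \sum_(j < 2 ^ n) (sin (dyadic_angle n j / 2)) ^- 2 by lra.
rewrite (reindex_inj rev_ord_inj) /=; apply: eq_bigr => j _; congr (_ ^- 2).
have -> : (dyadic_angle n (2 ^ n - j.+1) + pi) / 2 = pi - dyadic_angle n j / 2.
  rewrite /dyadic_angle natrB // natrX -natr1 exprS; field.
  by rewrite expf_neq0.
by rewrite sinB sinpi cospi mul0r sub0r mulN1r opprK.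
Qed.

(** Apply sin a <= a to each term of [sum_dyadic_csc2_half], after enlarging the range to 2^n terms;
    the powers of 4 cancel. *)
Lemma sum_inv_odd_sq_le n : \sum_(j < n) ((2 * j%:R + 1) ^- 2 : R) <= pi ^+ 2 / 8.
Proof.
have pp := @pi_gt0 R.
have le1 : \sum_(j < n) ((2 * j%:R + 1) ^- 2 : R) <= \sum_(j < 2 ^ n) ((2 * j%:R + 1) ^- 2 : R).
  rewrite (big_ord_widen_cond (2 ^ n) xpredT (fun j => (2 * j%:R + 1) ^- 2)) ?(ltnW (ltn_expl _ _)) //.
  rewrite big_mkcond; apply: ler_sum => j _; case: ifP => // _.
apply: le_trans le1 _.
have : \sum_(j < 2 ^ n) (dyadic_angle n j / 2) ^- 2 <= 2 * 4 ^+ n.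
  rewrite -sum_dyadic_csc2_half; apply: ler_sum => j _.
  have /andP[a0 api] := dyadic_angle_itv (ltn_ord j).
  have s0 : 0 < sin (dyadic_angle n j / 2) by apply: sin_gt0_pi; lra.
  have d0 : 0 < dyadic_angle n j / 2 by lra.
  rewrite lef_pV2 ?posrE ?exprn_gt0 //.
  by apply: lerXn2r; rewrite ?nnegrE ?(ltW s0) ?(ltW d0) //; apply: sin_le_id; lra.
have p2 : 0 < 4 ^+ n :> R by rewrite exprn_gt0.
have -> : \sum_(j < 2 ^ n) (dyadic_angle n j / 2) ^- 2
   = 16 * 4 ^+ n / pi ^+ 2 * \sum_(j < 2 ^ n) ((2 * j%:R + 1) ^- 2 : R).
  rewrite mulr_sumr; apply: eq_bigr => j _; rewrite /dyadic_angle.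
  rewrite (_ : 4 ^+ n = (2 ^+ n) ^+ 2 :> R); last by rewrite -exprM mulnC exprM; congr (_ ^+ _); ring.
  have h2 : 2 ^+ n != 0 :> R by rewrite expf_neq0.
  have j0 : 2 * j%:R + 1 != 0 :> R by have := ler0n R j => j0; rewrite gt_eqF //; lra.
  rewrite [2 ^+ n.+1]exprS; move: (2 ^+ n) (2 * j%:R + 1 : R) h2 j0 => w v h2 j0.
  by move: (pi : R) pp => q pp; field_nz.
move: (4 ^+ n) p2 (\sum_(j < _) _) => w w0 S.
rewrite mulrAC ler_pdivrMr ?exprn_gt0 // => H.
have : w * (16 * S) <= w * (2 * pi ^+ 2) by lra.
by rewrite ler_pM2l //; lra.
Qed.

(** If S(n) is the sum, S(2n) is its odd part plus S(n) / 4. Since S(n) <= S(2n), this gives (3 / 4)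
    S(n) <= pi^2 / 8. *)
Lemma sum_inv_sq_le n : \sum_(j < n) ((j.+1%:R) ^- 2 : R) <= pi ^+ 2 / 6.
Proof.
have split2 m : \sum_(j < m.*2) ((j.+1%:R) ^- 2 : R)
   = \sum_(j < m) ((2 * j%:R + 1) ^- 2 : R) + (\sum_(j < m) ((j.+1%:R) ^- 2 : R)) / 4.
  elim: m => [|m IH]; first by rewrite !big_ord0 mul0r addr0.
  rewrite doubleS !big_ord_recr /= IH -!natr1 -muln2 natrM.
  have := ler0n R m; move: (m%:R : R) => z z0; field.
  by rewrite !gt_eqF //; lra.
have mono : \sum_(j < n) ((j.+1%:R) ^- 2 : R) <= \sum_(j < n.*2) ((j.+1%:R) ^- 2 : R).
  rewrite -addnn big_split_ord /= lerDl; apply: sumr_ge0 => j _.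
  by rewrite invr_ge0 exprn_ge0.
by have := split2 n; have := sum_inv_odd_sq_le n; lra.
Qed.

End TrigBounds.

Lemma ler_sum_uniq_subset (R : numDomainType) (T : eqType) (s t : seq T) (F : T -> R) :
  uniq s -> uniq t -> {subset s <= t} -> (forall i, i \in t -> 0 <= F i) ->
  \sum_(i <- s) F i <= \sum_(i <- t) F i.
Proof.
move=> us ut st F0; rewrite [leRHS](bigID (mem s)) /= -[X in _ <= X + _]big_filter.
rewrite (perm_big s (r1 := [seq i <- t | i \in s])); last first.
  apply: uniq_perm; rewrite ?filter_uniq // => i; rewrite mem_filter.
  by case: (boolP (i \in s)) => //= /st ->.
rewrite lerDl big_seq_cond; apply: sumr_ge0 => i /andP[it _]; exact: F0.
Qed.

(** * Well-spaced points on the circle *)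

Section CircleSpacing.
Variable R : realType.
Implicit Types (y z : R).

(** Signed: the sign tells on which side of 0 the point lies on the circle, and [sum_half_dist_le]
    treats the two sides separately. *)
Definition nearest_dist y : R := y - (Num.floor (y + 1 / 2))%:~R.

Lemma nearest_dist_itv y : - (1 / 2) <= nearest_dist y <= 1 / 2.
Proof.
rewrite /nearest_dist; have := Num.Theory.floor_itv (y + 1 / 2).
by rewrite intrD1 => /andP[? ?]; apply/andP; split; lra.
Qed.

Lemma norm_sin_shift_nat z (n : nat) : `|sin (z + n%:R * pi)| = `|sin z|.
Proof.
elim: n => [|n IH]; first by rewrite mul0r addr0.
by rewrite -natr1 mulrDl mul1r addrA sinDpi normrN.
Qed.

Lemma norm_cos_shift_nat z (n : nat) : `|cos (z + n%:R * pi)| = `|cos z|.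
Proof.
elim: n => [|n IH]; first by rewrite mul0r addr0.
by rewrite -natr1 mulrDl mul1r addrA cosDpi normrN.
Qed.

Lemma norm_sin_shift z (n : int) : `|sin (z + n%:~R * pi)| = `|sin z|.
Proof.
case: n => n; first exact: norm_sin_shift_nat.
rewrite NegzE mulrNz -(norm_sin_shift_nat (z + _) n.+1) -pmulrn.
by congr (`|sin _|); ring.
Qed.

Lemma norm_cos_shift z (n : int) : `|cos (z + n%:~R * pi)| = `|cos z|.
Proof.
case: n => n; first exact: norm_cos_shift_nat.
rewrite NegzE mulrNz -(norm_cos_shift_nat (z + _) n.+1) -pmulrn.
by congr (`|cos _|); ring.
Qed.

Lemma nearest_dist_shift y : pi * y = pi * nearest_dist y + (Num.floor (y + 1 / 2))%:~R * pi.
Proof. by rewrite /nearest_dist; ring. Qed.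

Lemma sin_pi_eq0 y : sin (pi * y) = 0 -> nearest_dist y = 0.
Proof.
move=> s0; have /andP[t1 t2] := nearest_dist_itv y.
have pp := @pi_gt0 R.
have : `|sin (pi * nearest_dist y)| = 0.
  by rewrite -(norm_sin_shift _ (Num.floor (y + 1 / 2))) -nearest_dist_shift s0 normr0.
move: (nearest_dist y) t1 t2 => t t1 t2 /normr0_eq0 st.
apply/eqP; rewrite eq_le !leNgt; apply/andP; split; apply/negP => tp.
  suff : 0 < sin (pi * t) by rewrite st ltxx.
  by apply: sin_gt0_pi; apply/andP; split; nra.
suff : 0 < sin (pi * - t) by rewrite mulrN sinN st oppr0 ltxx.
by apply: sin_gt0_pi; apply/andP; split; nra.
Qed.

Lemma csc_weight_nearest_le y : nearest_dist y != 0 ->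
  (1 + 2 * `|cos (pi * y)|) / sin (pi * y) ^+ 2 <= 3 / pi ^+ 2 * (nearest_dist y) ^- 2.
Proof.
move=> t0; have /andP[t1 t2] := nearest_dist_itv y.
have h := @csc_weight_le R _ t0; apply: le_trans (le_trans (h _) _).
- rewrite -[sin (pi * y) ^+ 2]real_normK ?num_real // nearest_dist_shift.
  by rewrite norm_sin_shift norm_cos_shift real_normK ?num_real.
- by rewrite ler_norml; apply/andP; split; lra.
- by rewrite exprMn invfM mulrA.
Qed.

Lemma sum_inv_sq_inj_le (I : finType) (P : pred I) (k : I -> nat) :
  (forall i, P i -> (0 < k i)%N) -> {in P &, injective k} ->
  \sum_(i | P i) ((k i)%:R ^- 2 : R) <= pi ^+ 2 / 6.
Proof.
move=> k0 kinj; pose n := (\max_(i : I) k i)%N.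
apply: le_trans (@sum_inv_sq_le R n).
rewrite (_ : \sum_(j < n) _ = \sum_(j <- iota 1 n) (j%:R ^- 2 : R)); last first.
  by rewrite -(big_mkord xpredT (fun j => (j.+1%:R ^- 2 : R))) -[iota 1 n]/(iota (1 + 0) n)
    iotaDl big_map /index_iota subn0.
rewrite -big_filter -(big_map k xpredT (fun j => (j%:R ^- 2 : R))).
apply: ler_sum_uniq_subset; rewrite ?iota_uniq //.
- rewrite map_inj_in_uniq ?filter_uniq ?index_enum_uniq // => i j.
  by rewrite !mem_filter => /andP[Pi _] /andP[Pj _]; apply: kinj.
- move=> j jin; have [ i ] := mapP jin; rewrite mem_filter => /andP[Pi _] ->.
  by rewrite mem_iota k0 //= add1n ltnS; apply: leq_bigmax.
Qed.

Variables (k : nat) (x : 'I_k -> R) (delta : R).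
Hypothesis delta_gt0 : 0 < delta.
Hypothesis separated : forall r s, r != s -> forall n : int, delta <= `|x r - x s - n%:~R|.

Lemma nearest_dist_sep r s : r != s -> delta <= `|nearest_dist (x r - x s)|.
Proof. by move=> rs; apply: separated. Qed.

Lemma nearest_dist_sep2 r s s' : s != s' ->
  delta <= `|nearest_dist (x r - x s) - nearest_dist (x r - x s')|.
Proof.
rewrite eq_sym => ss; rewrite /nearest_dist.
set m := Num.floor _; set m' := Num.floor _.
have := separated ss (m - m'); rewrite intrB.
by congr (_ <= `|_|); ring.
Qed.

(** On one side of x_r the distances to the other points are at least delta and differ pairwise by
    at least delta. Their integer parts in units of delta are then distinct positive integers, so
    the sum is at most that of all 1 / k^2. *)
Lemma sum_half_dist_le r (b : bool) :
  \sum_(s | (s != r) && ((0 < nearest_dist (x r - x s)) == b)) (nearest_dist (x r - x s)) ^- 2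
  <= pi ^+ 2 / 6 / delta ^+ 2.
Proof.
pose t s := nearest_dist (x r - x s); pose q s := Num.truncn (`|t s| / delta).
have t_ge s : s != r -> 1 <= `|t s| / delta.
  by move=> sr; rewrite ler_pdivlMr // mul1r nearest_dist_sep // eq_sym.
have qitv s : s != r -> (q s)%:R <= `|t s| / delta < (q s)%:R + 1.
  move=> sr; rewrite natr1; apply: Num.Theory.truncn_itv.
  by rewrite (le_trans ler01) ?t_ge.
apply: (@le_trans _ _ ((\sum_(s | (s != r) && ((0 < t s) == b)) ((q s)%:R ^- 2 : R)) / delta ^+ 2)).
  rewrite mulr_suml; apply: ler_sum => s /andP[sr _].
  have /andP[q1 _] := qitv s sr.
  have q0 : 0 < (q s)%:R :> R by rewrite ltr0n /q Num.Theory.truncn_gt0 t_ge.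
  rewrite -[X in X <= _]/((t s) ^- 2) -(real_normK (num_real (t s))) -invfM -exprMn.
  rewrite lef_pV2 ?posrE ?exprn_gt0 ?mulr_gt0 //; last first.
    by rewrite (lt_le_trans delta_gt0) // nearest_dist_sep // eq_sym.
  apply: lerXn2r; rewrite ?nnegrE ?mulr_ge0 // ?(ltW delta_gt0) //.
  by rewrite -ler_pdivlMr.
rewrite ler_pM2r ?invr_gt0 ?exprn_gt0 //; apply: sum_inv_sq_inj_le.
  by move=> s /andP[sr _]; rewrite /q Num.Theory.truncn_gt0 t_ge.
move=> s s' /andP[sr /eqP bs] /andP[sr' /eqP bs'] qq.
apply/eqP/contraT => ss; have := @nearest_dist_sep2 r _ _ ss.
have /andP[q1 q2] := qitv s sr; have /andP[] := qitv s' sr'; rewrite -qq => q1' q2'.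
move: q1 q2 q1' q2'; rewrite !ler_pdivlMr // !ltr_pdivrMr // -/(t s) -/(t s').
suff -> : `|t s - t s'| = `| `|t s| - `|t s'| |.
  by move=> h1 h2 h3 h4; apply: contraTT => _; rewrite -ltNge ltr_norml; apply/andP; split; nra.
move: bs bs'; case: (ltP 0 (t s)) => h <-; case: (ltP 0 (t s')) => // h' _.
  by rewrite (gtr0_norm h) (gtr0_norm h').
by rewrite (ler0_norm h) (ler0_norm h') -normrN; congr `|_|; ring.
Qed.

(** Two sides of pi^2 / 6 each, times 3 / pi^2, give exactly 1. This exactness is what leads to the
    large sieve constant N + 1 / delta. *)
Lemma csc_weight_sum_le r :
  \sum_(s | s != r) (1 + 2 * `|cos (pi * (x r - x s))|) / sin (pi * (x r - x s)) ^+ 2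
  <= delta ^- 2.
Proof.
apply: (@le_trans _ _ (\sum_(s | s != r) 3 / pi ^+ 2 * (nearest_dist (x r - x s)) ^- 2)).
  apply: ler_sum => s sr; apply: csc_weight_nearest_le.
  by rewrite -normr_gt0 (lt_le_trans delta_gt0) // nearest_dist_sep // eq_sym.
rewrite -mulr_sumr (bigID (fun s => (0 < nearest_dist (x r - x s)) == true)) /=.
have h1 := sum_half_dist_le r true; have h2 := sum_half_dist_le r false.
rewrite [X in _ * (_ + X)](eq_bigl (fun s => (s != r) && ((0 < nearest_dist (x r - x s)) == false))); last first.
  by move=> s; rewrite eqb_id eqbF_neg.
have pp := @pi_gt0 R; move: (pi : R) pp h1 h2 => q pp h1 h2.
apply: (@le_trans _ _ (3 / q ^+ 2 * (q ^+ 2 / 6 / delta ^+ 2 + q ^+ 2 / 6 / delta ^+ 2))).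
  by apply: ler_wpM2l; [rewrite divr_ge0 // sqr_ge0|apply: lerD].
by rewrite le_eqVlt; apply/orP; left; apply/eqP; field_nz.
Qed.

Lemma sin_sep_neq0 r s : r != s -> sin (pi * (x r - x s)) != 0.
Proof.
move=> rs; apply/eqP => /sin_pi_eq0 t0; have := nearest_dist_sep rs.
by rewrite t0 normr0 leNgt delta_gt0.
Qed.

End CircleSpacing.

(** * The Hilbert inequality in its cosecant form *)

Section Hilbert.
Variable R : realType.
Local Notation C := R[i].
Local Notation "z ^*" := (Num.conj z).

(** This is cot a + cot b = sin (a + b) / (sin a sin b). In the square of the cosecant matrix a + b
    does not depend on the summation index, so one cosecant factors out and differences of
    cotangents remain. *)
Lemma csc_mul_csc (a b : R) : sin a != 0 -> sin b != 0 -> sin (a + b) != 0 ->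
  (sin a)^-1 * (sin b)^-1 = (sin (a + b))^-1 * (cos a / sin a + cos b / sin b).
Proof.
rewrite sinD; move: (sin a) (cos a) (sin b) (cos b) => sa ca sb cb.
by move=> ? ? ?; field_nz.
Qed.

Variables (k : nat) (x : 'I_k -> R) (delta : R).
Hypothesis delta_gt0 : 0 < delta.
Hypothesis separated : forall r s, r != s -> forall n : int, delta <= `|x r - x s - n%:~R|.

Definition csc_entry (r s : 'I_k) : R :=
  if r == s then 0 else (sin (pi * (x r - x s)))^-1.
Definition csc_cot_entry (r s : 'I_k) : R :=
  if r == s then 0 else cos (pi * (x r - x s)) / sin (pi * (x r - x s)) ^+ 2.
Definition cot_sum (r : 'I_k) : R :=
  \sum_(t | t != r) cos (pi * (x r - x t)) / sin (pi * (x r - x t)).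

Lemma csc_entryN r s : csc_entry s r = - csc_entry r s.
Proof.
rewrite /csc_entry eq_sym; case: eqP => [|_]; first by rewrite oppr0.
by rewrite -invrN -sinN -mulrN opprB.
Qed.

Lemma csc_cot_entry_sym r s : csc_cot_entry s r = csc_cot_entry r s.
Proof.
rewrite /csc_cot_entry eq_sym; case: eqP => // _.
by rewrite -(opprB (x r)) mulrN sinN cosN sqrrN.
Qed.

(** The full sums [cot_sum r] and [cot_sum s] contain the terms t = s and t = r, which the product
    sum lacks. These two terms add up to twice a cotangent, hence the correction by
    [csc_cot_entry]. *)
Lemma sum_csc_entry_mul r s : r != s ->
  \sum_t csc_entry r t * csc_entry t s
  = csc_entry r s * (cot_sum r - cot_sum s) - 2 * csc_cot_entry r s.
Proof.
move=> rs; have sr : s != r by rewrite eq_sym.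
have nz := sin_sep_neq0 delta_gt0 separated.
rewrite (bigD1 r) //= (bigD1 s) //= /csc_entry !eqxx (negPf rs) mul0r mulr0 !add0r.
have -> : cot_sum r = cos (pi * (x r - x s)) / sin (pi * (x r - x s))
    + \sum_(t | (t != r) && (t != s)) cos (pi * (x r - x t)) / sin (pi * (x r - x t)).
  by rewrite /cot_sum (bigD1 s).
have -> : cot_sum s = cos (pi * (x s - x r)) / sin (pi * (x s - x r))
    + \sum_(t | (t != r) && (t != s)) cos (pi * (x s - x t)) / sin (pi * (x s - x t)).
  by rewrite /cot_sum (bigD1 r) //=; congr (_ + _); apply: eq_bigl => t; rewrite andbC.
rewrite /csc_cot_entry (negPf rs).
rewrite (eq_bigr (fun t => (sin (pi * (x r - x s)))^-1
   * (cos (pi * (x r - x t)) / sin (pi * (x r - x t))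
      - cos (pi * (x s - x t)) / sin (pi * (x s - x t))))); last first.
  move=> t /andP[tr ts]; have rt : r != t by rewrite eq_sym.
  have st : s != t by rewrite eq_sym.
  rewrite (negPf rt) (negPf ts).
  rewrite csc_mul_csc ?nz //; last by rewrite -mulrDr addrA subrK nz.
  rewrite -mulrDr addrA subrK; congr (_ * (_ + _)).
  by rewrite -(opprB (x s)) mulrN sinN cosN invrN mulrN.
rewrite -mulr_sumr sumrB.
rewrite -(opprB (x r) (x s)) mulrN sinN cosN invrN mulrN.
move: (\sum_(t | _) _) (\sum_(t | _) _) => S1 S2.
have := nz _ _ rs; move: (sin _) (cos _) => sn cs h; by field.
Qed.

Lemma sum_csc_entry_mul_diag r :
  \sum_t csc_entry r t * csc_entry t r
  = - \sum_(t | t != r) (sin (pi * (x r - x t))) ^- 2.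
Proof.
rewrite (bigD1 r) //= /csc_entry eqxx mul0r add0r -sumrN; apply: eq_bigr => t tr.
have rt : r != t by rewrite eq_sym.
rewrite (negPf rt) (negPf tr) -(opprB (x r) (x t)) mulrN sinN invrN mulrN.
by rewrite -expr2 exprVn.
Qed.

Definition csc_mx : 'M[C]_k := \matrix_(r, s) (csc_entry r s)%:C%C.

Lemma conj_real (a : R) : (a%:C%C : C)^* = a%:C%C.
Proof. by apply/CrealP; apply/complex_realP; exists a. Qed.

Lemma trmx_csc_mx : csc_mx^T = - csc_mx.
Proof. by apply/matrixP => r s; rewrite !mxE csc_entryN raddfN. Qed.

Lemma conj_csc_mx : map_mx Num.conj csc_mx = csc_mx.
Proof. by apply/matrixP => r s; rewrite !mxE conj_real. Qed.

Lemma csc_mx_normal : csc_mx \is normalmx.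
Proof.
apply/normalmxP; rewrite trmx_csc_mx raddfN /= conj_csc_mx.
by rewrite mulmxN mulNmx.
Qed.

Lemma normC_le_of_sqr (z : C) (c : R) : 0 <= c -> `|z| ^+ 2 <= (c ^+ 2)%:C%C -> `|z| <= c%:C%C.
Proof.
move=> c0; rewrite rmorphXn /= => h.
by rewrite -(@ler_pXn2r _ 2) // ?nnegrE // lecR.
Qed.

(** The modulus of lam^2 is read off from the form of the squared matrix at a unit eigenvector. The
    cotangent sums there have no useful bound, but for an eigenvector they cancel; the rest is a
    weighted row sum bounded by [csc_weight_sum_le]. *)
Lemma csc_eigenvalue_le (u : 'rV[C]_k) (lam : C) :
  u *m csc_mx = lam *: u -> \sum_r `|u 0 r| ^+ 2 = 1 -> `|lam| <= (delta^-1)%:C%C.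
Proof.
move=> eig norm1.
have eigE s : \sum_r u 0 r * (csc_entry r s)%:C%C = lam * u 0 s.
  have := congr1 (fun M : 'rV_k => M 0 s) eig; rewrite !mxE => <-.
  by apply: eq_bigr => r _; rewrite mxE.
have lamE : lam = \sum_r \sum_s u 0 r * (csc_entry r s)%:C%C * (u 0 s)^*.
  rewrite exchange_big /= -[LHS]mulr1 -norm1 mulr_sumr; apply: eq_bigr => s _.
  by rewrite -mulr_suml eigE normCK mulrA.
have lam_conj : lam^* = - lam.
  rewrite {1}lamE rmorph_sum /= {1}lamE exchange_big -sumrN; apply: eq_bigr => r _.
  rewrite rmorph_sum -sumrN; apply: eq_bigr => s _.
  by rewrite !rmorphM /= conjCK conj_real csc_entryN raddfN /=; ring.
have eigE' r : \sum_s (csc_entry r s)%:C%C * (u 0 s)^* = lam * (u 0 r)^*.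
  have := congr1 Num.conj (eigE r); rewrite rmorph_sum rmorphM /= lam_conj => h.
  apply: oppr_inj; rewrite -mulNr -h -sumrN; apply: eq_bigr => s _.
  by rewrite rmorphM /= conj_real csc_entryN raddfN /=; ring.
pose P r := \sum_(t | t != r) (sin (pi * (x r - x t))) ^- 2.
have eig2 s : \sum_r u 0 r * (\sum_t csc_entry r t * csc_entry t s)%:C%C = lam ^+ 2 * u 0 s.
  rewrite expr2 -mulrA -eigE mulr_sumr.
  under eq_bigr => r _ do rewrite rmorph_sum mulr_sumr.
  rewrite exchange_big; apply: eq_bigr => t _ /=.
  by rewrite mulrA -eigE mulr_suml; apply: eq_bigr => r _; rewrite rmorphM /= mulrA.
have sqE : lam ^+ 2 = - \sum_r \sum_s (2 * csc_cot_entry r s)%:C%C * (u 0 r * (u 0 s)^*)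
    - \sum_r (P r)%:C%C * `|u 0 r| ^+ 2.
  have -> : lam ^+ 2 = \sum_r \sum_s u 0 r * (\sum_t csc_entry r t * csc_entry t s)%:C%C * (u 0 s)^*.
    rewrite exchange_big /= -[LHS]mulr1 -norm1 mulr_sumr; apply: eq_bigr => s _.
    by rewrite -mulr_suml eig2 normCK mulrA.
  (* By the eigenvector equation, applied on either side, the forms with [cot_sum r] and with
     [cot_sum s] both become lam times the sum of cot_sum(r) |u_r|^2, so their difference
     vanishes. *)
  have E1 : \sum_r \sum_s u 0 r * ((csc_entry r s)%:C%C * (cot_sum r)%:C%C) * (u 0 s)^*
     = \sum_r lam * (cot_sum r)%:C%C * (u 0 r * (u 0 r)^*).
    apply: eq_bigr => r _; transitivity (u 0 r * (cot_sum r)%:C%C * (lam * (u 0 r)^*)); last by ring.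
    by rewrite -eigE' mulr_sumr; apply: eq_bigr => s _; ring.
  have E2 : \sum_r \sum_s u 0 r * ((csc_entry r s)%:C%C * (cot_sum s)%:C%C) * (u 0 s)^*
     = \sum_r lam * (cot_sum r)%:C%C * (u 0 r * (u 0 r)^*).
    rewrite exchange_big; apply: eq_bigr => s _ /=.
    transitivity ((lam * u 0 s) * (cot_sum s)%:C%C * (u 0 s)^*); last by ring.
    by rewrite -eigE !mulr_suml; apply: eq_bigr => r _; ring.
  transitivity (\sum_r \sum_s (u 0 r * ((csc_entry r s)%:C%C * (cot_sum r)%:C%C) * (u 0 s)^*
     - u 0 r * ((csc_entry r s)%:C%C * (cot_sum s)%:C%C) * (u 0 s)^*
     - (2 * csc_cot_entry r s)%:C%C * (u 0 r * (u 0 s)^*)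
     - (if s == r then (P r)%:C%C else 0) * (u 0 r * (u 0 s)^*))).
    apply: eq_bigr => r _; apply: eq_bigr => s _; have [->|sr] := eqVneq s r.
      rewrite sum_csc_entry_mul_diag /csc_entry /csc_cot_entry !eqxx -/(P r).
      by rewrite mulr0 raddfN /=; ring.
    rewrite sum_csc_entry_mul 1?eq_sym // !(rmorphB, rmorphM) /=; ring.
  under eq_bigr => r _ do rewrite !sumrB.
  rewrite !sumrB E1 E2 subrr add0r; congr (_ - _).
  apply: eq_bigr => r _; rewrite (bigD1 r) //= eqxx big1 ?addr0 -?normCK // => s /negPf ->.
  by rewrite mul0r.
have normR (a : R) : `|a%:C%C : C| = (`|a|)%:C%C.
  by rewrite normc_def /= expr0n addr0 sqrtr_sqr.
apply: normC_le_of_sqr; first by rewrite invr_ge0 ltW.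
rewrite -normrX sqE -opprD normrN; apply: le_trans (ler_normD _ _) _.
apply: (@le_trans _ _ (\sum_r `|u 0 r| ^+ 2 * (\sum_s 2 * `|csc_cot_entry r s| + P r)%:C%C)).
  have P0 r : 0 <= P r by apply: sumr_ge0 => t _; rewrite invr_ge0 sqr_ge0.
  under [leRHS]eq_bigr => r _ do rewrite rmorphD mulrDr.
  rewrite big_split /=; apply: lerD; last first.
    apply: le_trans (ler_norm_sum _ _ _) _; apply: ler_sum => r _.
    by rewrite normrM normR (ger0_norm (P0 r)) mulrC normrX normr_id.
  (* Schur test: 2 |u_r u_s| <= |u_r|^2 + |u_s|^2; by symmetry of [csc_cot_entry] the two halves
     have the same sum. *)
  apply: (@le_trans _ _ (\sum_r \sum_s (`|csc_cot_entry r s|)%:C%C * (`|u 0 r| ^+ 2 + `|u 0 s| ^+ 2))).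
    apply: le_trans (ler_norm_sum _ _ _) _; apply: ler_sum => r _.
    apply: le_trans (ler_norm_sum _ _ _) _; apply: ler_sum => s _.
    rewrite !normrM normR norm_conjC normrM rmorphM /= ger0_norm //.
    rewrite (mulrC (2%:C)%C) -mulrA ler_wpM2l ?ler0c // rmorph_nat.
    by rewrite -subr_ge0 (_ : _ - _ = (`|u 0 r| - `|u 0 s|) ^+ 2) ?real_exprn_even_ge0 ?rpredB ?normr_real //; ring.
  rewrite le_eqVlt; apply/orP; left; apply/eqP.
  transitivity (\sum_r \sum_s (`|csc_cot_entry r s|)%:C%C * `|u 0 r| ^+ 2
      + \sum_r \sum_s (`|csc_cot_entry r s|)%:C%C * `|u 0 s| ^+ 2).
    rewrite -big_split; apply: eq_bigr => r _; rewrite -big_split; apply: eq_bigr => s _.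
    by rewrite /= mulrDr.
  rewrite [X in _ + X]exchange_big /= -big_split /=.
  apply: eq_bigr => r _; rewrite rmorph_sum mulr_sumr -big_split /=; apply: eq_bigr => s _.
  by rewrite csc_cot_entry_sym rmorphM /=; ring.
rewrite -[leRHS]mul1r -norm1 mulr_suml; apply: ler_sum => r _.
rewrite ler_wpM2l ?exprn_ge0 // lecR exprVn.
apply: le_trans (csc_weight_sum_le delta_gt0 separated r).
rewrite (bigD1 r) //= {1}/csc_cot_entry eqxx normr0 mulr0 add0r -big_split /=.
apply: ler_sum => s sr; rewrite /csc_cot_entry eq_sym (negPf sr).
rewrite normrM normfV normrX real_normK ?num_real //.
by rewrite [leRHS]mulrDl mul1r [leLHS]addrC -[in leRHS]mulrA.
Qed.

(** A real antisymmetric matrix is normal, so a unitary change of coordinates diagonalizes the form,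
    and it is at most the largest modulus of an eigenvalue times the squared norm. *)
Theorem hilbert_inequality (v : 'I_k -> C) :
  `|\sum_r \sum_s v r * (csc_entry r s)%:C%C * (v s)^*| <= (delta^-1)%:C%C * \sum_r `|v r| ^+ 2.
Proof.
pose U := spectralmx csc_mx; pose d := spectral_diag csc_mx.
have Uu : U \is unitarymx by apply: spectral_unitarymx.
have UV : invmx U = map_mx Num.conj (U^T) by rewrite invmx_unitary.
have AE : csc_mx = invmx U *m diag_mx d *m U by apply/orthomx_spectralP/csc_mx_normal.
pose V := \row_r v r : 'rV[C]_k; pose w := V *m invmx U.
have UU : U *m invmx U = 1%:M by rewrite mulmxV ?spectral_unit.
have UU' : invmx U *m U = 1%:M by rewrite mulVmx ?spectral_unit.
have dle i : `|d 0 i| <= (delta^-1)%:C%C.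
  apply: (@csc_eigenvalue_le (row i U)).
    rewrite -row_mul [in LHS]AE !mulmxA UU mul1mx mul_diag_mx.
    by apply/rowP => j; rewrite !mxE.
  have := congr1 (fun M : 'M[C]_k => M i i : C) UU; rewrite UV !mxE eqxx => h; transitivity (true%:R : C) => //; rewrite -h.
  by apply: eq_bigr => j _; rewrite !mxE normCK.
pose W := map_mx Num.conj (V^T).
have wW : map_mx Num.conj (w^T) = U *m W.
  by rewrite /w trmx_mul map_mxM UV trmxCK.
have qE : \sum_r \sum_s v r * (csc_entry r s)%:C%C * (v s)^* = \sum_i d 0 i * `|w 0 i| ^+ 2.
  transitivity ((V *m csc_mx *m W) 0 0).
    rewrite exchange_big mxE; apply: eq_bigr => s _ /=.
    by rewrite !mxE mulr_suml; apply: eq_bigr => r _; rewrite !mxE.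
  transitivity ((w *m diag_mx d *m (map_mx Num.conj (w^T))) 0 0).
    by rewrite wW [in LHS]AE /w !mulmxA.
  rewrite mul_mx_diag mxE; apply: eq_bigr => i _; rewrite !mxE normCK; ring.
have nE : \sum_r `|v r| ^+ 2 = \sum_i `|w 0 i| ^+ 2.
  transitivity ((V *m W) 0 0); first by rewrite mxE; apply: eq_bigr => r _; rewrite !mxE normCK.
  have -> : V *m W = w *m (map_mx Num.conj (w^T)) by rewrite wW /w mulmxA -(mulmxA V) UU' mulmx1.
  by rewrite mxE; apply: eq_bigr => i _; rewrite !mxE normCK.
rewrite qE nE mulr_sumr; apply: le_trans (ler_norm_sum _ _ _) _; apply: ler_sum => i _.
by rewrite normrM normrX normr_id ler_wpM2r // exprn_ge0.
Qed.

End Hilbert.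

(** * The large sieve, by duality *)

Section LargeSieve.
Variable R : realType.
Local Notation C := R[i].
Local Notation "z ^*" := (Num.conj z).
Implicit Types t u : R.

Lemma e2piD t u : e2pi (t + u) = e2pi t * e2pi u.
Proof.
rewrite /e2pi !mulrDr cosD sinD; apply/eqP; rewrite eq_complex /=.
by rewrite eqxx addrC eqxx.
Qed.

Lemma e2pi0 : e2pi 0 = 1 :> C.
Proof. by rewrite /e2pi mulr0 cos0 sin0. Qed.

Lemma conj_e2pi t : (e2pi t)^* = e2pi (- t).
Proof. by rewrite /e2pi mulrN cosN sinN. Qed.

Lemma e2piNK t : e2pi t * e2pi (- t) = 1.
Proof. by rewrite -e2piD subrr e2pi0. Qed.

Lemma norm_e2pi t : `|e2pi t| = 1.
Proof.
apply/eqP; rewrite -(@eqrXn2 _ 2) // normCK conj_e2pi e2piNK expr1n //.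
Qed.

Lemma e2pi_nat (n : nat) : e2pi (n%:R : R) = 1.
Proof.
elim: n => [|n IH]; first exact: e2pi0.
rewrite -natr1 e2piD IH mul1r /e2pi mulr1 mulr_natl.
by rewrite cos2pi sin2pi.
Qed.

Lemma e2pi_half_diff t : e2pi (- (t / 2)) - e2pi (t / 2) = (- 2 * sin (pi * t))%:C%C * 'i%C.
Proof.
rewrite /e2pi; have -> : 2 * pi * (t / 2) = pi * t by move: (pi : R) => q; field.
have -> : 2 * pi * - (t / 2) = - (pi * t) by move: (pi : R) => q; field.
rewrite cosN sinN; apply/eqP; rewrite eq_complex /=; apply/andP; split; apply/eqP; ring.
Qed.

(** Multiplying each term by e(-t/2) - e(t/2) makes the sum telescope, with end points M + 1/2 and
    1/2. In this multiplied form it holds also where the sine vanishes. *)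
Lemma sum_e2pi_geometric (M : nat) t :
  (\sum_(1 <= n < M.+1) e2pi (- (n%:R * t))) * ((- 2 * sin (pi * t))%:C%C * 'i%C)
  = e2pi (- ((M%:R + 1 / 2) * t)) - e2pi (- (1 / 2 * t)).
Proof.
rewrite -e2pi_half_diff mulr_suml.
transitivity (\sum_(1 <= n < M.+1) (e2pi (- ((n%:R + 1 / 2) * t)) - e2pi (- ((n.-1%:R + 1 / 2) * t)))).
  rewrite !big_nat; apply: eq_bigr => n /andP[n1 _].
  rewrite mulrBr -!e2piD; congr (e2pi _ - e2pi _); first by field.
  by rewrite -{1}(prednK n1) -natr1; field.
rewrite big_add1 /=; elim: M => [|M IH]; first by rewrite big_geq // add0r subrr.
by rewrite big_nat_recr //= IH -!natr1; ring.
Qed.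

Variables (k : nat) (x : 'I_k -> R) (delta : R).
Hypothesis delta_gt0 : 0 < delta.
Hypothesis separated : forall r s, r != s -> forall n : int, delta <= `|x r - x s - n%:~R|.

(** Opening the square, the diagonal gives M. The off-diagonal part is (1 / 2i) times a difference
    of two cosecant forms whose coefficients are u_r twisted by unimodular numbers e(-c x_r), c = M
    + 1/2 or c = 1/2. Each form is at most 1 / delta, and the factor 1/2 pays for having two. *)
Lemma dual_large_sieve (M : nat) (u : 'I_k -> C) :
  \sum_(1 <= n < M.+1) `|\sum_r u r * e2pi (- (n%:R * x r))| ^+ 2
  <= (M%:R + delta^-1)%:C%C * \sum_r `|u r| ^+ 2.
Proof.
pose g r s := \sum_(1 <= n < M.+1) e2pi (- (n%:R * (x r - x s))) : C.
have E0 : \sum_(1 <= n < M.+1) `|\sum_r u r * e2pi (- (n%:R * x r))| ^+ 2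
   = \sum_r \sum_s u r * (u s)^* * g r s.
  transitivity (\sum_(1 <= n < M.+1) \sum_r \sum_s u r * (u s)^* * e2pi (- (n%:R * (x r - x s)))).
    apply: eq_bigr => n _; rewrite normCK rmorph_sum /= mulr_suml; apply: eq_bigr => r _.
    rewrite mulr_sumr; apply: eq_bigr => s _; rewrite rmorphM /= conj_e2pi opprK mulrBr opprB.
    rewrite [_ - _]addrC e2piD; ring.
  rewrite exchange_big; apply: eq_bigr => r _ /=; rewrite exchange_big; apply: eq_bigr => s _ /=.
  by rewrite /g mulr_sumr.
pose q (c : R) := \sum_r \sum_s (u r * e2pi (- (c * x r))) * (csc_entry x r s)%:C%C * (u s * e2pi (- (c * x s)))^*.
have qle c : `|q c| <= (delta^-1)%:C%C * \sum_r `|u r| ^+ 2.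
  apply: le_trans (hilbert_inequality delta_gt0 separated _) _.
  by under eq_bigr => r _ do rewrite normrM norm_e2pi mulr1.
have sc0 : ((-2)%:C%C * 'i%C : C) != 0.
  by rewrite mulf_neq0 // ?neq0Ci //; apply/eqP => -[] /eqP; rewrite oppr_eq0 pnatr_eq0.
have E1 : \sum_r \sum_s u r * (u s)^* * g r s
   = M%:R%:C%C * (\sum_r `|u r| ^+ 2) + ((-2)%:C%C * 'i%C)^-1 * (q (M%:R + 1 / 2) - q (1 / 2)).
  rewrite {1}/q {1}/q -sumrB !mulr_sumr -big_split /=.
  apply: eq_bigr => r _; rewrite -sumrB mulr_sumr (bigD1 r) //= [in RHS](bigD1 r) //=.
  rewrite /csc_entry eqxx !mulr0 !mul0r subrr mulr0 add0r; congr (_ + _).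
    rewrite /g subrr normCK mulrC; congr (_ * _).
    under eq_bigr => n _ do rewrite mulr0 oppr0 e2pi0.
    by rewrite sumr_const_nat subn1 /= rmorph_nat.
  apply: eq_bigr => s sr; rewrite (eq_sym r) (negPf sr).
  have s0 : sin (pi * (x r - x s)) != 0 by apply: (sin_sep_neq0 delta_gt0 separated); rewrite eq_sym.
  have := sum_e2pi_geometric M (x r - x s); rewrite -/(g r s) rmorphM /= fmorphV.
  have sC : (sin (pi * (x r - x s)))%:C%C != 0 :> C by rewrite fmorph_eq0.
  have cE c : u r * e2pi (- (c * x r)) * (sin (pi * (x r - x s)))%:C%C^-1 * (u s * e2pi (- (c * x s)))^*
     = u r * (u s)^* * (sin (pi * (x r - x s)))%:C%C^-1 * e2pi (- (c * (x r - x s))).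
    have -> : - (c * (x r - x s)) = - (c * x r) + c * x s by ring.
    by rewrite e2piD rmorphM /= conj_e2pi opprK; ring.
  rewrite !cE; move: (g r s) (e2pi _) (e2pi _) ((sin _)%:C%C) sC (u r * _) => G e1 e2 sn sn0 w H.
  move: sc0 H; move: ((-2)%:C%C) ('i%C) => a b ab H.
  have [a0 b0] : a != 0 /\ b != 0 by move: ab; rewrite mulf_eq0 negb_or => /andP.
  apply: (mulfI (mulf_neq0 ab sn0)); transitivity (w * (e2 - e1)); last by field_nz.
  by rewrite -H; ring.
have nsc : `|((-2)%:C%C * 'i%C : C)^-1| = (2^-1)%:C%C.
  rewrite normfV normrM !normc_def /= !expr0n /= addr0 add0r expr1n sqrtr1 mulr1 sqrtr_sqr normrN.
  by rewrite ger0_norm // fmorphV.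
have S0 : 0 <= \sum_r `|u r| ^+ 2 :> C by apply: sumr_ge0 => r _; rewrite exprn_ge0.
have -> : \sum_(1 <= n < M.+1) `|\sum_r u r * e2pi (- (n%:R * x r))| ^+ 2
    = `|\sum_(1 <= n < M.+1) `|\sum_r u r * e2pi (- (n%:R * x r))| ^+ 2|.
  by rewrite ger0_norm //; apply: sumr_ge0 => n _; rewrite exprn_ge0.
rewrite E0 E1; apply: le_trans (ler_normD _ _) _.
rewrite rmorphD mulrDl lerD //.
  by rewrite normrM (ger0_norm S0) ler_wpM2r // ger0_norm // ler0c.
rewrite normrM nsc; apply: (@le_trans _ _ ((2^-1)%:C%C * (((delta^-1)%:C%C * \sum_r `|u r| ^+ 2) *+ 2))).
  rewrite ler_wpM2l ?ler0c ?invr_ge0 // mulr2n; apply: le_trans (ler_normB _ _) _.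
  by rewrite lerD // qle.
rewrite mulrnAr -mulrnAl -rmorphMn (_ : 2^-1 *+ 2 = 1 :> R) ?rmorph1 ?mul1r //.
by rewrite mulr2n; lra.
Qed.

(** With D the constant, A the norm of [a], T the left side and w_n the dual sums with coefficients
    S_r, expanding the sum of |D a_n - w_n|^2 >= 0 gives 2 D T <= D^2 A + sum |w_n|^2. The last sum
    is at most D T by the dual inequality. *)
Theorem large_sieve (M : nat) (a : nat -> C) :
  \sum_r `|\sum_(1 <= n < M.+1) a n * e2pi (n%:R * x r)| ^+ 2
  <= (M%:R + delta^-1)%:C%C * \sum_(1 <= n < M.+1) `|a n| ^+ 2.
Proof.
set D := (M%:R + delta^-1)%:C%C; pose S r := \sum_(1 <= n < M.+1) a n * e2pi (n%:R * x r).
set A := \sum_(1 <= n < M.+1) `|a n| ^+ 2; set T := \sum_r _.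
have D0 : 0 < D by rewrite -[0]/((0 : R)%:C%C) ltcR ltr_wpDl // invr_gt0.
have Dc : D^* = D by rewrite conj_Creal // gtr0_real.
have Tc : \sum_(1 <= n < M.+1) a n * (\sum_r (S r)^* * e2pi (n%:R * x r)) = T.
  rewrite /T; under eq_bigr => n _ do rewrite mulr_sumr.
  rewrite exchange_big; apply: eq_bigr => r _ /=; rewrite normCK -/(S r) {2}/S mulr_suml.
  by apply: eq_bigr => n _; ring.
have Treal : T^* = T by rewrite conj_Creal // ger0_real // sumr_ge0 // => r _; rewrite exprn_ge0.
pose w n := \sum_r S r * e2pi (- (n%:R * x r)).
have wc n : (w n)^* = \sum_r (S r)^* * e2pi (n%:R * x r).
  by rewrite /w rmorph_sum; apply: eq_bigr => r _; rewrite rmorphM /= conj_e2pi opprK.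
have key : 0 <= D ^+ 2 * A - D * T - D * T + \sum_(1 <= n < M.+1) `|w n| ^+ 2.
  have -> : D ^+ 2 * A - D * T - D * T + \sum_(1 <= n < M.+1) `|w n| ^+ 2
     = \sum_(1 <= n < M.+1) `|D * a n - w n| ^+ 2.
    transitivity (\sum_(1 <= n < M.+1) (D ^+ 2 * `|a n| ^+ 2 - D * (a n * (w n)^*)
       - D * (a n * (w n)^*)^* + `|w n| ^+ 2)).
      rewrite big_split /= !sumrB -!mulr_sumr -/A -rmorph_sum /=.
      by under [\sum_(1 <= n < M.+1) a n * _]eq_bigr => n _ do rewrite wc; rewrite Tc Treal.
    by apply: eq_bigr => n _; rewrite !normCK !rmorphB !rmorphM /= conjCK Dc; ring.
  by apply: sumr_ge0 => n _; rewrite exprn_ge0.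
have dl : \sum_(1 <= n < M.+1) `|w n| ^+ 2 <= D * T by apply: dual_large_sieve.
rewrite -(ler_pM2l D0) mulrA -expr2 -subr_ge0.
apply: le_trans key _; rewrite -subr_ge0.
by rewrite (_ : _ - _ = D * T - \sum_(1 <= n < M.+1) `|w n| ^+ 2) ?subr_ge0 //; ring.
Qed.

End LargeSieve.

(** * Squarefree integers and reindexing of sums *)

Section SquarefreeSums.

(** Computable from the list of prime factors, because the numerical tables evaluate it. *)
Definition sqf (n : nat) : bool := all (fun p => ~~ (p %| n %/ p))%N (primes n).

Lemma sqfP n : (0 < n)%N -> reflect (forall p, prime p -> ~~ (p * p %| n)%N) (sqf n).
Proof.
move=> n0; apply: (iffP allP) => h p.
  move=> pp; case: (boolP (p %| n)%N) => pn.
    by rewrite -dvdn_divRL // h // mem_primes pp n0.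
  by apply: contraNN pn; apply: dvdn_trans; apply: dvdn_mulr.
by rewrite mem_primes => /and3P[pp _ pn]; rewrite dvdn_divRL // h.
Qed.

Lemma sqf_primeM p r : prime p -> (0 < r)%N -> sqf (p * r) = ~~ (p %| r)%N && sqf r.
Proof.
move=> pp r0; have p0 := prime_gt0 pp; have pr0 : (0 < p * r)%N by rewrite muln_gt0 p0.
apply/sqfP/andP => // [h|[npr /(sqfP r0) h] q qp].
  split; first by have := h p pp; rewrite dvdn_pmul2l.
  by apply/sqfP => // q qp; apply: contra (h q qp); apply: dvdn_mull.
have [->|qp'] := eqVneq q p; first by rewrite dvdn_pmul2l.
rewrite Gauss_dvdr ?h //; rewrite coprimeMl; apply/andP.
by split; rewrite prime_coprime // dvdn_prime2.
Qed.

Lemma big_dvdn_reindex (R : Type) (idx : R) (op : Monoid.com_law idx) (p N : nat)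
    (P : pred nat) (F : nat -> R) : (0 < p)%N ->
  \big[op/idx]_(1 <= n < N.+1 | (p %| n)%N && P n) F n
  = \big[op/idx]_(1 <= m < (N %/ p).+1 | P (p * m)%N) F (p * m)%N.
Proof.
move=> p0; rewrite -[LHS]big_filter -[RHS]big_filter.
rewrite -(big_map (muln p) xpredT F); apply: perm_big; apply: uniq_perm.
- by rewrite filter_uniq // iota_uniq.
- rewrite map_inj_uniq ?filter_uniq ?iota_uniq // => i j /eqP.
  by rewrite eqn_pmul2l // => /eqP.
move=> n; rewrite mem_filter mem_index_iota; apply/idP/mapP => [|[ m ]].
  case/andP => /andP[/dvdnP[m ->] Pm] /andP[n1 nN]; exists m; last by rewrite mulnC.
  rewrite mem_filter mulnC Pm mem_index_iota /=.
  apply/andP; split; first by move: n1; rewrite muln_gt0 => /andP[].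
  by rewrite ltnS leq_divRL.
rewrite mem_filter mem_index_iota => /andP[Pm /andP[m1 mN]] ->.
by rewrite dvdn_mulr // Pm muln_gt0 p0 m1 /= ltnS mulnC -leq_divRL.
Qed.

Lemma big_nat_extend (R : Type) (idx : R) (op : Monoid.com_law idx) (N M : nat)
    (P : pred nat) (F : nat -> R) : (N <= M)%N ->
  (forall n, (N < n)%N -> P n -> (n <= M)%N -> F n = idx) ->
  \big[op/idx]_(1 <= n < M.+1 | P n) F n = \big[op/idx]_(1 <= n < N.+1 | P n) F n.
Proof.
move=> NM h; rewrite (big_cat_nat (n := N.+1)) //= [X in op _ X]big_nat_cond [X in op _ X]big1 ?Monoid.mulm1 //.
by move=> n /andP[/andP[Nn nM] Pn]; apply: h.
Qed.

Definition Gn (R : realType) (d N : nat) : R :=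
  \sum_(1 <= r < N.+1 | sqf r && coprime r d) (totient r)%:R^-1.

End SquarefreeSums.

(** * Ramanujan sums as kernels *)

Section Ramanujan.
Variable R : realType.
Local Notation C := R[i].
Local Notation "z ^*" := (Num.conj z).

(** The Ramanujan sum c_q(n - n'), written as a kernel in two variables so that its Gram
    decomposition is visible. *)
Definition ram (q n n' : nat) : C :=
  \sum_(b < q | coprime b q) e2pi (b%:R / q%:R * n%:R) * (e2pi (b%:R / q%:R * n'%:R))^*.

Lemma ram1 n n' : ram 1 n n' = 1.
Proof. by rewrite /ram big_mkcond big_ord1 /= !mul0r e2pi0 conjC1 mulr1. Qed.

Lemma e2pi_shift (t : R) (m n : nat) : e2pi ((t + m%:R) * n%:R) = e2pi (t * n%:R).
Proof. by rewrite mulrDl e2piD -natrM e2pi_nat mulr1. Qed.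

Lemma modn_mul_inj q1 q2 b c : coprime q1 q2 -> (b < q1)%N -> (c < q1)%N ->
  b * q2 = c * q2 %[mod q1] -> b = c.
Proof.
move=> cop; wlog cb : b c / (c <= b)%N.
  by move=> H; case/orP: (leq_total c b) => h *; [|apply/esym]; apply: H.
move=> bq cq /eqP; rewrite eqn_mod_dvd ?leq_mul2r ?cb ?orbT // -mulnBl Gauss_dvdl // => d.
apply/eqP; rewrite eqn_leq cb andbT -subn_eq0; apply: contraTT d => d0.
by rewrite gtnNdvd ?lt0n // (leq_ltn_trans (leq_subr _ _)).
Qed.

(** Chinese remainder theorem: b = b1 q2 + b2 q1 runs over the residues mod q1 q2, and b / (q1 q2) =
    b1 / q1 + b2 / q2 modulo 1. *)
Lemma ramM q1 q2 n n' : (0 < q1)%N -> (0 < q2)%N -> coprime q1 q2 ->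
  ram (q1 * q2) n n' = ram q1 n n' * ram q2 n n'.
Proof.
move=> q10 q20 cop; have q0 : (0 < q1 * q2)%N by rewrite muln_gt0 q10.
pose h (b : 'I_q1 * 'I_q2) : 'I_(q1 * q2) := Ordinal (ltn_pmod (b.1 * q2 + b.2 * q1) q0).
have hinj : injective h.
  move=> [b1 b2] [c1 c2] /(congr1 val) /= E; congr (_, _); apply: val_inj => /=.
    have : b1 * q2 = c1 * q2 %[mod q1].
      have := congr1 (fun m => (m %% q1)%N) E; rewrite !(modn_dvdm _ (dvdn_mulr q2 (dvdnn q1))).
      by rewrite ![(_ + _ * q1)%N]addnC !modnMDl.
    by apply: modn_mul_inj.
  have : b2 * q1 = c2 * q1 %[mod q2].
    have := congr1 (fun m => (m %% q2)%N) E; rewrite !(modn_dvdm _ (dvdn_mull q1 (dvdnn q2))).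
    by rewrite !modnMDl.
  by apply: modn_mul_inj => //; rewrite coprime_sym.
have hbij : bijective h by apply: inj_card_bij => //; rewrite card_prod !card_ord.
rewrite /ram (reindex h) /=; last exact: onW_bij.
rewrite big_distrlr pair_big /=; apply: eq_big => [[b1 b2]|[b1 b2] _] /=.
  rewrite coprime_modl coprimeMr /coprime; congr (_ && _).
    by rewrite -/(coprime _ _) -(coprime_modl _ q1) [(_ + b2 * q1)%N]addnC modnMDl coprime_modl coprimeMl
       [coprime q2 q1]coprime_sym cop andbT.
  by rewrite -/(coprime _ _) -(coprime_modl _ q2) modnMDl coprime_modl coprimeMl cop andbT.
have E m : e2pi (((b1 * q2 + b2 * q1) %% (q1 * q2))%N%:R / (q1 * q2)%:R * m%:R)
    = e2pi (b1%:R / q1%:R * m%:R) * e2pi (b2%:R / q2%:R * m%:R) :> C.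
  rewrite -e2piD -(e2pi_shift _ ((b1 * q2 + b2 * q1) %/ (q1 * q2))); congr e2pi.
  have nz1 : q1%:R != 0 :> R by rewrite pnatr_eq0 -lt0n.
  have nz2 : q2%:R != 0 :> R by rewrite pnatr_eq0 -lt0n.
  have : (b1 * q2 + b2 * q1)%:R = ((b1 * q2 + b2 * q1) %/ (q1 * q2) * (q1 * q2)
     + (b1 * q2 + b2 * q1) %% (q1 * q2))%:R :> R by rewrite -divn_eq.
  rewrite !natrD !natrM; move: (_ %/ _)%N (_ %% _)%N => d e E.
  rewrite -mulrDl; congr (_ * _); apply: (mulIf (mulf_neq0 nz1 nz2)).
  by rewrite mulrDl mulfVK ?mulf_neq0 // addrC -E; field_nz.
by rewrite !E rmorphM /=; ring.
Qed.

Lemma e2pi_eq1 (n p : nat) : (0 < p)%N -> e2pi (n%:R / p%:R : R) = 1 -> (p %| n)%N.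
Proof.
move=> p0 /eqP; rewrite eq_complex /= => /andP[/eqP c1 _].
have s0 : sin (pi * (n%:R / p%:R : R)) = 0.
  move: c1; rewrite -mulrA mulrC mulr_natr cos_mulr2n => c1.
  have := cos2Dsin2 (pi * (n%:R / p%:R : R)).
  move: c1; rewrite -[_ *+ 2]mulr_natl; move: (cos _) (sin _) => c s c1 cs.
  by apply/eqP; rewrite -sqrf_eq0; apply/eqP; lra.
have := sin_pi_eq0 s0; rewrite /nearest_dist => /eqP; rewrite subr_eq0 => /eqP.
move: (Num.floor _) => m E.
have nz : p%:R != 0 :> R by rewrite pnatr_eq0 -lt0n.
have E2 : n%:R = m%:~R * p%:R :> R by rewrite -E mulfVK.
have {}E2 : (n%:Z = m * p%:Z)%R by apply: (@intr_inj R); rewrite rmorphM.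
have : (p%:Z %| n%:Z)%Z by rewrite E2 dvdz_mull.
by [].
Qed.

Lemma sum_e2pi_prime p n : prime p -> ~~ (p %| n)%N ->
  \sum_(b < p | coprime b p) e2pi (b%:R / p%:R * n%:R) = -1 :> C.
Proof.
move=> pp pn; have p0 := prime_gt0 pp.
have nz : p%:R != 0 :> R by rewrite pnatr_eq0 -lt0n.
have w1 : e2pi (n%:R / p%:R : R) - 1 != 0.
  by rewrite subr_eq0; apply: contra pn => /eqP; apply: e2pi_eq1.
have powE (b : nat) : e2pi (b%:R / p%:R * n%:R : R) = e2pi (n%:R / p%:R) ^+ b.
  elim: b => [|b IH]; first by rewrite !mul0r e2pi0.
  by rewrite exprS -IH -e2piD -natr1; congr e2pi; field.
have all0 : \sum_(b < p) e2pi (b%:R / p%:R * n%:R) = 0 :> C.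
  apply: (mulfI w1); rewrite mulr0; under eq_bigr => b _ do rewrite powE.
  rewrite -subrX1 -powE mulfV // mul1r e2pi_nat subrr //.
have cE (b : 'I_p) : coprime b p = (b != Ordinal p0).
  rewrite coprime_sym prime_coprime // -val_eqE /=; congr (~~ _).
  by case: b => [[|b] bp] /=; rewrite ?dvdn0 ?eqxx // gtnNdvd.
rewrite (eq_bigl _ _ cE); apply/eqP; rewrite -subr_eq0 opprK addrC.
by have := all0; rewrite (bigD1 (Ordinal p0)) //= !mul0r e2pi0 => /eqP.
Qed.

End Ramanujan.

(** * Positive semidefinite kernels and the comparison of Farey energies *)

Section SieveComparison.
Variable R : realType.
Local Notation C := R[i].
Local Notation "z ^*" := (Num.conj z).
Local Notation ram := (@ram R).

(* Positive semidefiniteness of a kernel on the set P, in the form of an explicit Gram decomposition. *)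
Definition psd (P : nat -> Prop) (K : nat -> nat -> C) :=
  exists (I : finType) (f : I -> nat -> C),
    forall n n', P n -> P n' -> K n n' = \sum_i f i n * (f i n')^*.

(** Schur product: the Gram vectors are replaced by their tensor products. *)
Lemma psdM (P : nat -> Prop) K L : psd P K -> psd P L -> psd P (fun n n' => K n n' * L n n').
Proof.
move=> [I [f fE]] [J [g gE]]; exists (I * J)%type, (fun ij n => f ij.1 n * g ij.2 n) => n n' Pn Pn'.
rewrite fE // gE // big_distrlr pair_big /=; apply: eq_bigr => -[i j] _ /=.
by rewrite rmorphM /=; ring.
Qed.

Lemma psd1 (P : nat -> Prop) : psd P (fun _ _ => 1).
Proof. by exists unit, (fun _ _ => 1) => n n' _ _; rewrite big_const card_unit /= conjC1 mulr1 addr0. Qed.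

Lemma psd_ext (P : nat -> Prop) K L : (forall n n', P n -> P n' -> K n n' = L n n') -> psd P K -> psd P L.
Proof. by move=> h [I [f fE]]; exists I, f => n n' Pn Pn'; rewrite -h // fE. Qed.

(** The kernel of p^v is [kp] plus, for v = 1 only, the constant 1 / phi(p). The split isolates the
    part of the energy that sifting by p forces. *)
Definition kp (p v n n' : nat) : C := ram (p ^ v) n n' - (v == 1%N)%:R / (p%:R - 1).

Lemma ram_psd P q : psd P (ram q).
Proof.
exists 'I_q, (fun (b : 'I_q) (n : nat) => (coprime b q)%:R * e2pi (b%:R / q%:R * n%:R)) => n n' _ _.
rewrite /ram big_mkcond; apply: eq_bigr => b _; case: ifP => _.
  by rewrite !mul1r.
by rewrite !mul0r.
Qed.

(* For n prime to p the functions b |-> e(bn/p), b = 1, ..., p - 1, sum to -1; so recentering them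
   by 1/(p - 1) subtracts exactly 1/(p - 1) from the kernel. *)
Lemma kp_psd (P : nat -> Prop) p v : prime p -> (forall n, P n -> ~~ (p %| n)%N) -> psd P (kp p v).
Proof.
move=> pp Pp; have [->|v1] := eqVneq v 1%N; last first.
  apply: (psd_ext _ (ram_psd P (p ^ v))) => n n' _ _.
  by rewrite /kp (negPf v1) mul0r subr0.
pose c : C := (p%:R - 1)^-1.
have p1 : p%:R - 1 != 0 :> C.
  by rewrite subr_eq0 pnatr_eq1; apply: contraTneq pp => ->.
exists 'I_p, (fun (b : 'I_p) (n : nat) => (coprime b p)%:R * (e2pi (b%:R / p%:R * n%:R) + c)) => n n' /Pp pn /Pp pn'.
have cc : c^* = c by rewrite /c fmorphV rmorphB rmorph_nat rmorph1.
transitivity (\sum_(b < p | coprime b p) (e2pi (b%:R / p%:R * n%:R) + c) * (e2pi (b%:R / p%:R * n'%:R) + c)^*); last first.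
  rewrite [LHS]big_mkcond; apply: eq_bigr => b _; case: ifP => _.
    by rewrite !mul1r.
  by rewrite !mul0r.
transitivity (\sum_(b < p | coprime b p) (e2pi (b%:R / p%:R * n%:R) * (e2pi (b%:R / p%:R * n'%:R))^*
   + c * (e2pi (b%:R / p%:R * n%:R)) + c * (e2pi (b%:R / p%:R * n'%:R))^* + c ^+ 2)); last first.
  by apply: eq_bigr => b _; rewrite rmorphD /= cc; ring.
rewrite !big_split /= -!mulr_sumr -(rmorph_sum Num.conj) /= !sum_e2pi_prime // rmorphN1.
rewrite sumr_const; have -> : #|[pred b : 'I_p | coprime b p]| = p.-1.
  rewrite -totient_prime // totient_count_coprime -sum1_card big_mkcond big_mkord.
  by apply: eq_bigr => b _; rewrite inE coprime_sym; case: coprime.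
have pE : p%:R - 1 = p.-1%:R :> C by rewrite -{1}(prednK (prime_gt0 pp)) -natr1 addrK.
rewrite /kp expn1 eqxx /ram -[c *+ _]mulr_natr /c pE; rewrite pE in p1.
rewrite -[true%:R]/(1 : C).
by move: (\sum_(b < p | _) _) => S; field.
Qed.

Definition kd (d n n' : nat) : C := \prod_(p <- primes d) kp p (logn p d) n n'.

Lemma kd_psd (P : nat -> Prop) d : (forall p n, prime p -> (p %| d)%N -> P n -> ~~ (p %| n)%N) ->
  psd P (kd d).
Proof.
move=> h; rewrite /kd.
have : {subset primes d <= primes d} by [].
elim: {1 3}(primes d) => [|p s IH] sub.
  by apply: psd_ext (psd1 P) => n n' _ _; rewrite big_nil.
apply: (psd_ext (K := fun n n' => kp p (logn p d) n n' * \prod_(q <- s) kp q (logn q d) n n')).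
  by move=> n n' _ _; rewrite big_cons.
apply: psdM; last by apply: IH => q qs; apply: sub; rewrite inE qs orbT.
have := sub p (mem_head _ _); rewrite mem_primes => /and3P[pp _ pd].
by apply: kp_psd => // n Pn; apply: h pp pd Pn.
Qed.

Lemma kd_primeM p v m n n' : prime p -> (0 < v)%N -> (0 < m)%N -> ~~ (p %| m)%N ->
  kd (p ^ v * m) n n' = kp p v n n' * kd m n n'.
Proof.
move=> pp v0 m0 pm; have p0 := prime_gt0 pp; have pv0 : (0 < p ^ v)%N by rewrite expn_gt0 p0.
rewrite /kd (perm_big (p :: primes m)) /=; last first.
  apply: uniq_perm; rewrite ?primes_uniq //=.
    by rewrite primes_uniq andbT mem_primes (negPf pm) !andbF.
  by move=> q; rewrite primesM // primesX // primes_prime // mem_seq1 inE.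
rewrite big_cons lognM // pfactorK // (lognE p m) (negPf pm) !andbF addn0; congr (_ * _).
apply: eq_big_seq => q; rewrite mem_primes => /and3P[qp _ qm].
rewrite lognM // lognX logn_prime // (_ : q == p = false) ?muln0 //.
by apply: contraNF pm => /eqP <-.
Qed.

(** The squarefree unitary divisors of q, that is, the products of primes that divide q exactly
    once. They index the terms when the product over the primes of q is expanded. *)
Definition sqf_codiv (q r : nat) := [&& (r %| q)%N, sqf r & coprime r (q %/ r)].

Lemma sqf_codiv_coprime p v m r : prime p -> (0 < v)%N -> (0 < m)%N -> ~~ (p %| m)%N -> (0 < r)%N ->
  ~~ (p %| r)%N && sqf_codiv (p ^ v * m) r = sqf_codiv m r.
Proof.
move=> pp v0 m0 pm r0; apply/idP/idP.
  case/and4P => pr rq sr cop.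
  have cpr : coprime r (p ^ v) by rewrite coprime_sym coprimeXl // prime_coprime.
  have rm : (r %| m)%N by rewrite -(Gauss_dvdr _ cpr).
  by rewrite /sqf_codiv rm sr; move: cop; rewrite -muln_divA // coprimeMr => /andP[].
case/and3P => rm sr cop; have pr : ~~ (p %| r)%N by apply: contra pm => /dvdn_trans; apply.
rewrite pr /sqf_codiv dvdn_mull // sr -muln_divA // coprimeMr cop andbT.
by rewrite coprime_sym coprimeXl // prime_coprime.
Qed.

Lemma sqf_codiv_dvd p v m r : prime p -> (0 < v)%N -> (0 < m)%N -> ~~ (p %| m)%N -> (0 < r)%N ->
  sqf_codiv (p ^ v * m) (p * r) = (v == 1%N) && sqf_codiv m r.
Proof.
move=> pp v0 m0 pm r0; have p0 := prime_gt0 pp.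
rewrite /sqf_codiv sqf_primeM // -(prednK v0) expnS -mulnA dvdn_pmul2l // divnMl // prednK //.
have [->|v1] := eqVneq v 1%N.
  rewrite /= expn0 mul1n; have [rm|] := boolP (r %| m)%N => //=.
  have pr : ~~ (p %| r)%N by apply: contra pm => /dvdn_trans; apply.
  rewrite pr coprimeMl /= [coprime p _]prime_coprime // (_ : (p %| m %/ r)%N = false) //.
  by apply: contraNF pm => /dvdn_trans; apply; apply: dvdn_div.
apply/negP => /and3P[rq /andP[pr sr]]; rewrite coprimeMl prime_coprime // => /andP[].
have cpr : coprime r (p ^ v.-1) by rewrite coprime_sym coprimeXl // prime_coprime.
rewrite Gauss_dvdr // in rq; rewrite -muln_divA // dvdn_mulr //.
by rewrite dvdn_exp // -subn1 subn_gt0 ltn_neqAle eq_sym v1.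
Qed.

(** Multiply out the product over p^v || q of [kp] plus (for v = 1) 1 / phi(p): r collects the
    primes where the constant is chosen. The induction removes the full power of the least prime of
    q; E1 and E2 are the terms with p not dividing r and with p dividing r. *)
Lemma ram_decomposition q n n' : (0 < q)%N ->
  ram q n n' = \sum_(1 <= r < q.+1 | sqf_codiv q r) kd (q %/ r) n n' / (totient r)%:R.
Proof.
elim/ltn_ind: q => q IH q0; have [q1|q1] := leqP q 1.
  have -> : q = 1%N by apply/eqP; rewrite eqn_leq q1.
  rewrite ram1 big_mkcond big_nat1 /= /sqf_codiv /= divn1.
  by rewrite /kd big_nil divr1.
pose p := pdiv q; have pp : prime p by apply: pdiv_prime.
have pq : (p %| q)%N by apply: pdiv_dvd.
pose v := logn p q; have v0 : (0 < v)%N by rewrite logn_gt0 mem_primes pp q0.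
pose m := (q %/ p ^ v)%N; have p0 := prime_gt0 pp; have pv0 : (0 < p ^ v)%N by rewrite expn_gt0 p0.
have qE : q = (p ^ v * m)%N by rewrite /m mulnC divnK // pfactor_dvdnn.
have m0 : (0 < m)%N by move: q0; rewrite qE muln_gt0 => /andP[].
have pm : ~~ (p %| m)%N by have [m' cm' E] := pfactor_coprime pp q0; rewrite /m {1}E mulnK // -prime_coprime.
have mq : (m < q)%N by rewrite qE -[X in (X < _)%N]mul1n ltn_pmul2r // -(exp1n v) ltn_exp2r // prime_gt1.
have E1 : \sum_(1 <= r < q.+1 | ~~ (p %| r)%N && sqf_codiv q r) kd (q %/ r) n n' / (totient r)%:R
   = kp p v n n' * ram m n n'.
  rewrite (IH m mq m0) mulr_sumr (@big_nat_extend _ _ _ m q) ?(ltnW mq) //; last first.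
    move=> r mr /andP[pr]; rewrite qE => h _.
    have r0 : (0 < r)%N by apply: leq_ltn_trans mr.
    have : sqf_codiv m r by rewrite -(@sqf_codiv_coprime p v) // pr.
    by case/and3P => /(dvdn_leq m0) h' _ _; move: (leq_trans mr h'); rewrite ltnn.
  rewrite big_nat_cond [RHS]big_nat_cond; apply: eq_big => [r|r].
    by case: (posnP r) => [->|r0] //; rewrite qE sqf_codiv_coprime.
  case/andP => /andP[r0 _]; rewrite qE sqf_codiv_coprime // => /and3P[rm _ _].
  have mr0 : (0 < m %/ r)%N by rewrite divn_gt0 // dvdn_leq.
  have pmr : ~~ (p %| m %/ r)%N by apply: contra pm => /dvdn_trans; apply; apply: dvdn_div.
  by rewrite -(muln_divA _ rm) (kd_primeM _ _ pp v0 mr0 pmr) mulrA.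
have E2 : \sum_(1 <= r < q.+1 | (p %| r)%N && sqf_codiv q r) kd (q %/ r) n n' / (totient r)%:R
   = (v == 1%N)%:R / (p%:R - 1) * ram m n n'.
  rewrite big_dvdn_reindex //; have [v1|v1] := eqVneq v 1%N; last first.
    rewrite mul0r mul0r big_nat_cond big1 // => r /andP[/andP[r0 _]].
    by rewrite {1}qE sqf_codiv_dvd // (negPf v1).
  have qpm : (q %/ p)%N = m by rewrite {1}qE v1 expn1 mulKn.
  rewrite qpm (IH m mq m0) mulr_sumr big_nat_cond [RHS]big_nat_cond; apply: eq_big => [r|r].
    by case: (posnP r) => [->|r0] //; rewrite {1}qE sqf_codiv_dvd // v1.
  case/andP => /andP[r0 _]; rewrite {1}qE sqf_codiv_dvd // => /andP[_ /and3P[rm _ _]].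
  have pr : ~~ (p %| r)%N by apply: contra pm => /dvdn_trans; apply.
  rewrite {1}qE v1 expn1 divnMl // totient_coprime ?prime_coprime // totient_prime //.
  rewrite natrM (_ : p%:R - 1 = p.-1%:R :> C); last by rewrite -(prednK p0) -natr1 addrK.
  by rewrite -[true%:R]/(1 : C) invfM; ring.
rewrite (bigID (fun r => (p %| r)%N)) /=.
under eq_bigl => r do rewrite andbC.
under [X in _ + X]eq_bigl => r do rewrite andbC.
rewrite E1 E2 -mulrDl addrC /kp subrK -ramM //; first by rewrite -qE.
by rewrite coprimeXl // prime_coprime.
Qed.

(** Write q = d r. For fixed d the admissible r are the squarefree r <= X / d prime to d, and [kd d]
    does not depend on r or X; so X enters only through [Gn]. *)
Lemma sum_ram_decomposition (X : nat) n n' :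
  \sum_(1 <= q < X.+1) ram q n n' = \sum_(1 <= d < X.+1) kd d n n' * (Gn R d (X %/ d))%:C%C.
Proof.
transitivity (\sum_(1 <= r < X.+1) \sum_(1 <= q < X.+1 | (r %| q)%N && (sqf r && coprime r (q %/ r)))
   kd (q %/ r) n n' / (totient r)%:R).
  transitivity (\sum_(1 <= q < X.+1) \sum_(1 <= r < X.+1 | sqf_codiv q r) kd (q %/ r) n n' / (totient r)%:R).
    rewrite big_nat [RHS]big_nat; apply: eq_bigr => q /andP[q0 qX].
    rewrite ram_decomposition // (@big_nat_extend _ _ _ q X) //.
    by move=> r qr /and3P[/(dvdn_leq q0) h _ _]; move: (leq_trans qr h); rewrite ltnn.
  by rewrite (exchange_big_dep xpredT).
transitivity (\sum_(1 <= r < X.+1) \sum_(1 <= d < X.+1 | (d * r <= X)%N && (sqf r && coprime r d))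
   kd d n n' / (totient r)%:R).
  rewrite big_nat [RHS]big_nat; apply: eq_bigr => r /andP[r0 _].
  rewrite big_dvdn_reindex // (@big_nat_extend _ _ _ (X %/ r) X) ?leq_div //; last first.
    by move=> d; rewrite ltn_divLR // => h /andP[]; rewrite leqNgt h.
  rewrite big_nat_cond [RHS]big_nat_cond; apply: eq_big => [d|d]; rewrite mulKn //.
  by case: (posnP d) => [->|d0] //=; rewrite ltnS leq_divRL //; case: leqP; rewrite ?andbF ?andbT.
rewrite (exchange_big_dep xpredT) //= big_nat [RHS]big_nat; apply: eq_bigr => d /andP[d0 _].
rewrite /Gn rmorph_sum mulr_sumr.
rewrite (@big_nat_extend _ _ _ (X %/ d) X) ?leq_div //; last first.
  by move=> r; rewrite ltn_divLR // mulnC => h /andP[]; rewrite leqNgt h.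
rewrite big_nat_cond [RHS]big_nat_cond; apply: eq_big => [r|r _].
  by rewrite ltnS leq_divRL // [(r * d)%N]mulnC; case: (leqP (d * r)%N X); rewrite ?andbF ?andbT.
by rewrite fmorphV rmorph_nat.
Qed.

Variables (M : nat) (a : nat -> C).

Definition energy (q : nat) : C :=
  \sum_(b < q | coprime b q) `|\sum_(1 <= n < M.+1) a n * e2pi (b%:R / q%:R * n%:R)| ^+ 2.

Definition quad (K : nat -> nat -> C) : C :=
  \sum_(1 <= n < M.+1) \sum_(1 <= n' < M.+1) a n * (a n')^* * K n n'.

Lemma energyE q : energy q = quad (ram q).
Proof.
rewrite /quad /ram; under eq_bigr => n _ do under eq_bigr => n' _ do rewrite mulr_sumr.
under eq_bigr => n _ do rewrite exchange_big /=.
rewrite exchange_big /=; apply: eq_bigr => b _; rewrite normCK rmorph_sum mulr_suml.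
apply: eq_bigr => n _; rewrite mulr_sumr; apply: eq_bigr => n' _.
by rewrite rmorphM /=; ring.
Qed.

Lemma quad_psd_ge0 (P : nat -> Prop) K : (forall n, (0 < n)%N -> a n != 0 -> P n) -> psd P K -> 0 <= quad K.
Proof.
move=> aP [I [f fE]].
suff -> : quad K = \sum_i `|\sum_(1 <= n < M.+1) a n * f i n| ^+ 2.
  by apply: sumr_ge0 => i _; rewrite exprn_ge0.
transitivity (\sum_i \sum_(1 <= n < M.+1) \sum_(1 <= n' < M.+1) a n * (a n')^* * (f i n * (f i n')^*)).
  rewrite [RHS]exchange_big /= /quad [LHS]big_nat [RHS]big_nat; apply: eq_bigr => n /andP[n0 _].
  rewrite [RHS]exchange_big /= [LHS]big_nat [RHS]big_nat; apply: eq_bigr => n' /andP[n'0 _].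
  have [->|an] := eqVneq (a n) 0; first by rewrite !mul0r big1 // => i _; rewrite !mul0r.
  have [->|an'] := eqVneq (a n') 0.
    by rewrite conjC0 mulr0 !mul0r big1 // => i _; rewrite !mul0r.
  by rewrite fE ?mulr_sumr //; apply: aP.
apply: eq_bigr => i _; rewrite normCK rmorph_sum mulr_suml; apply: eq_bigr => n _.
by rewrite mulr_sumr; apply: eq_bigr => n' _; rewrite rmorphM /=; ring.
Qed.

Lemma sum_energy (X : nat) :
  \sum_(1 <= q < X.+1) energy q = \sum_(1 <= d < X.+1) (Gn R d (X %/ d))%:C%C * quad (kd d).
Proof.
transitivity (quad (fun n n' => \sum_(1 <= q < X.+1) ram q n n')).
  under eq_bigr => q _ do rewrite energyE.
  rewrite /quad exchange_big /=; apply: eq_bigr => n _; rewrite exchange_big /=.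
  by apply: eq_bigr => n' _; rewrite mulr_sumr.
rewrite /quad; under eq_bigr => n _ do under eq_bigr => n' _ do rewrite sum_ram_decomposition mulr_sumr.
under eq_bigr => n _ do rewrite exchange_big /=.
rewrite exchange_big /=; apply: eq_bigr => d _; rewrite mulr_sumr; apply: eq_bigr => n _.
by rewrite mulr_sumr; apply: eq_bigr => n' _; ring.
Qed.

Lemma Gn_ge0 d N : 0 <= Gn R d N.
Proof. by apply: sumr_ge0 => r _; rewrite invr_ge0. Qed.

Theorem sieve_comparison (K0 K : nat) (rho : R) : (K0 <= K)%N ->
  (forall n p, (0 < n)%N -> a n != 0 -> prime p -> (p <= K)%N -> ~~ (p %| n)%N) ->
  0 <= rho ->
  (forall d, (0 < d)%N -> (d <= K0)%N -> Gn R d (K0 %/ d) <= rho * Gn R d (K %/ d)) ->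
  \sum_(1 <= q < K0.+1) energy q <= rho%:C%C * \sum_(1 <= q < K.+1) energy q.
Proof.
move=> K0K sieved rho0 hG; rewrite !sum_energy.
(* Every prime of d is at most K, so [a] is supported on integers prime to d. This holds up to K and
   not only up to K0, which is why the terms K0 < d <= K may be dropped at the end. *)
have T0 d : (0 < d <= K)%N -> 0 <= quad (kd d).
  move=> /andP[d0 dK]; apply: (@quad_psd_ge0 (fun n => forall p, prime p -> (p <= K)%N -> ~~ (p %| n)%N)).
    by move=> n n0 an p; apply: sieved.
  by apply: kd_psd => p n pp pd; apply=> //; apply: leq_trans (dvdn_leq d0 pd) dK.
apply: (@le_trans _ _ (\sum_(1 <= d < K0.+1) rho%:C%C * ((Gn R d (K %/ d))%:C%C * quad (kd d)))).
  rewrite big_nat [leRHS]big_nat; apply: ler_sum => d /andP[d0 dK0].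
  rewrite mulrA -rmorphM ler_wpM2r ?lecR ?hG //.
  by apply: T0; rewrite d0 (leq_trans _ K0K).
rewrite -mulr_sumr ler_wpM2l ?ler0c //.
rewrite [leRHS](big_cat_nat (n := K0.+1)) //= lerDl big_nat; apply: sumr_ge0 => d /andP[dK0 dK].
by rewrite mulr_ge0 ?ler0c ?Gn_ge0 // T0 // (leq_ltn_trans _ dK0).
Qed.

End SieveComparison.

(** * The large sieve at Farey fractions *)

Section FareySieve.
Variable R : realType.
Local Notation C := R[i].

Definition farey_seq (K : nat) : seq (nat * nat) :=
  [seq (b, q) | q <- index_iota 1 K.+1, b <- [seq b <- iota 0 q | coprime b q]].
Definition farey_pt (bq : nat * nat) : R := bq.1%:R / bq.2%:R.

Lemma mem_farey_seq K b q : ((b, q) \in farey_seq K) = [&& (0 < q)%N, (q <= K)%N, (b < q)%N & coprime b q].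
Proof.
apply/allpairsPdep/idP => [[q' [b' [hq hb]]]|/and4P[q0 qK bq cop]].
  move: hq hb; rewrite mem_index_iota mem_filter mem_iota => /andP[q0 qK] /andP[cop /andP[_ bq]].
  by case=> -> ->; rewrite q0 -ltnS qK bq cop.
exists q, b; split => //; first by rewrite mem_index_iota q0 ltnS.
by rewrite mem_filter mem_iota cop.
Qed.

Lemma uniq_farey_seq K : uniq (farey_seq K).
Proof.
apply: allpairs_uniq_dep; first exact: iota_uniq.
  by move=> q _; rewrite filter_uniq ?iota_uniq.
by move=> [q b] [q' b'] /= _ _ [-> ->].
Qed.

(** The difference is m / (q q') with an integer m and q q' <= K^2. If m = 0, reducedness gives q |
    q' and q' | q, and both fractions lie in [0, 1), so they coincide. *)
Lemma farey_separated K (s t : nat * nat) (n : int) : s \in farey_seq K -> t \in farey_seq K -> s != t ->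
  (K%:R ^+ 2)^-1 <= `|farey_pt s - farey_pt t - n%:~R|.
Proof.
move: s t => [b q] [b' q']; rewrite !mem_farey_seq => /and4P[q0 qK bq cop] /and4P[q0' qK' bq' cop'] ne.
rewrite /farey_pt /=.
have nz : q%:R != 0 :> R by rewrite pnatr_eq0 -lt0n.
have nz' : q'%:R != 0 :> R by rewrite pnatr_eq0 -lt0n.
pose m : int := b%:Z * q'%:Z - b'%:Z * q%:Z - n * (q%:Z * q'%:Z).
have -> : b%:R / q%:R - b'%:R / q'%:R - n%:~R = m%:~R / (q%:R * q'%:R) :> R.
  by rewrite /m !rmorphB !rmorphM /= -!pmulrn; field_nz.
have m0 : m != 0.
  apply: contraNneq ne => m0.
  have E : b%:Z * q'%:Z = (b'%:Z + n * q'%:Z) * q%:Z by move: m0; rewrite /m; lia.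
  have E' : b'%:Z * q%:Z = (b%:Z - n * q%:Z) * q'%:Z by move: m0; rewrite /m; lia.
  have d1 : (q %| q')%N.
    rewrite -(Gauss_dvdr _ (n := b)) 1?coprime_sym //.
    have : (q%:Z %| b%:Z * q'%:Z)%Z by rewrite E dvdz_mull.
    by rewrite -PoszM.
  have d2 : (q' %| q)%N.
    rewrite -(Gauss_dvdr _ (n := b')) 1?coprime_sym //.
    have : (q'%:Z %| b'%:Z * q%:Z)%Z by rewrite E' dvdz_mull.
    by rewrite -PoszM.
  have qq : q = q' by apply/eqP; rewrite eqn_dvd d1 d2.
  subst q'; have : b%:Z - b'%:Z = n * q%:Z.
    have qz : q%:Z != 0 by rewrite -lt0n in q0 *; lia.
    by apply: (mulIf qz); move: E; lia.
  move=> hb; have n0 : n = 0 by nia.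
  by rewrite xpair_eqE eqxx andbT; move: hb; rewrite n0; lia.
rewrite normrM normfV ler_pdivlMr; last by rewrite normr_gt0 mulf_neq0.
have m1 : 1 <= `|m%:~R : R| by rewrite -intr_norm ler1z; lia.
apply: le_trans m1; rewrite ger0_norm ?mulr_ge0 //.
have K0 : 0 < K%:R :> R by rewrite ltr0n (leq_trans q0).
by rewrite mulrC ler_pdivrMr ?exprn_gt0 // mul1r expr2 ler_pM // ler_nat.
Qed.

Variables (M : nat) (a : nat -> C).

Lemma sum_energy_farey K : \sum_(1 <= q < K.+1) energy M a q
  = \sum_(s <- farey_seq K) `|\sum_(1 <= n < M.+1) a n * e2pi (farey_pt s * n%:R)| ^+ 2.
Proof.
rewrite /farey_seq big_allpairs_dep /=; apply: eq_bigr => q _.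
by rewrite big_filter /energy -(big_mkord (fun b => coprime b q)
  (fun b => `|\sum_(1 <= n < M.+1) a n * e2pi (b%:R / q%:R * n%:R)| ^+ 2)) /index_iota subn0.
Qed.

Lemma farey_large_sieve K : (0 < K)%N ->
  \sum_(1 <= q < K.+1) energy M a q
  <= (M%:R + K%:R ^+ 2)%:C%C * \sum_(1 <= n < M.+1) `|a n| ^+ 2.
Proof.
move=> K0; rewrite sum_energy_farey (big_nth (0, 0)%N) big_mkord.
pose x (i : 'I_(size (farey_seq K))) := farey_pt (nth (0, 0)%N (farey_seq K) i).
have d0 : 0 < (K%:R ^+ 2)^-1 :> R by rewrite invr_gt0 exprn_gt0 // ltr0n.
have sep (r s : 'I_(size (farey_seq K))) : r != s -> forall n : int, (K%:R ^+ 2)^-1 <= `|x r - x s - n%:~R|.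
  move=> rs n; apply: farey_separated; rewrite ?mem_nth //.
  by rewrite nth_uniq ?uniq_farey_seq.
have := @large_sieve R _ x _ d0 sep M a; rewrite invrK; apply: le_trans.
rewrite le_eqVlt; apply/orP; left; apply/eqP; apply: eq_bigr => i _.
by congr (Num.norm _ ^+ 2); apply: eq_bigr => n _; rewrite [n%:R * _]mulrC.
Qed.

End FareySieve.

(** * Rational bounds for logarithms, and the sum of 1 / j over odd j *)

Section Logarithms.
Variable R : realType.
Implicit Types x y t : R.

Lemma is_derive_ln1D x : 0 <= x -> is_derive x 1 (fun y => ln (1 + y)) (1 + x)^-1.
Proof.
move=> x0; have p : 0 < 1 + x by lra.
have h := is_derive1_ln p.
rewrite -[X in is_derive _ _ _ X]mulr1.
apply: (@is_derive1_comp _ (@ln R) (fun y => 1 + y) _ _ _ h).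
by apply: is_derive_eq; lra.
Qed.

Lemma is_derive_ln1B x : x < 1 -> is_derive x 1 (fun y => ln (1 - y)) (- (1 - x)^-1).
Proof.
move=> x1; have p : 0 < 1 - x by lra.
have h := is_derive1_ln p.
rewrite -mulrN1.
apply: (@is_derive1_comp _ (@ln R) (fun y => 1 - y) _ _ _ h).
by apply: is_derive_eq; lra.
Qed.

(** Two terms of the series of log ((1 + t) / (1 - t)). At t = 1 / (2n + 1) the argument is (n + 1)
    / n, so every later numerical logarithm comes from this and from [artanh_le], which bounds the
    tail by a geometric series. *)
Lemma artanh_ge t : 0 <= t <= 1 / 2 -> 2 * t + 2 / 3 * t ^+ 3 <= ln (1 + t) - ln (1 - t).
Proof.
move=> ht; rewrite -subr_ge0.
apply: (@ge0_of_derivative_itv R (fun t => ln (1 + t) - ln (1 - t) - (2 * t + 2 / 3 * t ^+ 3))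
  (fun t => (1 + t)^-1 + (1 - t)^-1 - (2 + 2 * t ^+ 2)) (1 / 2)) => //.
- move=> x /andP[x0 xh]; have d1 := is_derive_ln1D x0.
  have d2 : is_derive x 1 (fun y => ln (1 - y)) (- (1 - x)^-1) by apply: is_derive_ln1B; lra.
  by apply: is_derive_eq; rewrite /GRing.scale /=; lra.
- move=> x /andP[x0 xh].
  have -> : (1 + x)^-1 + (1 - x)^-1 - (2 + 2 * x ^+ 2) = 2 * x ^+ 4 / ((1 + x) * (1 - x)).
    by field; rewrite !gt_eqF //; lra.
  by rewrite divr_ge0 // ?mulr_ge0 ?exprn_ge0 //; lra.
- by rewrite addr0 subr0 ln1; lra.
Qed.

Lemma artanh_le t : 0 <= t <= 1 / 2 ->
  ln (1 + t) - ln (1 - t) <= 2 * t + 2 / 3 * t ^+ 3 / (1 - t ^+ 2).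
Proof.
move=> ht.
have sq x : 0 <= x <= 1 / 2 -> 1 - x ^+ 2 != 0 by move=> hx; rewrite gt_eqF //; nra.
rewrite -subr_ge0.
apply: (@ge0_of_derivative_itv R (fun t => 2 * t + 2 / 3 * t ^+ 3 / (1 - t ^+ 2) - (ln (1 + t) - ln (1 - t)))
  (fun x => 4 / 3 * x ^+ 4 / (1 - x ^+ 2) ^+ 2) (1 / 2)); last by [].
- move=> x hx; have /andP[x0 xh] := hx; have d1 := is_derive_ln1D x0.
  have d2 : is_derive x 1 (fun y => ln (1 - y)) (- (1 - x)^-1) by apply: is_derive_ln1B; lra.
  have d3 : is_derive x 1 (fun y : R => (1 - y ^+ 2)^-1) (2 * x / (1 - x ^+ 2) ^+ 2).
    have h := sq x hx; apply: is_derive_eq; rewrite /GRing.scale /=.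
    by field; rewrite h.
  apply: is_derive_eq; rewrite /GRing.scale /=.
  have h1 : 1 + x != 0 by rewrite gt_eqF //; lra.
  have h2 : 1 - x != 0 by rewrite gt_eqF //; lra.
  have E : 1 - x ^+ 2 = (1 + x) * (1 - x) by ring.
  by rewrite E; field; rewrite h1 h2.
- by move=> x hx; rewrite divr_ge0 ?sqr_ge0 // mulr_ge0 ?exprn_even_ge0.
- by rewrite addr0 subr0 ln1 expr0n /= !mulr0 mul0r; lra.
Qed.

Lemma ln_succ_ge (n : nat) : (0 < n)%N ->
  2 / (2 * n%:R + 1) + 2 / 3 / (2 * n%:R + 1) ^+ 3 <= ln (n.+1%:R) - ln (n%:R : R).
Proof.
move=> n0; have nR : 1 <= n%:R :> R by rewrite ler1n.
pose t : R := (2 * n%:R + 1)^-1; have t0 : 0 < t by rewrite invr_gt0; lra.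
have th : t <= 1 / 2 by rewrite /t invf_ple ?posrE ?divrr ?div1r ?invrK //; lra.
have := @artanh_ge t; rewrite th ltW // => /(_ isT).
have h : 2 * n%:R + 1 != 0 :> R by rewrite gt_eqF //; lra.
rewrite -ln_div ?posrE; [|lra|lra].
have -> : (1 + t) / (1 - t) = n.+1%:R / n%:R.
  by rewrite /t -natr1; field; rewrite h !gt_eqF //; lra.
rewrite ln_div ?posrE ?ltr0n //; apply: le_trans.
by rewrite /t exprVn.
Qed.

Lemma ln_succ_le (n : nat) : (0 < n)%N ->
  ln (n.+1%:R) - ln (n%:R : R) <= 2 / (2 * n%:R + 1) + (6 * n%:R * (n%:R + 1) * (2 * n%:R + 1))^-1.
Proof.
move=> n0; have nR : 1 <= n%:R :> R by rewrite ler1n.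
pose t : R := (2 * n%:R + 1)^-1; have t0 : 0 < t by rewrite invr_gt0; lra.
have th : t <= 1 / 2 by rewrite /t invf_ple ?posrE ?divrr ?div1r ?invrK //; lra.
have := @artanh_le t; rewrite th ltW // => /(_ isT).
have h : 2 * n%:R + 1 != 0 :> R by rewrite gt_eqF //; lra.
rewrite -ln_div ?posrE; [|lra|lra].
have -> : (1 + t) / (1 - t) = n.+1%:R / n%:R.
  by rewrite /t -natr1; field; rewrite h !gt_eqF //; lra.
rewrite ln_div ?posrE ?ltr0n // => /le_trans; apply.
rewrite le_eqVlt; apply/orP; left; apply/eqP; rewrite /t.
by move: (n%:R : R) nR h {t t0 th} => z z1 h; field; rewrite !gt_eqF //; nra.
Qed.

Lemma ln_le_sub1 x : 0 < x -> ln x <= x - 1.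
Proof.
move=> x0; have E : 1 + (x - 1) = x by ring.
by have := @le_ln1Dx R (x - 1); rewrite E; apply; lra. Qed.

Lemma ln_le_half_sub_inv x : 1 <= x -> ln x <= (x - x^-1) / 2.
Proof.
move=> x1; rewrite -subr_ge0.
pose f (y : R) := ((1 + y) - (1 + y)^-1) / 2 - ln (1 + y).
have E : 1 + (x - 1) = x by ring.
suff : 0 <= f (x - 1) by rewrite /f E.
apply: (@ge0_of_derivative_itv R f (fun y => (1 - (1 + y)^-1) ^+ 2 / 2) (x - 1)); last by lra.
- move=> y /andP[y0 _]; have d1 := is_derive_ln1D y0.
  have d3 : is_derive y 1 (fun z : R => (1 + z)^-1) (- (1 + y) ^- 2).
    have h : 1 + y != 0 by rewrite gt_eqF //; lra.
    by apply: is_derive_eq; rewrite /GRing.scale /=; field; rewrite h.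
  apply: is_derive_eq; rewrite /GRing.scale /= -[(1 + y) ^- 2]exprVn.
  by move: ((1 + y)^-1) => z; field.
- by move=> y _; rewrite divr_ge0 ?sqr_ge0.
- by rewrite /f addr0 ln1 invr1; lra.
Qed.

Definition odd_harmonic (n : nat) : R := \sum_(1 <= j < n.+1 | odd j) (j%:R)^-1.
(** Twice the constant term of the odd harmonic sum, which is (ln n + gamma + ln 2) / 2 + o(1) up to
    n. *)
Definition gamma2 : R := euler_gamma R + ln 2.

Let harm (n : nat) : R := \sum_(1 <= k < n.+1) (k%:R)^-1.

Lemma harmonic_split k : harm k.*2 = odd_harmonic k.*2 + harm k / 2.
Proof.
rewrite /harm /odd_harmonic (bigID odd) /=; congr (_ + _).
rewrite (eq_bigl (fun i => (2 %| i)%N && true)); last by move=> i; rewrite dvdn2 andbT.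
rewrite big_dvdn_reindex // -muln2 mulnK // mulr_suml; apply: eq_big_nat => i /andP[i0 _].
by rewrite natrM invfM mulrC.
Qed.

Let e (n : nat) : R := harm n - ln n%:R.

Lemma ln_succ_simple n : (0 < n)%N ->
  (n.+1%:R)^-1 <= ln (n.+1%:R) - ln (n%:R : R) <= (n%:R)^-1.
Proof.
move=> n0; have nR : 0 < n%:R :> R by rewrite ltr0n.
apply/andP; split.
  have -> : ln n.+1%:R - ln n%:R = - ln (n%:R / n.+1%:R : R).
    by rewrite ln_div ?posrE ?ltr0n // opprB.
  rewrite lerNr; apply: le_trans (ln_le_sub1 _) _; first by rewrite divr_gt0 // ltr0n.
  by rewrite le_eqVlt; apply/orP; left; apply/eqP; rewrite -natr1; field; rewrite gt_eqF //; lra.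
rewrite -ln_div ?posrE ?ltr0n //; apply: le_trans (ln_le_sub1 _) _; first by rewrite divr_gt0 // ltr0n.
by rewrite le_eqVlt; apply/orP; left; apply/eqP; rewrite -natr1; field; rewrite gt_eqF.
Qed.

Lemma e_step n : (0 < n)%N -> e n - (n%:R)^-1 + (n.+1%:R)^-1 <= e n.+1 <= e n.
Proof.
move=> n0; have /andP[h1 h2] := ln_succ_simple n0.
have hE : harm n.+1 = harm n + (n.+1%:R)^-1 by rewrite /harm big_nat_recr.
rewrite /e hE; move: (n.+1%:R^-1 : R) h1 h2 => v h1 h2.
by apply/andP; split; lra.
Qed.

Lemma e_mono m n : (0 < m)%N -> (m <= n)%N -> e m - (m%:R)^-1 + (n%:R)^-1 <= e n <= e m.
Proof.
move=> m0; elim: n => [|n IH]; first by rewrite leqn0 => /eqP m00; rewrite m00 in m0.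
rewrite leq_eqVlt => /orP[/eqP <-|]; first by rewrite subrK lexx.
rewrite ltnS => mn; have /andP[h1 h2] := IH mn.
have /andP[] := e_step (leq_trans m0 mn); move: (n.+1%:R^-1 : R) => v h3 h4.
by apply/andP; split; lra.
Qed.

Lemma e_cvg : cvgn e.
Proof.
have dec : nonincreasing_seq (fun n => e n.+1).
  by move=> m n mn; have /andP[] := @e_mono m.+1 n.+1 isT mn.
have : cvgn (fun n => e n.+1).
  apply: nonincreasing_is_cvgn => //; exists 0 => _ [n _ <-] /=.
  have /andP[h _] := @e_mono 1 n.+1 isT isT.
  apply: le_trans h; rewrite /e /harm big_nat1 ln1 invr1; have : 0 <= (n.+1%:R)^-1 :> R by rewrite invr_ge0.
  by move: (n.+1%:R^-1 : R) => v v0; lra.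
by move=> /cvg_ex[l hl]; apply/cvg_ex; exists l; rewrite -cvg_shiftS.
Qed.

Lemma euler_gamma_bounds n : (0 < n)%N -> e n - (n%:R)^-1 <= euler_gamma R <= e n.
Proof.
move=> n0; apply/andP; split.
  apply: limr_ge; first exact: e_cvg.
  near=> m; have nm : (n <= m)%N by near: m; apply: nbhs_infty_ge.
  have /andP[h _] := e_mono n0 nm; apply: le_trans h.
  by rewrite lerDl invr_ge0.
apply: limr_le; first exact: e_cvg.
near=> m; have nm : (n <= m)%N by near: m; apply: nbhs_infty_ge.
by have /andP[_ h] := e_mono n0 nm.
Unshelve. all: by end_near.
Qed.

(** Evaluated at 2k, midway between consecutive odd numbers: there the term of order 1 / k of the
    error vanishes and 1 / (48 k^2) is the leading one. *)
Definition odd_harmonic_mid (k : nat) : R := odd_harmonic k.*2 - ln (k.*2%:R) / 2.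

Lemma odd_harmonic_mid_bounds k : (0 < k)%N ->
  - (k%:R)^-1 <= odd_harmonic_mid k - gamma2 / 2 <= (k%:R)^-1.
Proof.
move=> k0; have k20 : (0 < k.*2)%N by rewrite double_gt0.
have /andP[h1 h2] := euler_gamma_bounds k20; have /andP[h3 h4] := euler_gamma_bounds k0.
move: h1 h2 h3 h4; rewrite /odd_harmonic_mid /gamma2 /e harmonic_split.
have -> : ln (k.*2%:R : R) = ln 2 + ln k%:R.
  by rewrite -muln2 natrM mulrC lnM ?posrE ?ltr0n.
have -> : (k.*2%:R : R)^-1 = (k%:R)^-1 / 2 by rewrite -muln2 natrM invfM.
have : 0 < (k%:R : R)^-1 by rewrite invr_gt0 ltr0n.
by move=> *; apply/andP; split; lra.
Qed.

Lemma odd_harmonicS k : odd_harmonic k.+1.*2 = odd_harmonic k.*2 + (2 * k%:R + 1)^-1.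
Proof.
rewrite /odd_harmonic doubleS big_mkcond big_nat_recr //= big_nat_recr //= -big_mkcond /=.
by rewrite odd_double /= addr0 -natr1 -muln2 natrM mulrC.
Qed.

(** The sequence decreases, and after subtraction of 1 / (48 k^2) it increases, so its limit is
    enclosed at every k. *)
Lemma odd_harmonic_mid_step k : (0 < k)%N ->
  odd_harmonic_mid k.+1 <= odd_harmonic_mid k
  /\ odd_harmonic_mid k - (48 * k%:R ^+ 2)^-1 <= odd_harmonic_mid k.+1 - (48 * k.+1%:R ^+ 2)^-1.
Proof.
move=> k0; have kR : 1 <= k%:R :> R by rewrite ler1n.
have hE := odd_harmonicS k.
have lE : ln (k.+1.*2%:R : R) - ln k.*2%:R = ln k.+1%:R - ln k%:R.
  by rewrite -!muln2 !natrM !lnM ?posrE ?ltr0n //; ring.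
have h1 := ln_succ_ge k0; have h2 := ln_succ_le k0.
have c0 : 0 < 2 / 3 / (2 * k%:R + 1) ^+ 3 :> R by rewrite !divr_gt0 // exprn_gt0; lra.
rewrite /odd_harmonic_mid hE; split; first by lra.
suff : (6 * k%:R * (k%:R + 1) * (2 * k%:R + 1))^-1 / 2 <= (48 * k%:R ^+ 2)^-1 - (48 * k.+1%:R ^+ 2)^-1 :> R.
  move: h1 h2 c0; move: (_ / _ ^+ 3) ((6 * _ * _ * _)^-1) ((2 * _ + 1)^-1)
    ((48 * k%:R ^+ 2)^-1) ((48 * k.+1%:R ^+ 2)^-1) => v1 v2 v3 v4 v5; lra.
have -> : k.+1%:R = k%:R + 1 :> R by rewrite natr1.
move: (k%:R : R) kR {h1 h2 c0 hE lE} => z z1.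
have -> : (48 * z ^+ 2)^-1 - (48 * (z + 1) ^+ 2)^-1 = (2 * z + 1) / (48 * z ^+ 2 * (z + 1) ^+ 2).
  by field; rewrite !gt_eqF //; lra.
have -> : (6 * z * (z + 1) * (2 * z + 1))^-1 / 2
   = (4 * z * (z + 1)) / (2 * z + 1) / (48 * z ^+ 2 * (z + 1) ^+ 2).
  by field; rewrite !gt_eqF //; lra.
rewrite ler_pM2r ?invr_gt0; last by rewrite !mulr_gt0 ?exprn_gt0 //; lra.
by rewrite ler_pdivrMr; [nra|lra].
Qed.

Lemma odd_harmonic_mid_mono k m : (0 < k)%N ->
  odd_harmonic_mid (k + m) <= odd_harmonic_mid k
  /\ odd_harmonic_mid k - (48 * k%:R ^+ 2)^-1 <= odd_harmonic_mid (k + m).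
Proof.
move=> k0; suff [h1 h2] : odd_harmonic_mid (k + m) <= odd_harmonic_mid k
  /\ odd_harmonic_mid k - (48 * k%:R ^+ 2)^-1 <= odd_harmonic_mid (k + m) - (48 * (k + m)%:R ^+ 2)^-1.
  split=> //; apply: le_trans h2 _; rewrite gerBl invr_ge0 mulr_ge0 ?sqr_ge0 //.
elim: m => [|m [IH1 IH2]]; first by rewrite addn0.
have km : (0 < k + m)%N by rewrite addn_gt0 k0.
have [h1 h2] := odd_harmonic_mid_step km; rewrite addnS.
by split; [apply: le_trans IH1|apply: le_trans h2].
Qed.

Lemma le_of_inv_nat (x : R) : (forall m : nat, x <= (m.+1%:R)^-1) -> x <= 0.
Proof.
move=> h; rewrite leNgt; apply/negP => x0.
have := h (Num.truncn x^-1); rewrite leNgt => /negP; apply.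
rewrite invf_plt ?posrE ?ltr0n //.
have xv : 0 <= x^-1 by rewrite invr_ge0 ltW.
by have /andP[] := Num.Theory.truncn_itv xv.
Qed.

(** The crude bounds by 1 / k identify the limit as gamma2 / 2; monotonicity then supplies the error
    of second order. *)
Lemma odd_harmonic_mid_gamma k : (0 < k)%N ->
  0 <= odd_harmonic_mid k - gamma2 / 2 <= (48 * k%:R ^+ 2)^-1.
Proof.
move=> k0.
have bd m : (((k + m)%:R : R)^-1 <= (m.+1%:R)^-1).
  by rewrite lef_pV2 ?posrE ?ltr0n ?addn_gt0 ?k0 // ler_nat -add1n leq_add2r.
apply/andP; split.
  rewrite -oppr_le0; apply: le_of_inv_nat => m; have [h1 _] := odd_harmonic_mid_mono m k0.
  have km : (0 < k + m)%N by rewrite addn_gt0 k0.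
  have /andP[] := odd_harmonic_mid_bounds km; have := bd m.
  by move: (m.+1%:R^-1 : R) ((k + m)%:R^-1 : R) => v w *; lra.
rewrite -subr_le0; apply: le_of_inv_nat => m; have [_ h1] := odd_harmonic_mid_mono m k0.
have km : (0 < k + m)%N by rewrite addn_gt0 k0.
have /andP[] := odd_harmonic_mid_bounds km; have := bd m.
by move: (m.+1%:R^-1 : R) ((k + m)%:R^-1 : R) => v w *; lra.
Qed.

(** Meant for all y > 0: below 1 the sum is empty and the defect is -(ln y + gamma2) / 2. These
    values occur, since the recursion over primes keeps dividing the argument. *)
Definition odd_defect (y : R) : R := odd_harmonic (Num.truncn y) - (ln y + gamma2) / 2.

Lemma odd_harmonic_odd n : odd_harmonic (uphalf n).*2 = odd_harmonic n.
Proof.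
rewrite -{2}(odd_double_half n) uphalf_half; case: (boolP (odd n)) => on; last by [].
rewrite add1n doubleS /odd_harmonic [LHS]big_mkcond big_nat_recr //= -big_mkcond /=.
by rewrite odd_double /= addr0.
Qed.

(** Between 2k - 1 and 2k + 1 the odd sum is constant, so its value can be taken at the midpoint 2k;
    the logarithm accounts for moving from 2k to y. *)
Lemma odd_defect_formula (y : R) : 1 <= y -> exists k : nat, exists th : R,
  [/\ (0 < k)%N, 2 * k%:R - 1 <= y < 2 * k%:R + 1, 0 <= th <= (48 * k%:R ^+ 2)^-1
   & odd_defect y = ln (2 * k%:R / y) / 2 + th].
Proof.
move=> y1; have y0 : 0 <= y by lra.
pose n := Num.truncn y; pose k := uphalf n.
have n0 : (0 < n)%N by rewrite Num.Theory.truncn_gt0.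
have k0 : (0 < k)%N by rewrite /k uphalf_gt0.
have /andP[ny yn] := Num.Theory.truncn_itv y0; rewrite -/n in ny yn.
exists k, (odd_harmonic_mid k - gamma2 / 2); split => //.
- have kn : (k.*2 <= n.+1)%N by rewrite /k uphalf_half; lia.
  have nk : (n <= k.*2)%N by rewrite /k uphalf_half; lia.
  have knR : 2 * k%:R <= n%:R + 1 :> R by rewrite -natrM natr1 ler_nat mul2n.
  have nkR : n%:R <= 2 * k%:R :> R by rewrite -natrM ler_nat mul2n.
  by rewrite -natr1 in yn; apply/andP; split; lra.
- exact: odd_harmonic_mid_gamma.
rewrite /odd_defect -/n -(odd_harmonic_odd n) -/k /odd_harmonic_mid.
by rewrite ln_div ?posrE ?mulr_gt0 ?ltr0n // -?muln2 ?natrM ?[_ * 2]mulrC; lra.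
Qed.

(** For y >= 2k the bound is (y^2 - 4 k^2) / (8 k), at most (4 k + 1) / (8 k); the worst case k = 1
    with y near 3 gives 5 / 8. For y < 2k the product is at most 1/2 + 1/16. *)
Lemma odd_defect_ge1 (y : R) : 1 <= y -> y * `|odd_defect y| <= 5 / 8.
Proof.
move=> y1; have [k [th [k0 /andP[ky yk] /andP[th0 th1] ->]]] := odd_defect_formula y1.
have kR : 1 <= k%:R :> R by rewrite ler1n.
move: (k%:R : R) kR ky yk th0 th1 => z z1 zy yz th0 th1.
have y0 : 0 < y by lra.
rewrite -[y in y * _]gtr0_norm // -normrM ler_norml; apply/andP; split.
  have [zle|zgt] := leP (2 * z) y.
    have s1 : 1 <= y / (2 * z) by rewrite ler_pdivlMr; lra.
    have := ln_le_half_sub_inv s1; rewrite invf_div.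
    rewrite -[y / (2 * z)]invf_div lnV ?posrE ?divr_gt0 //; last by lra.
    move: (ln _) => L; rewrite invf_div => hL.
    have : y * (L / 2) >= - ((y ^+ 2 / (2 * z) - 2 * z) / 4).
      have -> : (y ^+ 2 / (2 * z) - 2 * z) / 4 = y * ((y / (2 * z) - 2 * z / y) / 2 / 2).
        by field; rewrite !gt_eqF //; lra.
      by rewrite -mulrN ler_pM2l //; lra.
    have : (y ^+ 2 / (2 * z) - 2 * z) / 4 <= 5 / 8.
      have -> : (y ^+ 2 / (2 * z) - 2 * z) / 4 = (y ^+ 2 - 4 * z ^+ 2) / (8 * z).
        by field; rewrite gt_eqF //; lra.
      by rewrite ler_pdivrMr; nra.
    have : 0 <= y * th by rewrite mulr_ge0 // ltW.
    by rewrite mulrDr; lra.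
  have : 0 <= ln (2 * z / y) by rewrite ln_ge0 // ler_pdivlMr //; lra.
  move: (ln _) => L L0; have : 0 <= y * (L / 2 + th) by rewrite mulr_ge0 //; lra.
  lra.
have h : ln (2 * z / y) <= 2 * z / y - 1 by apply: ln_le_sub1; rewrite divr_gt0 //; lra.
have : y * (ln (2 * z / y) / 2) <= 1 / 2.
  apply: (@le_trans _ _ (y * ((2 * z / y - 1) / 2))); first by rewrite ler_pM2l //; lra.
  rewrite (_ : y * ((2 * z / y - 1) / 2) = (2 * z - y) / 2); last by field; rewrite gt_eqF.
  lra.
have : y * th <= 1 / 16.
  apply: (@le_trans _ _ (3 * z * (48 * z ^+ 2)^-1)); first by rewrite ler_pM //; lra.
  rewrite (_ : 3 * z * (48 * z ^+ 2)^-1 = 1 / 16 / z); last by field; rewrite gt_eqF //; lra.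
  by rewrite ler_pdivrMr; lra.
by rewrite mulrDr; lra.
Qed.

End Logarithms.

(** * The odd defect summed over odd squares *)

Section OddSquareSums.
Variable R : realType.
Implicit Types u y z : R.

Lemma ln_succ_num (n : nat) (t s : R) : (0 < n)%N -> t * (2 * n%:R + 1) = 1 ->
  s * (6 * n%:R * (n%:R + 1)) = 1 ->
  2 * t + 2 / 3 * t ^+ 3 <= ln (n.+1%:R) - ln (n%:R : R) <= 2 * t + s * t.
Proof.
move=> n0 tE sE; have h1 := @ln_succ_ge R n n0; have h2 := @ln_succ_le R n n0.
have tV : (2 * n%:R + 1)^-1 = t.
  by apply/esym/divr1_eq; rewrite invrK.
have sV : (6 * n%:R * (n%:R + 1))^-1 = s.
  by apply/esym/divr1_eq; rewrite invrK.
rewrite [X in _ <= _ + X]invfM tV sV in h2; rewrite -exprVn tV in h1.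
by rewrite h1.
Qed.

Lemma ln4E : ln (4 : R) = 2 * ln 2.
Proof. by rewrite (_ : 4 = 2 * 2) ?lnM ?posrE //; ring. Qed.

Lemma ln8E : ln (8 : R) = 3 * ln 2.
Proof. by rewrite (_ : 8 = 2 * 4) ?lnM ?posrE // ?ln4E; ring. Qed.

Lemma ln2_bounds : 70 / 101 <= ln (2 : R) <= 61 / 88.
Proof.
have a4 : 1 / 9 * (2 * 4%:R + 1) = 1 :> R by field.
have b4 : 1 / 120 * (6 * 4%:R * (4%:R + 1)) = 1 :> R by field.
have /andP[l4 u4] := ln_succ_num (isT : 0 < 4)%N a4 b4.
have a5 : 1 / 11 * (2 * 5%:R + 1) = 1 :> R by field.
have b5 : 1 / 180 * (6 * 5%:R * (5%:R + 1)) = 1 :> R by field.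
have /andP[l5 u5] := ln_succ_num (isT : 0 < 5)%N a5 b5.
have a6 : 1 / 13 * (2 * 6%:R + 1) = 1 :> R by field.
have b6 : 1 / 252 * (6 * 6%:R * (6%:R + 1)) = 1 :> R by field.
have /andP[l6 u6] := ln_succ_num (isT : 0 < 6)%N a6 b6.
have a7 : 1 / 15 * (2 * 7%:R + 1) = 1 :> R by field.
have b7 : 1 / 336 * (6 * 7%:R * (7%:R + 1)) = 1 :> R by field.
have /andP[l7 u7] := ln_succ_num (isT : 0 < 7)%N a7 b7.
rewrite ln4E in l4 u4; rewrite ln8E in l7 u7.
by apply/andP; split; lra.
Qed.

(* Eight terms of the decreasing sequence odd_harmonic_mid locate its limit gamma2 / 2. *)
Lemma gamma2_bounds : 1268 / 1000 <= gamma2 R <= 1272 / 1000.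
Proof.
have /andP[g1 g2] := @odd_harmonic_mid_gamma R 8 isT.
have /andP[l1 l2] := ln2_bounds.
move: g1 g2; rewrite /odd_harmonic_mid /odd_harmonic.
have -> : ln (8.*2%:R : R) = 4 * ln 2.
  have -> : 8.*2%:R = 2 * 8 :> R by rewrite -natrM.
  by rewrite lnM ?posrE // ln8E; ring.
rewrite -/(odd_harmonic R 8.*2) !odd_harmonicS -[0.*2]/0%N {1 2}/odd_harmonic !big_geq //.
rewrite (_ : 2 * 0%:R + 1 = 1); last by ring.
rewrite (_ : 2 * 1%:R + 1 = 3); last by ring.
rewrite (_ : 2 * 2%:R + 1 = 5); last by ring.
rewrite (_ : 2 * 3%:R + 1 = 7); last by ring.
rewrite (_ : 2 * 4%:R + 1 = 9); last by ring.
rewrite (_ : 2 * 5%:R + 1 = 11); last by ring.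
rewrite (_ : 2 * 6%:R + 1 = 13); last by ring.
rewrite (_ : 2 * 7%:R + 1 = 15); last by ring.
rewrite (_ : 48 * 8%:R ^+ 2 = 3072); last by ring.
by move=> g1 g2; apply/andP; split; lra.
Qed.

(** The term of the odd number j = 2i + 1, with u = sqrt z, so that the argument z / j^2 is a square
    and the cut is at j = u. *)
Definition odd_sq_term u (i : nat) : R :=
  (2 * i%:R + 1) ^- 2 * `|odd_defect ((u / (2 * i%:R + 1)) ^+ 2)|.

Lemma odd_sq_term_ge0 u i : 0 <= odd_sq_term u i.
Proof. by rewrite /odd_sq_term mulr_ge0 // invr_ge0 sqr_ge0. Qed.

Lemma odd_sq_term_head u i : 2 * i%:R + 1 <= u -> odd_sq_term u i <= 5 / 8 / u ^+ 2.
Proof.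
have : 0 <= i%:R :> R by []; rewrite /odd_sq_term; move: (i%:R : R) => z z0 hu.
have u0 : 0 < u by lra.
have j0 : 0 < 2 * z + 1 by lra.
have y1 : 1 <= (u / (2 * z + 1)) ^+ 2 by rewrite expr_ge1 ?divr_ge0 ?ler_pdivlMr //; lra.
have := odd_defect_ge1 y1; move: (`|odd_defect _|) => D hD.
rewrite ler_pdivlMr ?exprn_gt0 // (_ : _ * _ * _ = (u / (2 * z + 1)) ^+ 2 * D) //.
by field; rewrite gt_eqF.
Qed.

(** With w = y^(-1/4) the defect is 2 ln w - gamma2 / 2, and the tangent of the logarithm at w = 4
    gives ln w <= w / 4 - 1 + 2 ln 2. The fourth root is chosen because y = (u / j)^2 turns w into
    sqrt (j / u), leaving the convergent series of j^(-3/2). *)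
Lemma odd_defect_lt1 y : 0 < y -> y < 1 -> `|odd_defect y| <= 14 / 100 + (Num.sqrt (Num.sqrt y^-1)) / 2.
Proof.
move=> y0 y1; have /andP[g1 g2] := gamma2_bounds; have /andP[l1 l2] := ln2_bounds.
have t0 : Num.truncn y = 0%N.
  by apply/eqP; rewrite -leqn0 leqNgt Num.Theory.truncn_gt0 -ltNge.
rewrite /odd_defect t0 /odd_harmonic big_geq // sub0r normrN.
pose s := Num.sqrt y^-1; pose w := Num.sqrt s.
have yv : 1 < y^-1 by rewrite invf_gt1.
have s2 : s ^+ 2 = y^-1 by rewrite sqr_sqrtr // ltW // invr_gt0.
have s1 : 1 <= s by rewrite -(@ler_pXn2r _ 2) ?nnegrE ?sqrtr_ge0 // s2 expr1n ltW.
have w2 : w ^+ 2 = s by rewrite sqr_sqrtr // (le_trans ler01).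
have w1 : 1 <= w by rewrite -(@ler_pXn2r _ 2) ?nnegrE ?sqrtr_ge0 // w2 expr1n.
have yE : ln y = - (4 * ln w).
  have w4 : w ^+ 4 = y^-1 by rewrite -[4%N]/(2 * 2)%N exprM w2 s2.
  have -> : y = (w ^+ 4)^-1 by rewrite w4 invrK.
  have w0 : 0 < w by apply: lt_le_trans w1.
  by rewrite lnV ?posrE ?exprn_gt0 // lnXn // mulr_natl.
rewrite yE -/s -/w.
have lw0 : 0 <= ln w by rewrite ln_ge0.
have lw : ln w <= w / 4 - 1 + 2 * ln 2.
  have : ln (w / 4) <= w / 4 - 1 by apply: ln_le_sub1; lra.
  by rewrite ln_div ?posrE ?ln4E //; lra.
by rewrite ler_norml; apply/andP; split; lra.
Qed.

Lemma odd_sq_term_tail u i : 0 < u -> u < 2 * i%:R + 1 ->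
  odd_sq_term u i <= 14 / 100 * (2 * i%:R + 1) ^- 2
     + (2 * Num.sqrt u)^-1 * ((2 * i%:R + 1) * Num.sqrt (2 * i%:R + 1))^-1.
Proof.
have : 0 <= i%:R :> R by []; rewrite /odd_sq_term; move: (i%:R : R) => z z0 u0 hu.
have j0 : 0 < 2 * z + 1 by lra.
move: (2 * z + 1) j0 hu => j j0 hu {z z0}.
have y0 : 0 < (u / j) ^+ 2 by rewrite exprn_gt0 // divr_gt0.
have y1 : (u / j) ^+ 2 < 1 by rewrite exprn_ilt1 // ?divr_ge0 ?ltr_pdivrMr ?mul1r // ltW.
have := odd_defect_lt1 y0 y1; move: (`|odd_defect _|) => D.
have -> : ((u / j) ^+ 2)^-1 = (j / u) ^+ 2 by rewrite -exprVn invf_div.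
rewrite sqrtr_sqr gtr0_norm ?divr_gt0 // sqrtrM ?sqrtrV ?(ltW u0) ?(ltW j0) //.
have su : 0 < Num.sqrt u by rewrite sqrtr_gt0.
have sj : 0 < Num.sqrt j by rewrite sqrtr_gt0.
have sj2 : Num.sqrt j ^+ 2 = j by rewrite sqr_sqrtr // ltW.
move=> hD; apply: (@le_trans _ _ (j ^- 2 * (14 / 100 + Num.sqrt j / Num.sqrt u / 2))).
  by rewrite ler_wpM2l // invr_ge0 sqr_ge0.
rewrite mulrDr lerD // ?[j ^- 2 * _]mulrC // le_eqVlt; apply/orP; left; apply/eqP.
move: (Num.sqrt j) (Num.sqrt u) sj su sj2 => a b a0 b0 <-.
by field; rewrite !gt_eqF.
Qed.

Lemma inv_sq_telescope (i : nat) : (0 < i)%N ->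
  (2 * i%:R + 1) ^- 2 <= (4 * i%:R)^-1 - (4 * i.+1%:R)^-1 :> R.
Proof.
move=> i0; have : 1 <= i%:R :> R by rewrite ler1n.
have -> : i.+1%:R = i%:R + 1 :> R by rewrite natr1.
move: (i%:R : R) => z z1.
have -> : (4 * z)^-1 - (4 * (z + 1))^-1 = (4 * z * (z + 1))^-1 by field; rewrite !gt_eqF //; lra.
by rewrite lef_pV2 ?posrE; nra.
Qed.

(** The term j^(-3/2) at j = 2i + 1 is compared with the difference of j^(-1/2) at the two even
    neighbours of j, so the tail over odd j telescopes. *)
Lemma inv_three_halves_telescope (i : nat) : (0 < i)%N ->
  ((2 * i%:R + 1) * Num.sqrt (2 * i%:R + 1))^-1
  <= (Num.sqrt (2 * i%:R))^-1 - (Num.sqrt (2 * i.+1%:R))^-1 :> R.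
Proof.
move=> i0; have : 1 <= i%:R :> R by rewrite ler1n.
have -> : i.+1%:R = i%:R + 1 :> R by rewrite natr1.
move: (i%:R : R) => z z1.
pose a := Num.sqrt (2 * z); pose b := Num.sqrt (2 * (z + 1)); pose c := Num.sqrt (2 * z + 1).
have a2 : a ^+ 2 = 2 * z by rewrite sqr_sqrtr //; lra.
have b2 : b ^+ 2 = 2 * (z + 1) by rewrite sqr_sqrtr //; lra.
have c2 : c ^+ 2 = 2 * z + 1 by rewrite sqr_sqrtr //; lra.
have a0 : 0 < a by rewrite sqrtr_gt0; lra.
have b0 : 0 < b by rewrite sqrtr_gt0; lra.
have c0 : 0 < c by rewrite sqrtr_gt0; lra.
rewrite -/a -/b -/c -c2; clearbody a b c.
have -> : a^-1 - b^-1 = 2 / (a * b * (a + b)).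
  rewrite (_ : 2 = b ^+ 2 - a ^+ 2); last by rewrite a2 b2; ring.
  by field; rewrite !gt_eqF //; lra.
have abc : a * b <= c ^+ 2 by have := sqr_ge0 (a - b); rewrite sqrrB; lra.
have sc : a + b <= 2 * c.
  have h : (a + b) ^+ 2 <= (2 * c) ^+ 2 by rewrite sqrrD exprMn a2 b2 mulr2n; lra.
  by move: h; rewrite ler_pXn2r ?nnegrE //; lra.
have p1 : 0 < a * b * (a + b) by rewrite !mulr_gt0 // addr_gt0.
rewrite ler_pdivlMr // mulrC ler_pdivrMr ?mulr_gt0 ?exprn_gt0 //.
apply: (@le_trans _ _ (c ^+ 2 * (2 * c))); last by lra.
by apply: ler_pM => //; [rewrite mulr_ge0 // ltW|rewrite addr_ge0 // ltW].
Qed.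

Lemma odd_sq_sum_tail u (m n : nat) : 0 < u -> u < 2 * m%:R + 1 -> (0 < m)%N ->
  \sum_(m <= i < m + n) odd_sq_term u i
  <= 14 / 100 / (4 * m%:R) + (2 * Num.sqrt u)^-1 * (Num.sqrt (2 * m%:R))^-1.
Proof.
move=> u0 um m0; have su : 0 < (2 * Num.sqrt u)^-1 by rewrite invr_gt0 mulr_gt0 // sqrtr_gt0.
pose t (i : nat) : R := 14 / 100 / (4 * i%:R) + (2 * Num.sqrt u)^-1 * (Num.sqrt (2 * i%:R))^-1.
have t0 i : 0 <= t i.
  by rewrite addr_ge0 ?mulr_ge0 ?invr_ge0 ?mulr_ge0 ?sqrtr_ge0 //; lra.
suff : \sum_(m <= i < m + n) odd_sq_term u i <= t m - t (m + n)%N by have := t0 (m + n)%N; rewrite /t; lra.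
elim: n => [|n IH]; first by rewrite addn0 big_geq // subrr.
rewrite addnS big_nat_recr ?leq_addr //=; apply: (le_trans (lerD IH (lexx _))).
have uk : u < 2 * (m + n)%:R + 1.
  by apply: lt_le_trans um _; rewrite lerD2r ler_pM2l // ler_nat leq_addr.
have k0 : (0 < m + n)%N by rewrite addn_gt0 m0.
have := odd_sq_term_tail u0 uk.
have h1 := inv_sq_telescope k0; have := inv_three_halves_telescope k0.
move: (m + n)%N h1 => k h1; rewrite -(ler_pM2l su) mulrBr => h2 h3.
have h4 : 14 / 100 * (2 * k%:R + 1) ^- 2 <= 14 / 100 / (4 * k%:R) - 14 / 100 / (4 * k.+1%:R) :> R.
  by rewrite -mulrBr ler_wpM2l //; lra.
by rewrite /t; move: h2 h3 h4; move: (odd_sq_term _ _) (_ * (_ * _)^-1) (_ * (Num.sqrt (2 * k%:R))^-1)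
   (_ * (Num.sqrt (2 * k.+1%:R))^-1) (_ / (4 * k%:R)) (_ / (4 * k.+1%:R)) (_ * _ ^- 2) => *; lra.
Qed.

(** Cut at j = u: there are m odd j up to u, each term at most (5/8) / u^2, and the rest
    telescopes. *)
Lemma odd_sq_sum_le u (n : nat) : 0 < u -> \sum_(i < n) odd_sq_term u i <= 103 / 100 / u.
Proof.
move=> u0; pose m := Num.truncn ((u + 1) / 2).
have hp : 0 <= (u + 1) / 2 by lra.
have /andP[m1 m2] := Num.Theory.truncn_itv hp; rewrite -/m -[m.+1%:R]natr1 in m1 m2.
have um : u < 2 * m%:R + 1 by lra.
have ext : \sum_(i < n) odd_sq_term u i <= \sum_(0 <= i < m + n.+1) odd_sq_term u i.
  rewrite -(big_mkord xpredT (odd_sq_term u)) [leRHS](big_cat_nat (n := n)) //=; last by lia.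
  by rewrite lerDl sumr_ge0 // => i _; apply: odd_sq_term_ge0.
apply: le_trans ext _; rewrite (big_cat_nat (n := m)) //=; last by lia.
have su2 : Num.sqrt u ^+ 2 = u by rewrite sqr_sqrtr // ltW.
have su0 : 0 < Num.sqrt u by rewrite sqrtr_gt0.
have [mz|mp] := posnP m.
  rewrite mz in um *; rewrite mulr0 add0r in um.
  rewrite big_geq // add0r add0n big_ltn //.
  have h1 := odd_sq_term_tail u0 (_ : u < 2 * 0%:R + 1); rewrite mulr0 add0r in h1.
  have {}h1 := h1 um; rewrite sqrtr1 expr1n !mulr1 invr1 !mulr1 in h1.
  have um1 : u < 2 * 1%:R + 1 by lra.
  have := odd_sq_sum_tail n u0 um1 isT; rewrite add1n.
  have r2 : (Num.sqrt (2 * 1%:R : R)) ^+ 2 = 2 by rewrite sqr_sqrtr mulr1.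
  have r0 : 0 < Num.sqrt (2 * 1%:R : R) by rewrite sqrtr_gt0 mulr1.
  have s2 : (Num.sqrt (2 * 1%:R : R))^-1 <= 71 / 100.
    move: (Num.sqrt _) r0 r2 => r r0 r2.
    by rewrite -div1r ler_pdivrMr //; nra.
  have s0 : 0 <= (Num.sqrt (2 * 1%:R))^-1 :> R by rewrite invr_ge0 sqrtr_ge0.
  move: (Num.sqrt (2 * _))^-1 s0 s2 h1 => q q0 q1 h1 h2.
  rewrite ler_pdivlMr //; apply: (@le_trans _ _ ((14 / 100 + (2 * Num.sqrt u)^-1
     + (14 / 100 / (4 * 1%:R) + (2 * Num.sqrt u)^-1 * q)) * u)).
    by rewrite ler_pM2r //; apply: lerD.
  have su1 : Num.sqrt u <= 1 by rewrite -sqrtr1 ler_sqrt //; lra.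
  rewrite -[X in _ * X <= _]su2; move: (Num.sqrt u) su0 su1 => v v0 v1.
  have -> : (14 / 100 + (2 * v)^-1 + (14 / 100 / (4 * 1%:R) + (2 * v)^-1 * q)) * v ^+ 2
    = 175 / 1000 * v ^+ 2 + (1 + q) / 2 * v by field; rewrite gt_eqF.
  by nra.
have mR : 1 <= m%:R :> R by rewrite ler1n.
have head : \sum_(0 <= i < m) odd_sq_term u i <= m%:R * (5 / 8 / u ^+ 2).
  rewrite mulr_natl -{2}(subn0 m) -sumr_const_nat; apply: ler_sum_nat => i /andP[_ im].
  apply: odd_sq_term_head.
  have : i%:R + 1 <= m%:R :> R by rewrite natr1 ler_nat.
  lra.
have tail := odd_sq_sum_tail n.+1 u0 um mp.
apply: (le_trans (lerD head tail)); rewrite ler_pdivlMr //.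
move: (m%:R : R) mR m1 um {head tail} => z z1 zu um.
pose a := Num.sqrt (2 * z); have a2 : a ^+ 2 = 2 * z by rewrite sqr_sqrtr //; lra.
have a0 : 0 < a by rewrite sqrtr_gt0; lra.
rewrite -/a; clearbody a.
have -> : (z * (5 / 8 / u ^+ 2) + (14 / 100 / (4 * z) + (2 * Num.sqrt u)^-1 / a)) * u
   = 5 / 16 * (2 * z / u) + 7 / 100 * (u / (2 * z)) + Num.sqrt u / a / 2.
  by move: (Num.sqrt u) su0 su2 => v v0 <-; field; rewrite !gt_eqF //; lra.
(* Times u, the bound depends only on p = u / (2m), which lies in [1/2, 3/2]. *)
set p := u / (2 * z); set w := Num.sqrt u / a.
have p1 : 1 / 2 <= p by rewrite ler_pdivlMr; lra.
have p2 : p <= 3 / 2 by rewrite ler_pdivrMr; lra.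
have wp : w ^+ 2 = p by rewrite /w /p exprMn su2 exprVn a2.
(* The tangent of the square root at p = 9 / 16, which makes the claim polynomial in p. *)
have wle : w <= p / (3 / 2) + 3 / 8 by have := sqr_ge0 (w - 3 / 4); rewrite sqrrB; lra.
have -> : 2 * z / u = p^-1 by rewrite invf_div.
have p0 : 0 < p by lra.
clearbody p w; rewrite -(ler_pM2r p0).
have -> : (5 / 16 * p^-1 + 7 / 100 * p + w / 2) * p = 5 / 16 + 7 / 100 * p ^+ 2 + w * p / 2.
  by field; rewrite gt_eqF.
nra.
Qed.

End OddSquareSums.

(** * From 1 / n to mu^2(n) / phi(n), one prime at a time *)

Section SieveWeights.
Variable R : realType.
Implicit Types (S : seq nat) (p n N : nat) (y z : R).

Definition up p : R := (p%:R * (p%:R - 1))^-1.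

(** weight(n) / n has the local factors of mu^2(n) / phi(n) at the primes of S and those of 1 / n
    elsewhere. It interpolates between the odd harmonic sum (S empty) and the sum defining [Gn]. *)
Definition weight S n : R :=
  \prod_(p <- S) (if (p %| n)%N then if (p * p %| n)%N then 0 else p%:R / (p%:R - 1) else 1).

Definition wsum S N : R := \sum_(1 <= n < N.+1 | odd n) weight S n / n%:R.

Definition odd_primes S := forall p, p \in S -> prime p && odd p.

Lemma weight_primeM S p n : prime p -> odd_primes S -> p \notin S -> weight S (p * n) = weight S n.
Proof.
move=> pp hS pS; apply: eq_big_seq => q qS; have /andP[qp _] := hS q qS.
have qp' : coprime q p.
  by rewrite prime_coprime // dvdn_prime2 //; apply: contraNneq pS => <-.
by rewrite !Gauss_dvdr // coprimeMl qp'.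
Qed.

Lemma wsum_dvd S p N : prime p -> odd p -> odd_primes S -> p \notin S ->
  \sum_(1 <= n < N.+1 | (p %| n)%N && odd n) weight S n / n%:R = wsum S (N %/ p) / p%:R.
Proof.
move=> pp po hS pS; rewrite big_dvdn_reindex ?prime_gt0 // /wsum mulr_suml.
apply: eq_big => [m|m _]; first by rewrite oddM po.
by rewrite weight_primeM // natrM invfM mulrA mulrAC.
Qed.

Lemma wsum_coprime S p N : prime p -> odd p -> odd_primes S -> p \notin S ->
  \sum_(1 <= n < N.+1 | ~~ (p %| n)%N && odd n) weight S n / n%:R
  = wsum S N - wsum S (N %/ p) / p%:R.
Proof.
move=> pp po hS pS; rewrite -wsum_dvd // /wsum [X in _ = X - _](bigID (fun n => (p %| n)%N)) /=.
rewrite [X in _ = X + _ - _](eq_bigl (fun n => (p %| n)%N && odd n)); last by move=> n; rewrite andbC.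
by rewrite addrAC subrr add0r; apply: eq_bigl => n; rewrite andbC.
Qed.

Lemma prime_sub1_gt0 p : prime p -> 0 < p%:R - 1 :> R.
Proof. by move=> pp; rewrite subr_gt0 ltr1n prime_gt1. Qed.

(** In Dirichlet series, with X = p^(-s), the new local factor over the old one is (1 - X / p)(1 + X
    / (p - 1)) = 1 + up(p) (X - X^2); X and X^2 act as division of N by p and by p^2. *)
Lemma wsum_cons S p N : prime p -> odd p -> odd_primes S -> p \notin S ->
  wsum (p :: S) N = wsum S N + up p * (wsum S (N %/ p) - wsum S (N %/ (p * p))).
Proof.
move=> pp po hS pS; have p1 := prime_sub1_gt0 pp.
have p0 : 0 < p%:R :> R by rewrite ltr0n prime_gt0.
rewrite {1}/wsum (bigID (fun n => (p %| n)%N)) /=.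
under eq_bigl => n do rewrite andbC.
rewrite big_dvdn_reindex ?prime_gt0 //.
have -> : \sum_(1 <= m < (N %/ p).+1 | odd (p * m)) weight (p :: S) (p * m) / (p * m)%:R
   = \sum_(1 <= m < (N %/ p).+1 | ~~ (p %| m)%N && odd m) (weight S m / m%:R) / (p%:R - 1).
  rewrite big_mkcond [RHS]big_mkcond; apply: eq_bigr => m _; rewrite oddM po /=.
  case: (odd m); rewrite ?andbF // andbT /weight big_cons dvdn_mulr // dvdn_pmul2l ?prime_gt0 //.
  case: (p %| m)%N; first by rewrite !mul0r.
  rewrite -/(weight S (p * m)) -/(weight S m) weight_primeM // natrM invfM /=.
  move: (weight S m) (m%:R^-1) ((p%:R - 1)^-1) => w mi pv.
  by transitivity (p%:R / p%:R * (w * mi * pv)); [ring|rewrite divff ?mul1r // gt_eqF].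
rewrite -mulr_suml wsum_coprime // -divnMA.
have -> : \sum_(1 <= n < N.+1 | odd n && ~~ (p %| n)%N) weight (p :: S) n / n%:R
   = wsum S N - wsum S (N %/ p) / p%:R.
  rewrite -wsum_coprime //; apply: eq_big => [n|n /andP[_ /negPf pn]]; first by rewrite andbC.
  by rewrite /weight big_cons pn mul1r.
by rewrite /up; field; rewrite !gt_eqF.
Qed.

Lemma wsum_nil N : wsum [::] N = odd_harmonic R N.
Proof. by apply: eq_bigr => n _; rewrite /weight big_nil mul1r. Qed.

Lemma truncn_divn y p : 0 <= y -> (0 < p)%N -> Num.truncn (y / p%:R) = (Num.truncn y %/ p)%N.
Proof.
move=> y0 p0; have pR : 0 < p%:R :> R by rewrite ltr0n.
have /andP[h1 h2] := Num.Theory.truncn_itv y0.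
apply: Num.Theory.truncn_def; apply/andP; split.
  rewrite ler_pdivlMr // -natrM; apply: le_trans h1; rewrite ler_nat; exact: leq_trunc_div.
rewrite ltr_pdivrMr // -natrM; apply: (lt_le_trans h2); rewrite ler_nat.
by rewrite ltn_ceil.
Qed.

(** The shift of the main term: up(p) times the difference of the logarithms of y / p and y / p^2,
    accumulated over S. *)
Definition kappaS S : R := \sum_(p <- S) up p * ln p%:R.

Definition wdefect S y : R := wsum S (Num.truncn y) - (ln y + gamma2 R + kappaS S) / 2.

Lemma wdefect_nil y : wdefect [::] y = odd_defect y.
Proof. by rewrite /wdefect wsum_nil /kappaS big_nil addr0. Qed.

Lemma wdefect_cons S p y : prime p -> odd p -> odd_primes S -> p \notin S -> 0 < y ->
  wdefect (p :: S) y = wdefect S y + up p * (wdefect S (y / p%:R) - wdefect S (y / p%:R / p%:R)).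
Proof.
move=> pp po hS pS y0; have p0 := prime_gt0 pp; have pR : 0 < p%:R :> R by rewrite ltr0n.
rewrite /wdefect wsum_cons // !truncn_divn ?divr_ge0 ?ltW // -divnMA.
rewrite !ln_div ?posrE ?divr_gt0 // /kappaS big_cons; ring.
Qed.

(** The recursion of [wdefect_cons] with absolute values. Being nonnegative, it can be summed over
    index sets of odd j. *)
Fixpoint defect_major S y : R :=
  if S is p :: S' then
    defect_major S' y + up p * (defect_major S' (y / p%:R) + defect_major S' (y / p%:R / p%:R))
  else `|odd_defect y|.

Lemma up_gt0 p : prime p -> 0 < up p.
Proof. by move=> pp; rewrite invr_gt0 mulr_gt0 ?prime_sub1_gt0 // ltr0n prime_gt0. Qed.

Lemma defect_major_ge0 S y : (forall p, p \in S -> prime p) -> 0 <= defect_major S y.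
Proof.
elim: S y => [|p S IH] y hS //=; have pp := hS p (mem_head _ _).
have IH' z : 0 <= defect_major S z by apply: IH => q qS; apply: hS; rewrite inE qS orbT.
by rewrite addr_ge0 // mulr_ge0 ?addr_ge0 // ltW // up_gt0.
Qed.

Lemma odd_primes_cons p S : odd_primes (p :: S) -> [/\ prime p, odd p & odd_primes S].
Proof.
move=> h; have /andP[pp po] := h p (mem_head _ _); split=> // q qS.
by apply: h; rewrite inE qS orbT.
Qed.

Lemma wdefect_le_major S y : odd_primes S -> uniq S -> 0 < y -> `|wdefect S y| <= defect_major S y.
Proof.
elim: S y => [|p S IH] y; first by rewrite wdefect_nil.
move=> /odd_primes_cons[pp po hS] /= /andP[pS uS] y0.
have pR : 0 < p%:R :> R by rewrite ltr0n prime_gt0.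
rewrite wdefect_cons //; apply: le_trans (ler_normD _ _) _; apply: lerD; first exact: IH.
rewrite normrM gtr0_norm ?up_gt0 // ler_pM2l ?up_gt0 //.
apply: le_trans (ler_normB _ _) _.
by apply: lerD; apply: IH => //; rewrite ?divr_gt0.
Qed.

(** The cost of p against a bound c / sqrt z. The shift by p costs up(p) sqrt p, which is the second
    summand. For the shift by p^2 only the excess up(p) - p^-2 = up(p) / p is charged, at the price
    p, which gives up(p). *)
Definition cp p : R := up p + (Num.sqrt p%:R * (p%:R - 1))^-1.
Definition Cprod S : R := \prod_(p <- S) (1 + cp p).

Lemma sum_odd_list_le z (J : seq nat) : 0 < z -> uniq J -> (forall j, j \in J -> odd j) ->
  \sum_(j <- J) (j%:R ^- 2 : R) * `|odd_defect (z / (j * j)%:R)| <= 103 / 100 / Num.sqrt z.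
Proof.
move=> z0 uJ oJ; have s0 : 0 < Num.sqrt z by rewrite sqrtr_gt0.
pose n := (\max_(j <- J) j./2).+1.
apply: le_trans (odd_sq_sum_le n s0); rewrite -(big_mkord xpredT (odd_sq_term (Num.sqrt z))).
have -> : \sum_(j <- J) (j%:R ^- 2 : R) * `|odd_defect (z / (j * j)%:R)|
    = \sum_(i <- [seq j./2 | j <- J]) odd_sq_term (Num.sqrt z) i.
  rewrite big_map big_seq [RHS]big_seq; apply: eq_bigr => j jJ; rewrite /odd_sq_term.
  have -> : 2 * j./2%:R + 1 = j%:R :> R.
    by rewrite -{2}(odd_double_half j) (oJ j jJ) natrD -muln2 natrM addrC mulrC.
  by rewrite expr_div_n sqr_sqrtr ?natrM -?expr2 // ltW.
apply: ler_sum_uniq_subset; rewrite ?iota_uniq //.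
- rewrite map_inj_in_uniq // => i j iJ jJ h.
  by rewrite -(odd_double_half i) -(odd_double_half j) (oJ i iJ) (oJ j jJ) h.
- move=> i /mapP[j jJ ->]; rewrite mem_index_iota /= ltnS.
  exact: (@leq_bigmax_seq _ J xpredT (fun j => j./2) j).
- by move=> i _; apply: odd_sq_term_ge0.
Qed.

(* The squares p^2 are absorbed into the index set: J and pJ together are again a set of odd numbers
   coprime to the primes already treated, so only the excess up(p) - 1/p^2 and the shift by p cost. *)
Lemma sum_defect_major S z (J : seq nat) : odd_primes S -> uniq S -> 0 < z -> uniq J ->
  (forall j, j \in J -> odd j && all (fun p => ~~ (p %| j)%N) S) ->
  \sum_(j <- J) (j%:R ^- 2 : R) * defect_major S (z / (j * j)%:R)
  <= 103 / 100 * Cprod S / Num.sqrt z.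
Proof.
elim: S z J => [|p S IH] z J.
  move=> _ _ z0 uJ hJ; rewrite /Cprod big_nil mulr1; apply: sum_odd_list_le => // j /hJ.
  by rewrite andbT.
move=> /odd_primes_cons[pp po hS] /= /andP[pS uS] z0 uJ hJ.
have p0 := prime_gt0 pp; have pR : 0 < p%:R :> R by rewrite ltr0n.
have p1 := prime_sub1_gt0 pp.
have hSp q : q \in S -> prime q by move=> /hS /andP[].
have F0 y : 0 <= defect_major S y by apply: defect_major_ge0.
have jodd j : j \in J -> odd j by move=> /hJ /andP[].
have jS j : j \in J -> all (fun q => ~~ (q %| j)%N) S by move=> /hJ /and3P[].
have jp j : j \in J -> ~~ (p %| j)%N by move=> /hJ /and3P[].
have j0 j : j \in J -> (0 < j)%N by move=> /jodd; case: j.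
pose F y : R := \sum_(j <- J) (j%:R ^- 2 : R) * defect_major S (y / (j * j)%:R).
pose K : R := 103 / 100 * Cprod S.
have FK y : 0 < y -> F y <= K / Num.sqrt y.
  by move=> y0; apply: IH => // j jJ; rewrite jodd //= jS.
have FF : F z + (p%:R ^- 2) * F (z / p%:R / p%:R) <= K / Num.sqrt z.
  have := IH z (J ++ [seq (p * j)%N | j <- J]) hS uS z0.
  rewrite big_cat big_map /= -/(F z).
  have -> : \sum_(j <- J) ((p * j)%:R ^- 2 : R) * defect_major S (z / (p * j * (p * j))%:R)
     = p%:R ^- 2 * F (z / p%:R / p%:R).
    rewrite /F mulr_sumr big_seq [RHS]big_seq; apply: eq_bigr => j jJ.
    have jR : j%:R != 0 :> R by rewrite pnatr_eq0 -lt0n j0.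
    have -> : z / (p * j * (p * j))%:R = z / p%:R / p%:R / (j * j)%:R.
      by rewrite !natrM; field; rewrite jR gt_eqF.
    by rewrite natrM exprMn invfM mulrA.
  apply.
    rewrite cat_uniq uJ map_inj_uniq ?uJ ?andbT /=; last first.
      by move=> i j /eqP; rewrite eqn_pmul2l // => /eqP.
    apply/hasPn => j /mapP[i iJ ->]; apply/negP => /jp; by rewrite dvdn_mulr.
  move=> j; rewrite mem_cat => /orP[jJ|/mapP[i iJ ->]]; first by rewrite jodd //= jS.
  rewrite oddM po jodd //=; apply/allP => q qS; have := allP (jS i iJ) q qS.
  rewrite Gauss_dvdr // prime_coprime ?(hSp q qS) // dvdn_prime2 ?(hSp q qS) //.
  by apply: contraNneq pS => E; rewrite ?E // -E.
have split3 : \sum_(j <- J) (j%:R ^- 2 : R) * (defect_major S (z / (j * j)%:R)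
      + up p * (defect_major S (z / (j * j)%:R / p%:R) + defect_major S (z / (j * j)%:R / p%:R / p%:R)))
   = F z + up p * F (z / p%:R) + up p * F (z / p%:R / p%:R).
  rewrite /F !mulr_sumr -!big_split /=; apply: eq_bigr => i _.
  rewrite [z / p%:R / p%:R / _]mulrAC ![z / p%:R / (i * i)%:R]mulrAC.
  by ring.
rewrite split3.
have sz : 0 < Num.sqrt z by rewrite sqrtr_gt0.
have sp : 0 < Num.sqrt (p%:R : R) by rewrite sqrtr_gt0.
have sp2 : Num.sqrt (p%:R : R) ^+ 2 = p%:R by rewrite sqr_sqrtr.
have h1 : F (z / p%:R) <= K * Num.sqrt p%:R / Num.sqrt z.
  apply: (le_trans (FK _ _)); first by rewrite divr_gt0.
  by rewrite sqrtrM ?(ltW z0) // sqrtrV ?(ltW pR) // invfM invrK mulrA mulrAC.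
have h2 : F (z / p%:R / p%:R) <= K * p%:R / Num.sqrt z.
  apply: (le_trans (FK _ _)); first by rewrite !divr_gt0.
  rewrite -mulrA -invfM -expr2 sqrtrM ?(ltW z0) // sqrtrV ?exprn_ge0 ?(ltW pR) // sqrtr_sqr gtr0_norm //.
  by rewrite invfM invrK mulrA mulrAC.
have upE : up p = p%:R ^- 2 + up p / p%:R by rewrite /up; field; rewrite !gt_eqF.
rewrite [X in _ + X * _]upE mulrDl addrACA -[F z + _ + _]addrA addrCA.
apply: (@le_trans _ _ (up p * (K * Num.sqrt p%:R / Num.sqrt z) + K / Num.sqrt z
    + up p / p%:R * (K * p%:R / Num.sqrt z))).
  have u0 := up_gt0 pp.
  have t1 : up p * F (z / p%:R) <= up p * (K * Num.sqrt p%:R / Num.sqrt z) by rewrite ler_pM2l.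
  have t2 : up p / p%:R * F (z / p%:R / p%:R) <= up p / p%:R * (K * p%:R / Num.sqrt z).
    by rewrite ler_pM2l // divr_gt0.
  by move: t1 t2 FF; move: (F _) (F _) (F _) => *; lra.
rewrite le_eqVlt; apply/orP; left; apply/eqP.
rewrite /Cprod big_cons -/(Cprod S) /cp /up /K.
move: (Num.sqrt p%:R) sp sp2 => v v0 v2; move: p1 pR; rewrite -v2 => p1 pR.
by field; rewrite !gt_eqF.
Qed.

Lemma wdefect_le S z : odd_primes S -> uniq S -> 0 < z ->
  `|wdefect S z| <= 103 / 100 * Cprod S / Num.sqrt z.
Proof.
move=> hS uS z0; apply: le_trans (wdefect_le_major hS uS z0) _.
have H := @sum_defect_major S z [:: 1%N] hS uS z0 isT.
have {}H : \sum_(j <- [:: 1%N]) (j%:R ^- 2 : R) * defect_major S (z / (j * j)%:R)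
    <= 103 / 100 * Cprod S / Num.sqrt z.
  apply: H => j; rewrite mem_seq1 => /eqP ->; apply/allP => p /hS /andP[pp _].
  by rewrite dvdn1; apply: contraTN pp => /eqP ->.
by move: H; rewrite big_seq1 expr1n invr1 mul1r mulr1.
Qed.

Lemma weight_totient S n : odd_primes S -> uniq S -> (0 < n)%N -> odd n ->
  (forall p, prime p -> (p %| n)%N -> p \in S) ->
  weight S n / n%:R = if sqf n then (totient n)%:R^-1 else 0.
Proof.
move=> hS uS; elim/ltn_ind: n => n IH n0 on nS.
have [n1|n1] := leqP n 1.
  have -> : n = 1%N by apply/eqP; rewrite eqn_leq n1.
  rewrite /= divr1 invr1 /weight big_seq big1 // => p /hS /andP[pp _].
  by rewrite dvdn1; case: eqP => // p1; rewrite p1 in pp.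
pose p := pdiv n; have pp : prime p by apply: pdiv_prime.
have pn : (p %| n)%N by apply: pdiv_dvd.
have p0 := prime_gt0 pp; have pS : p \in S by apply: nS.
pose m := (n %/ p)%N; have nE : n = (p * m)%N by rewrite mulnC divnK.
have m0 : (0 < m)%N by rewrite divn_gt0 // dvdn_leq.
have mn : (m < n)%N by rewrite ltn_Pdiv // prime_gt1.
have om : odd m by move: on; rewrite nE oddM => /andP[].
have mS q : prime q -> (q %| m)%N -> q \in S by move=> qp qm; apply: nS => //; rewrite nE dvdn_mull.
have pR : 0 < p%:R :> R by rewrite ltr0n.
have p1 := prime_sub1_gt0 pp.
rewrite nE sqf_primeM //; have [pm|pm] := boolP (p %| m)%N.
  by rewrite /weight (bigD1_seq p) //= dvdn_mulr // dvdn_pmul2l // pm !mul0r.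
have wE : weight S (p * m) = p%:R / (p%:R - 1) * weight S m.
  rewrite /weight (bigD1_seq p) //= dvdn_mulr // dvdn_pmul2l // (negPf pm).
  rewrite [in RHS](bigD1_seq p) //= (negPf pm) mul1r; congr (_ * _).
  rewrite big_seq_cond [RHS]big_seq_cond; apply: eq_bigr => q /andP[qS qp].
  have /andP[qpr _] := hS q qS.
  have cq : coprime q p by rewrite prime_coprime // dvdn_prime2.
  by rewrite !Gauss_dvdr // coprimeMl cq.
have {}IH := IH m mn m0 om mS.
have -> : weight S (p * m) / (p * m)%:R = (weight S m / m%:R) / (p%:R - 1).
  by rewrite wE natrM; field; rewrite !gt_eqF // ltr0n.
rewrite IH /=; case: (sqf m); last by rewrite mul0r.
have -> : totient (p * m) = (p.-1 * totient m)%N by rewrite totient_coprime ?prime_coprime // totient_prime.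
rewrite natrM invfM mulrC; congr (_^-1 * _).
by rewrite -{1}(prednK p0) -natr1 addrK.
Qed.

Definition odd_primes_upto (k N : nat) : seq nat := [seq p <- iota k N | prime p && odd p].

Lemma odd_primes_uptoP k N : odd_primes (odd_primes_upto k N).
Proof. by move=> p; rewrite mem_filter => /andP[]. Qed.

Lemma uniq_odd_primes_upto k N : uniq (odd_primes_upto k N).
Proof. by rewrite filter_uniq // iota_uniq. Qed.

Lemma Gn2_wsum N n : (n <= N)%N -> Gn R 2 n = wsum (odd_primes_upto 3 N) n.
Proof.
move=> nN; rewrite /Gn /wsum big_mkcond [RHS]big_mkcond; apply: eq_big_nat => r /andP[r0 rn].
rewrite coprimen2; case: (boolP (odd r)) => or; last by rewrite andbF.
rewrite andbT weight_totient //; first exact: odd_primes_uptoP; first exact: uniq_odd_primes_upto.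
move=> p pp pr; rewrite mem_filter pp mem_iota (dvdn_odd pr or) /=.
rewrite odd_prime_gt2 ?(dvdn_odd pr or) //= (leq_ltn_trans (dvdn_leq r0 pr)) //; lia.
Qed.

(** The prime 3 stays outside the list and its multiples are removed by subtraction. Treating 3
    through [wsum_cons] would worsen the error by the factor 1 + cp(3). *)
Lemma Gn6_wsum N n : (n <= N)%N ->
  Gn R 6 n = wsum (odd_primes_upto 5 N) n - wsum (odd_primes_upto 5 N) (n %/ 3) / 3.
Proof.
move=> nN; have hS := @odd_primes_uptoP 5 N; have uS := uniq_odd_primes_upto 5 N.
have S3 : 3%N \notin odd_primes_upto 5 N by rewrite mem_filter mem_iota andbF.
rewrite -(@wsum_coprime (odd_primes_upto 5 N) 3) //.
rewrite /Gn big_mkcond [RHS]big_mkcond; apply: eq_big_nat => r /andP[r0 rn].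
rewrite (coprimeMr r 2 3) coprimen2 [coprime r 3]coprime_sym prime_coprime // [odd r && _]andbC.
case: (boolP (~~ (3 %| r)%N && odd r)) => [/andP[r3 or]|]; last by rewrite andbF.
rewrite andbT weight_totient //.
move=> p pp pr; have po := dvdn_odd pr or; rewrite mem_filter pp mem_iota po /=.
have p2 := odd_prime_gt2 po pp; have pn := leq_ltn_trans (dvdn_leq r0 pr) rn.
have p3 : p != 3%N by apply: contraNneq r3 => <-.
have p4 : p != 4%N by apply: contraTneq po => ->.
by apply/andP; split; lia.
Qed.

End SieveWeights.

(* [%Z] already delimits MathComp's [int_scope]. *)
Delimit Scope Z_scope with stdZ.

(* Locked: unification would otherwise unfold large literals to unary numerals. *)
HB.lock Definition zr (R : realType) (x : Z) : R := (int_of_Z x)%:~R.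

(** * Integer tables with directed rounding *)

Section IntegerTables.
Variable R : realType.
Local Notation zr := (@zr R).
Implicit Types (x y : Z) (n k : nat).

Lemma zrD x y : zr (x + y)%stdZ = zr x + zr y.
Proof. by rewrite ?zr.unlock -rmorphD -raddfD. Qed.

Lemma zrM x y : zr (x * y)%stdZ = zr x * zr y.
Proof. by rewrite ?zr.unlock -rmorphM -rmorphM. Qed.

Lemma zr_nat n : zr (Z.of_nat n) = n%:R.
Proof. by rewrite ?zr.unlock -[Z.of_nat n]/(Z_of_int (Posz n)) Z_of_intK. Qed.

Lemma zr_le x y : Z.leb x y -> zr x <= zr y.
Proof. by move=> h; rewrite ?zr.unlock ler_int; lia. Qed.

Lemma zr_div_le x y : Z.ltb 0 y -> zr (x / y)%stdZ <= zr x / zr y.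
Proof.
move=> y0; have yp : 0 < zr y by rewrite ?zr.unlock ltr0z; lia.
rewrite ler_pdivlMr // -zrM; apply: zr_le.
by have := Z.mul_div_le x y; move: (x / y)%stdZ => q; lia.
Qed.

Lemma zr_div_ge x y : Z.ltb 0 y -> zr x / zr y <= zr (x / y + 1)%stdZ.
Proof.
move=> y0; have yp : 0 < zr y by rewrite ?zr.unlock ltr0z; lia.
rewrite ler_pdivrMr // -zrM; apply: zr_le.
by have := Z.mul_succ_div_gt x y; move: (x / y)%stdZ => q; nia.
Qed.

Fixpoint tab (f : nat -> Z -> Z) (k n : nat) (v : Z) : seq Z :=
  if n is n'.+1 then v :: tab f k.+1 n' (f k v) else [:: v].

Lemma tab_invariant (P : nat -> Z -> Prop) f k n v :
  P k v -> (forall j w, (k <= j)%N -> P j w -> P j.+1 (f j w)) ->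
  forall i, (i <= n)%N -> P (k + i)%N (nth 0%stdZ (tab f k n v) i).
Proof.
elim: n k v => [|n IH] k v Pk Pf [|i] //=; rewrite ?addn0 // ltnS => h.
rewrite addnS -addSn; apply: IH => //; first exact: Pf.
by move=> j w kj; apply: Pf; apply: ltnW.
Qed.

Variable K : Z.
Hypothesis K0 : Z.ltb 0 K.

(** The increments are the bounds of [ln_succ_ge] and [ln_succ_le] over a common denominator, scaled
    by K and rounded down, respectively up. *)
Definition lnL_step (k : nat) (v : Z) : Z :=
  let m := (2 * Z.of_nat k + 1)%stdZ in (v + K * (6 * m * m + 2) / (3 * m * m * m))%stdZ.
Definition lnU_step (k : nat) (v : Z) : Z :=
  let c := Z.of_nat k in
  (v + (K * (12 * c * (c + 1) + 1) / (6 * c * (c + 1) * (2 * c + 1)) + 1))%stdZ.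

(** The entry of index 0 is a placeholder that makes the index equal to the argument of the
    logarithm. *)
Definition lnL_tab (n : nat) : seq Z := 0%stdZ :: tab lnL_step 1 n 0.
Definition lnU_tab (n : nat) : seq Z := 0%stdZ :: tab lnU_step 1 n 0.

Lemma zrK_gt0 : 0 < zr K.
Proof. by rewrite zr.unlock ltr0z; move: K0; lia. Qed.

Lemma zr_lit (n : nat) (x : Z) : Z.eqb x (Z.of_nat n) -> zr x = n%:R.
Proof. by move=> /eqP ->; rewrite zr_nat. Qed.

Definition zr_literals := (@zr_lit 1 1%stdZ erefl, @zr_lit 2 2%stdZ erefl, @zr_lit 3 3%stdZ erefl,
  @zr_lit 4 4%stdZ erefl, @zr_lit 5 5%stdZ erefl, @zr_lit 6 6%stdZ erefl, @zr_lit 12 12%stdZ erefl).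
Ltac zr_norm := rewrite !(zrM, zrD, zr_nat) ?zr_literals.

Lemma lnL_stepP k v : (0 < k)%N -> zr v <= zr K * ln k%:R -> zr (lnL_step k v) <= zr K * ln k.+1%:R.
Proof.
move=> k0 h.
have kR : 1 <= k%:R :> R by rewrite ler1n.
have := ln_succ_ge R k0; move: (ln k.+1%:R) => L1 hl.
rewrite /lnL_step; set m := (2 * Z.of_nat k + 1)%stdZ; rewrite zrD.
have mE : zr m = 2 * k%:R + 1 by rewrite /m; zr_norm.
have m0 : 0 < zr m by rewrite mE; lra.
have mz : Z.ltb 0 (3 * m * m * m) by rewrite /m; nia.
clearbody m.
have hd : zr (K * (6 * m * m + 2) / (3 * m * m * m))%stdZ
    <= zr K * (2 / (2 * k%:R + 1) + 2 / 3 / (2 * k%:R + 1) ^+ 3).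
  apply: le_trans (zr_div_le _ _) _; first exact: mz.
  zr_norm; rewrite mE; move: (zr K) (2 * k%:R + 1 : R) m0 mE => s v0 m0 <-.
  rewrite le_eqVlt; apply/orP; left; apply/eqP; field; exact: lt0r_neq0.
have := ler_wpM2l (ltW zrK_gt0) hl; rewrite mulrBr; lra.
Qed.

Lemma lnU_stepP k v : (0 < k)%N -> zr K * ln k%:R <= zr v -> zr K * ln k.+1%:R <= zr (lnU_step k v).
Proof.
move=> k0 h.
have kR : 1 <= k%:R :> R by rewrite ler1n.
have := ln_succ_le R k0; move: (ln k.+1%:R) => L1 hl.
rewrite /lnU_step; set c := Z.of_nat k; rewrite zrD.
have cE : zr c = k%:R by rewrite zr_nat.
have cz : Z.ltb 0 (6 * c * (c + 1) * (2 * c + 1)) by rewrite /c; nia.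
clearbody c.
have hd : zr K * (2 / (2 * k%:R + 1) + (6 * k%:R * (k%:R + 1) * (2 * k%:R + 1))^-1)
   <= zr (K * (12 * c * (c + 1) + 1) / (6 * c * (c + 1) * (2 * c + 1)) + 1)%stdZ.
  apply: le_trans (zr_div_ge _ _); last exact: cz.
  zr_norm; rewrite cE; move: (zr K) (k%:R : R) kR {h hl cE} => s z z1.
  rewrite le_eqVlt; apply/orP; left; apply/eqP; field; rewrite !gt_eqF //; lra.
have := ler_wpM2l (ltW zrK_gt0) hl; rewrite mulrBr; lra.
Qed.

Lemma ln3_bounds : (3 * (70 / 101) + 2 / 17) / 2 <= ln (3 : R) <= (3 * (61 / 88) + 2 / 17 + 1 / 7344) / 2.
Proof.
have /andP[l1 l2] := ln2_bounds R.
have a8 : 1 / 17 * (2 * 8%:R + 1) = 1 :> R by field.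
have b8 : 1 / 432 * (6 * 8%:R * (8%:R + 1)) = 1 :> R by field.
have /andP[] := ln_succ_num (isT : 0 < 8)%N a8 b8; rewrite ln8E.
have -> : ln (9 : R) = 2 * ln 3 by rewrite (_ : 9 = 3 * 3) ?lnM ?posrE //; ring.
by move=> h1 h2; apply/andP; split; lra.
Qed.

Lemma lnL_tabP n k : (0 < k)%N -> (k <= n + 1)%N -> zr (nth 0%stdZ (lnL_tab n) k) <= zr K * ln k%:R.
Proof.
case: k => // k _; rewrite addn1 ltnS => kn.
apply: (@tab_invariant (fun k v => zr v <= zr K * ln k%:R) lnL_step 1 n 0%stdZ _ lnL_stepP k kn).
by rewrite ln1 mulr0 (@zr_lit 0 0%stdZ erefl).
Qed.

Lemma lnU_tabP n k : (0 < k)%N -> (k <= n + 1)%N -> zr K * ln k%:R <= zr (nth 0%stdZ (lnU_tab n) k).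
Proof.
case: k => // k _; rewrite addn1 ltnS => kn.
apply: (@tab_invariant (fun k v => zr K * ln k%:R <= zr v) lnU_step 1 n 0%stdZ _ lnU_stepP k kn).
by rewrite ln1 mulr0 (@zr_lit 0 0%stdZ erefl).
Qed.

Definition inv_totient_coprime6 (r : nat) : bool := sqf r && coprime r 6.

(** The factor 3 is 6 / phi(6), so the tables hold K X_6. The values for the other divisors of 6 are
    linear combinations of these. *)
Definition xU_step (k : nat) (v : Z) : Z :=
  if inv_totient_coprime6 k.+1 then (v + (3 * K / Z.of_nat (totient k.+1) + 1))%stdZ else v.
Definition xL_step (k : nat) (v : Z) : Z :=
  if inv_totient_coprime6 k.+1 then (v + 3 * K / Z.of_nat (totient k.+1))%stdZ else v.
Definition xU_tab (n : nat) : seq Z := tab xU_step 0 n 0.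
Definition xL_tab (n : nat) : seq Z := tab xL_step 0 n 0.

Lemma Gn_recr d n : Gn R d n.+1 = Gn R d n + if sqf n.+1 && coprime n.+1 d then (totient n.+1)%:R^-1 else 0.
Proof. by rewrite /Gn big_mkcond big_nat_recr //= -big_mkcond. Qed.

Lemma xU_tabP n k : (k <= n)%N -> zr K * (3 * Gn R 6 k) <= zr (nth 0%stdZ (xU_tab n) k).
Proof.
move=> kn; have := @tab_invariant (fun k v => zr K * (3 * Gn R 6 k) <= zr v) xU_step 0 n 0%stdZ.
rewrite /xU_tab; apply => // [|j w _ h]; first by rewrite /Gn big_geq // !mulr0 (@zr_lit 0 0%stdZ erefl).
rewrite Gn_recr /xU_step -/(inv_totient_coprime6 j.+1); case: ifP => _; last by rewrite addr0.
have t0 : (0 < totient j.+1)%N by rewrite totient_gt0.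
rewrite zrD mulrDr mulrDr; apply: lerD => //.
apply: le_trans (zr_div_ge _ _); last by lia.
by rewrite zrM zr_nat (@zr_lit 3 3%stdZ erefl) mulrCA mulrA.
Qed.

Lemma xL_tabP n k : (k <= n)%N -> zr (nth 0%stdZ (xL_tab n) k) <= zr K * (3 * Gn R 6 k).
Proof.
move=> kn; have := @tab_invariant (fun k v => zr v <= zr K * (3 * Gn R 6 k)) xL_step 0 n 0%stdZ.
rewrite /xL_tab; apply => // [|j w _ h]; first by rewrite /Gn big_geq // !mulr0 (@zr_lit 0 0%stdZ erefl).
rewrite Gn_recr /xL_step -/(inv_totient_coprime6 j.+1); case: ifP => _; last by rewrite addr0.
have t0 : (0 < totient j.+1)%N by rewrite totient_gt0.
rewrite zrD mulrDr mulrDr; apply: lerD => //.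
apply: le_trans (zr_div_le _ _) _; first by lia.
by rewrite zrM zr_nat (@zr_lit 3 3%stdZ erefl) mulrCA mulrA.
Qed.

End IntegerTables.

(** * Normalized sums X_S and the effect of one more prime *)

Section CoprimeSums.
Variable R : realType.
Implicit Types (S T : seq nat) (p q r N d : nat).

Definition sifted S r : bool := sqf r && all (fun p => ~~ (p %| r)%N) S.
Definition Hs S N : R := \sum_(1 <= r < N.+1 | sifted S r) (totient r)%:R^-1.
(* For [S] the primes dividing [d] this is [d / phi d] times the sum of [1 / phi r] over
   squarefree [r <= N] coprime to [d]. *)
Definition Xs S N : R := (\prod_(p <- S) (p%:R / (p%:R - 1))) * Hs S N.

Lemma Xs_perm S T N : perm_eq S T -> Xs S N = Xs T N.
Proof.
move=> h; rewrite /Xs (perm_big T) //; congr (_ * _); apply: eq_bigl => r.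
by rewrite /sifted (perm_all _ h).
Qed.

Lemma Hs_ge0 S N : 0 <= Hs S N.
Proof. by apply: sumr_ge0 => r _; rewrite invr_ge0. Qed.

Lemma Xs_factor_gt0 S : (forall p, p \in S -> prime p) -> 0 < \prod_(p <- S) (p%:R / (p%:R - 1)) :> R.
Proof.
move=> hS; rewrite big_seq; elim/big_ind: _ => // [x y|p /hS pp]; first exact: mulr_gt0.
by rewrite divr_gt0 ?prime_sub1_gt0 // ltr0n prime_gt0.
Qed.

Lemma Hs_mono S M N : (M <= N)%N -> Hs S M <= Hs S N.
Proof.
move=> MN; rewrite /Hs [leRHS](@big_cat_nat _ _ _ M.+1) //=.
by rewrite lerDl; apply: sumr_ge0 => r _; rewrite invr_ge0.
Qed.

Lemma Xs_mono S M N : (forall p, p \in S -> prime p) -> (M <= N)%N -> Xs S M <= Xs S N.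
Proof. by move=> hS MN; rewrite /Xs ler_pM2l ?Xs_factor_gt0 // Hs_mono. Qed.

Lemma Xs_ge0 S N : (forall p, p \in S -> prime p) -> 0 <= Xs S N.
Proof. by move=> hS; rewrite mulr_ge0 ?Hs_ge0 // ltW // Xs_factor_gt0. Qed.

Lemma Hs_cons p S N : prime p -> (forall q, q \in S -> prime q) -> p \notin S ->
  Hs S N = Hs (p :: S) N + Hs (p :: S) (N %/ p) / (p%:R - 1).
Proof.
move=> pp hS pS; have p0 := prime_gt0 pp.
rewrite {1}/Hs (bigID (fun r => p %| r)%N) /= addrC; congr (_ + _).
  by apply: eq_bigl => r; rewrite /sifted /= -andbA; congr (_ && _); rewrite andbC.
under eq_bigl => r do rewrite andbC.
rewrite big_dvdn_reindex // mulr_suml big_mkcond [RHS]big_mkcond; apply: eq_big_nat => r /andP[r0 _].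
rewrite /sifted sqf_primeM //=.
have -> : all (fun q => ~~ (q %| p * r)%N) S = all (fun q => ~~ (q %| r)%N) S.
  apply: eq_in_all => q qS; have qp := hS q qS.
  rewrite Gauss_dvdr // prime_coprime // dvdn_prime2 //.
  by apply: contraNneq pS => <-.
case: (boolP (p %| r)%N) => pr /=; first by rewrite andbF.
case: ifP => // _; rewrite totient_coprime ?prime_coprime // totient_prime // natrM invfM mulrC.
by rewrite -subn1 natrB.
Qed.

(** In this normalization X_S(N) is the mean of X_{pS}(N) and X_{pS}(N / p) with weights (p - 1) / p
    and 1 / p. This is the reason for the factor d / phi(d). *)
Lemma Xs_cons p S N : prime p -> (forall q, q \in S -> prime q) -> p \notin S ->
  Xs S N = ((p%:R - 1) * Xs (p :: S) N + Xs (p :: S) (N %/ p)) / p%:R.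
Proof.
move=> pp hS pS; rewrite {1}/Xs (Hs_cons N pp hS pS) /Xs !big_cons.
have := prime_sub1_gt0 R pp; have : 0 < p%:R :> R by rewrite ltr0n prime_gt0.
move: (p%:R : R) (\prod_(j <- S) _) (Hs _ _) (Hs _ _) => z c u v z0 z1.
by field; rewrite !gt_eqF.
Qed.

Section Step.
Variables (p : nat) (S : seq nat).
Hypotheses (pp : prime p) (hS : forall q, q \in S -> prime q) (pS : p \notin S).

Lemma prime_consP q : q \in p :: S -> prime q.
Proof. by rewrite inE => /orP[/eqP ->|/hS]. Qed.

Lemma Xs_le_cons N : Xs S N <= Xs (p :: S) N.
Proof.
rewrite (Xs_cons N pp hS pS); have p0 : 0 < p%:R :> R by rewrite ltr0n prime_gt0.
have := Xs_mono prime_consP (leq_div N p).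
move: (Xs _ (N %/ p)) (Xs (p :: S) N) => u v uv.
by rewrite ler_pdivrMr // mulrBl mul1r mulrC; lra.
Qed.

(** With X_{pS}(N / p) in place of X_S(N / p) this is an equality, a rearrangement of [Xs_cons]; the
    replacement by the smaller value only increases the right side. *)
Lemma Xs_cons_le N : Xs (p :: S) N <= Xs S N + (Xs S N - Xs S (N %/ p)) / (p%:R - 1).
Proof.
have := Xs_le_cons (N %/ p); rewrite (Xs_cons N pp hS pS).
have := prime_sub1_gt0 R pp; have : 0 < p%:R :> R by rewrite ltr0n prime_gt0.
move: (p%:R : R) (Xs (p :: S) _) (Xs _ (N %/ p)) (Xs _ (N %/ p)) => z v w u z0 z1 uw.
have -> : ((z - 1) * v + w) / z + (((z - 1) * v + w) / z - u) / (z - 1) = v + (w - u) / (z - 1).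
  by field; rewrite !gt_eqF.
by rewrite lerDl mulr_ge0 ?subr_ge0 ?invr_ge0 // ltW.
Qed.
End Step.

Lemma natr_div_totient d : (0 < d)%N ->
  d%:R / (totient d)%:R = \prod_(p <- primes d) (p%:R / (p%:R - 1)) :> R.
Proof.
move=> d0; rewrite totientE // {1}(prod_prime_decomp d0) prime_decompE big_map /=.
rewrite !natr_prod -prodf_div big_seq [RHS]big_seq; apply: eq_bigr => p.
rewrite mem_primes => /and3P[pp _ pd]; have p0 := prime_gt0 pp.
have pz : 0 < p%:R :> R by rewrite ltr0n.
have p1 := prime_sub1_gt0 R pp.
have -> : logn p d = (logn p d).-1.+1 by rewrite prednK // logn_gt0 mem_primes pp d0.
rewrite /= expnS !natrM -[p.-1]subn1 natrB //.
have e0 : 0 < (p ^ (logn p d).-1)%:R :> R by rewrite ltr0n expn_gt0 p0.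
by field; rewrite !gt_eqF.
Qed.

Lemma Gn_Xs d N : (0 < d)%N -> d%:R / (totient d)%:R * Gn R d N = Xs (primes d) N.
Proof.
move=> d0; rewrite natr_div_totient // /Xs; congr (_ * _).
rewrite /Gn /Hs big_mkcond [RHS]big_mkcond; apply: eq_big_nat => r /andP[r0 _].
rewrite /sifted coprime_sym coprime_has_primes // has_sym -all_predC.
suff -> : all (predC (mem (primes r))) (primes d) = all (fun p => ~~ (p %| r)%N) (primes d) by [].
by apply: eq_in_all => p; rewrite mem_primes => /and3P[pp _ _]; rewrite /= mem_primes pp r0.
Qed.

End CoprimeSums.

(** * Numerical verification for small arguments *)

Section SmallCases.
Variable R : realType.
Local Notation zr := (@zr R).

Definition base23 (b2 b3 : bool) : seq nat := (if b2 then [:: 2%N] else [::]) ++ (if b3 then [:: 3%N] else [::]).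
Definition base57 (b5 b7 : bool) : seq nat := (if b5 then [:: 5%N] else [::]) ++ (if b7 then [:: 7%N] else [::]).

Definition drop_at (S : seq nat) (p N : nat) : R := Xs R S N - Xs R S (N %/ p)%N.
(** When both primes occur, 5 is added first and then 7: the step for 7 multiplies the gain of 5 by
    7/6, which gives 7/24, and X_5(N / 7) is bounded below by X(N / 7). *)
Definition gain57 (b5 b7 : bool) (S : seq nat) (N : nat) : R :=
  match b5, b7 with
  | false, false => 0
  | true, false => drop_at S 5 N / 4
  | false, true => drop_at S 7 N / 6
  | true, true => (4 * drop_at S 7 N + 7 * drop_at S 5 N) / 24
  end.

Lemma base23_prime b2 b3 q : q \in base23 b2 b3 -> prime q.
Proof. by case: b2; case: b3; rewrite !inE // => h; repeat case/orP: h => h; move/eqP: h => ->. Qed.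

Lemma Xs_base57_le b5 b7 b2 b3 N :
  Xs R (base57 b5 b7 ++ base23 b2 b3) N <= Xs R (base23 b2 b3) N + gain57 b5 b7 (base23 b2 b3) N.
Proof.
set S := base23 b2 b3; have hS : forall q, q \in S -> prime q by exact: base23_prime.
have S5 : 5%N \notin S by rewrite /S; case: (b2); case: (b3).
have S7 : 7%N \notin S by rewrite /S; case: (b2); case: (b3).
have h5 := @Xs_cons_le R 5 S isT hS S5 N; have h7 := @Xs_cons_le R 7 S isT hS S7 N.
have E4 : 5%:R - 1 = 4 :> R by ring.
have E6 : 7%:R - 1 = 6 :> R by ring.
rewrite E4 in h5; rewrite E6 in h7.
case: b5; case: b7; rewrite /= ?addr0 //.
have S75 : 7%N \notin 5%N :: S by rewrite inE negb_or S7.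
have hS5 : forall q, q \in 5%N :: S -> prime q by move=> q; rewrite inE => /orP[/eqP ->|/hS].
have h := @Xs_cons_le R 7 (5%N :: S) isT hS5 S75 N.
have hge := @Xs_le_cons R 5 S isT hS S5 (N %/ 7)%N.
rewrite E6 in h; rewrite (@Xs_perm _ _ (7%N :: 5%N :: S)); last first.
  by rewrite (perm_catCA [:: 5%N] [:: 7%N]).
apply: le_trans h _; rewrite /drop_at.
move: (Xs R (5%N :: S) _) (Xs R (5%N :: S) _) h5 hge => u v h5 hge; lra.
Qed.

Lemma Xs_prime_split p S N : prime p -> (forall q, q \in S -> prime q) -> p \notin S ->
  p%:R * Xs R S N = (p%:R - 1) * Xs R (p :: S) N + Xs R (p :: S) (N %/ p)%N.
Proof.
move=> pp hS pS; rewrite (Xs_cons _ _ pp hS pS) mulrC divfK // gt_eqF // ltr0n; exact: prime_gt0.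
Qed.

Lemma Xs_23 N : Xs R (base23 true true) N = 3 * Gn R 6 N.
Proof.
rewrite -(@Gn_Xs R 6) //; congr (_ * _).
by rewrite (_ : totient 6 = 2%N) //; field.
Qed.

Lemma Xs_2 N : 3 * Xs R (base23 true false) N
  = 2 * (3 * Gn R 6 N) + 3 * Gn R 6 (N %/ 3)%N.
Proof.
rewrite -!Xs_23 (@Xs_prime_split 3 (base23 true false)) //; last exact: base23_prime.
by congr (_ * _ + _); [ring|apply: Xs_perm|apply: Xs_perm].
Qed.

Lemma Xs_3 N : 2 * Xs R (base23 false true) N = 3 * Gn R 6 N + 3 * Gn R 6 (N %/ 2)%N.
Proof.
rewrite -!Xs_23 (@Xs_prime_split 2 (base23 false true)) //; last exact: base23_prime.
by rewrite (_ : 2%:R - 1 = 1 :> R) ?mul1r //; ring.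
Qed.

Lemma Xs_1_2 N : 2 * Xs R (base23 false false) N = Xs R (base23 true false) N + Xs R (base23 true false) (N %/ 2)%N.
Proof.
rewrite (@Xs_prime_split 2 (base23 false false)) //.
by rewrite (_ : 2%:R - 1 = 1 :> R) ?mul1r //; ring.
Qed.

Lemma Xs_1 N : 6 * Xs R (base23 false false) N
  = 2 * (3 * Gn R 6 N) + 3 * Gn R 6 (N %/ 3)%N
    + (2 * (3 * Gn R 6 (N %/ 2)%N) + 3 * Gn R 6 (N %/ 6)%N).
Proof.
have := Xs_2 (N %/ 2)%N; rewrite -divnMA; have := Xs_2 N; have := Xs_1_2 N; lra.
Qed.

(** The factor 6 clears the denominators 2 and 3 of [Xs_1], [Xs_2] and [Xs_3]. *)
Definition six_Xs (b2 b3 : bool) (Y : nat -> Z) (k : nat) : Z :=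
  match b2, b3 with
  | true, true => (6 * Y k)%stdZ
  | true, false => (4 * Y k + 2 * Y (k %/ 3)%N)%stdZ
  | false, true => (3 * Y k + 3 * Y (k %/ 2)%N)%stdZ
  | false, false => (2 * Y k + Y (k %/ 3)%N + (2 * Y (k %/ 2)%N + Y (k %/ 6)%N))%stdZ
  end.

Definition six_Xs_tab (b2 b3 : bool) (tY : seq Z) (n : nat) : seq Z :=
  [seq six_Xs b2 b3 (nth 0%stdZ tY) k | k <- iota 0 n.+1].

Variable K : Z.
Hypothesis K0 : Z.ltb 0 K.
Variable n : nat.

Lemma six_Xs_tabU b2 b3 k : (k <= n)%N ->
  zr K * (6 * Xs R (base23 b2 b3) k) <= zr (nth 0%stdZ (six_Xs_tab b2 b3 (xU_tab K n) n) k).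
Proof.
move=> kn; rewrite (nth_map 0%N) ?size_iota // nth_iota // add0n.
have h m : zr K * (3 * Gn R 6 (k %/ m)%N) <= zr (nth 0%stdZ (xU_tab K n) (k %/ m)%N).
  by apply: xU_tabP => //; apply: leq_trans kn; apply: leq_div.
have := h 1%N; have := h 2%N; have := h 3%N; have := h 6%N; rewrite divn1.
have e23 := Xs_23 k; have e1 := Xs_1 k; have e2 := Xs_2 k; have e3 := Xs_3 k.
case: b2; case: b3; rewrite /six_Xs !(zrD, zrM) ?zr_literals; move: (Xs R _ _) (zr K) e23 e1 e2 e3 => x s;
  by move=> *; nra.
Qed.

Lemma six_Xs_tabL b2 b3 k : (k <= n)%N ->
  zr (nth 0%stdZ (six_Xs_tab b2 b3 (xL_tab K n) n) k) <= zr K * (6 * Xs R (base23 b2 b3) k).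
Proof.
move=> kn; rewrite (nth_map 0%N) ?size_iota // nth_iota // add0n.
have h m : zr (nth 0%stdZ (xL_tab K n) (k %/ m)%N) <= zr K * (3 * Gn R 6 (k %/ m)%N).
  by apply: xL_tabP => //; apply: leq_trans kn; apply: leq_div.
have := h 1%N; have := h 2%N; have := h 3%N; have := h 6%N; rewrite divn1.
have e23 := Xs_23 k; have e1 := Xs_1 k; have e2 := Xs_2 k; have e3 := Xs_3 k.
case: b2; case: b3; rewrite /six_Xs !(zrD, zrM) ?zr_literals; move: (Xs R _ _) (zr K) e23 e1 e2 e3 => x s;
  by move=> *; nra.
Qed.

(* [144 K] times the upper bound for [Xs + gain57]. *)
Definition check_lhs (b5 b7 : bool) (tU tL : seq Z) (k : nat) : Z :=
  let x := nth 0%stdZ tU k in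
  let r5 := (x - nth 0%stdZ tL (k %/ 5)%N)%stdZ in
  let r7 := (x - nth 0%stdZ tL (k %/ 7)%N)%stdZ in
  (24 * x + match b5, b7 with
            | false, false => 0
            | true, false => 6 * r5
            | false, true => 4 * r7
            | true, true => 4 * r7 + 7 * r5
            end)%stdZ.

Lemma zrB x y : zr (x - y)%stdZ = zr x - zr y.
Proof. by rewrite -[X in _ = zr X - _](Z.sub_add y) zrD addrK. Qed.

Lemma check_lhsP b5 b7 b2 b3 k : (k <= n)%N ->
  zr K * (144 * (Xs R (base23 b2 b3) k + gain57 b5 b7 (base23 b2 b3) k))
  <= zr (check_lhs b5 b7 (six_Xs_tab b2 b3 (xU_tab K n) n) (six_Xs_tab b2 b3 (xL_tab K n) n) k).
Proof.
move=> kn; have hU := six_Xs_tabU b2 b3 kn.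
have h5 : (k %/ 5 <= n)%N by apply: leq_trans kn; apply: leq_div.
have h7 : (k %/ 7 <= n)%N by apply: leq_trans kn; apply: leq_div.
have {h5} := six_Xs_tabL b2 b3 h5; have {h7} := six_Xs_tabL b2 b3 h7.
rewrite /check_lhs /gain57 /drop_at; move: (nth 0%stdZ (six_Xs_tab b2 b3 (xU_tab K n) n) k) hU => yU hU.
move: (nth _ _ _) (nth _ _ _) => y7 y5; move: hU.
move: (Xs R _ _) (Xs R _ _) (Xs R _ _) => x x5 x7; case: b5; case: b7; rewrite ?addr0 ?Z.add_0_r !(zrD, zrM, zrB) ?zr_literals (@zr_lit _ 24 24%stdZ erefl) ?(@zr_lit _ 7 7%stdZ erefl);
  move: (zr K) => s *; lra.
Qed.

(* The target of [base_bounds] after [ln d >= 5 ln 10 - ln n], from [n d >= 10 ^ 5] up to the integer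
   part; 131/100 instead of 136/100 leaves room for the term [44 / 1000 / sqrt x] there. *)
Definition small_case_rhs (b2 b3 b5 b7 : bool) (n : R) : R :=
  885 / 1000 * ln n + 131 / 100 + 575 / 1000 * (ln 2 + ln 5)
  + 260 / 1000 * (b2%:R * ln 2 + b3%:R * ln 3 + b5%:R * ln 5 + b7%:R * ln 7)
  + 625 / 1000 * (b2%:R * (ln 2 / 2) + b3%:R * (ln 3 / 3)).

Definition Z_of_bool (b : bool) : Z := if b then 1%stdZ else 0%stdZ.

(** The comparison with [small_case_rhs], multiplied by 144 * 1000 * K. The coefficients 45000 and
    30000 are 144 * 625 / 2 and 144 * 625 / 3, from the terms ln 2 / 2 and ln 3 / 3. *)
Definition check1 (tl : seq Z) (b2 b3 b5 b7 : bool) (lhs : Z) (k : nat) : bool :=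
  let l := nth 0%stdZ tl in
  let z := Z_of_bool in
  Z.leb (1000 * lhs)
    (144 * (885 * l k + 1310 * K + 575 * (l 2%N + l 5%N)
       + 260 * (z b2 * l 2%N + z b3 * l 3%N + z b5 * l 5%N + z b7 * l 7%N))
     + (45000 * (z b2 * l 2%N) + 30000 * (z b3 * l 3%N)))%stdZ.

(** The two alternatives are the two branches of the maximum in [ln11_bound]; either one
    suffices. *)
Definition check2 (tl tu : seq Z) (lhs : Z) (k : nat) : bool :=
  let a := (144 * (26 * nth 0%stdZ tl 11))%stdZ in
  Z.leb (10 * lhs) a || Z.leb (10 * lhs) (a + 1440 * (nth 0%stdZ tl k - nth 0%stdZ tu 11))%stdZ.

Definition check_bools : seq (bool * bool) := [:: (false, false); (false, true); (true, false); (true, true)].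

Definition check_all : bool :=
  let tl := lnL_tab K n in
  let tu := lnU_tab K n in
  let xU := xU_tab K n in
  let xL := xL_tab K n in
  all (fun b23 : bool * bool =>
    let tU := six_Xs_tab b23.1 b23.2 xU n in
    let tL := six_Xs_tab b23.1 b23.2 xL n in
    all (fun k => all (fun b57 : bool * bool =>
      let lhs := check_lhs b57.1 b57.2 tU tL k in
      check1 tl b23.1 b23.2 b57.1 b57.2 lhs k && check2 tl tu lhs k) check_bools) (iota 1 n)) check_bools.

Lemma check1P b2 b3 b5 b7 k lhs : (0 < k)%N -> (k <= n)%N -> (7 <= n)%N ->
  check1 (lnL_tab K n) b2 b3 b5 b7 lhs k -> zr lhs <= zr K * (144 * small_case_rhs b2 b3 b5 b7 k%:R).
Proof.
move=> k0 kn n7; have hk m : (0 < m <= 7)%N || (m == k) -> zr (nth 0%stdZ (lnL_tab K n) m) <= zr K * ln m%:R.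
  move=> h; apply: lnL_tabP => //; first by case/orP: h => [/andP[]|/eqP ->].
  by case/orP: h => [/andP[_ h]|/eqP ->]; apply: leq_trans (leq_addr _ _) => //; apply: leq_trans n7.
have := hk 2%N isT; have := hk 3%N isT; have := hk 5%N isT; have := hk 7%N isT.
have := hk k; rewrite eqxx orbT => /(_ isT).
rewrite /check1 /small_case_rhs => h h7 h5 h3 h2 /(@zr_le R).
have s0 := zrK_gt0 R K0.
rewrite !(zrD, zrM) (@zr_lit _ 1000 1000%stdZ erefl) (@zr_lit _ 144 144%stdZ erefl) (@zr_lit _ 885 885%stdZ erefl)
  (@zr_lit _ 1310 1310%stdZ erefl) (@zr_lit _ 575 575%stdZ erefl) (@zr_lit _ 260 260%stdZ erefl).
have -> : zr 45000%stdZ = 45 * 1000.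
  by rewrite (_ : 45000%stdZ = (45 * 1000)%stdZ) // zrM (@zr_lit _ 45 45%stdZ erefl) (@zr_lit _ 1000 1000%stdZ erefl).
have -> : zr 30000%stdZ = 30 * 1000.
  by rewrite (_ : 30000%stdZ = (30 * 1000)%stdZ) // zrM (@zr_lit _ 30 30%stdZ erefl) (@zr_lit _ 1000 1000%stdZ erefl).
have E b : zr (Z_of_bool b) = b%:R by case: b; rewrite /= ?(@zr_lit _ 1 1%stdZ erefl) ?(@zr_lit _ 0 0%stdZ erefl).
rewrite !E; move: (zr (nth _ _ k)) (zr (nth _ _ 2%N)) (zr (nth _ _ 3%N)) (zr (nth _ _ 5%N)) (zr (nth _ _ 7%N)) h h2 h3 h5 h7.
move: (zr K) s0 (zr lhs) (ln k%:R) (ln 2%:R) (ln 3%:R) (ln 5%:R) (ln 7%:R) => s s0 l a a2 a3 a5 a7.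
move=> c c2 c3 c5 c7 h h2 h3 h5 h7.
have mb (b : bool) (x y : R) : x <= y -> b%:R * x <= b%:R * y by move=> xy; rewrite ler_wpM2l.
have := mb b2 _ _ h2; have := mb b3 _ _ h3; have := mb b5 _ _ h5; have := mb b7 _ _ h7.
move: (b2%:R : R) (b3%:R : R) (b5%:R : R) (b7%:R : R) => *; lra.
Qed.

(** What the primes p >= 11 need: a quantity below 2.6 ln 11 plus the positive part of ln (k / 11)
    exceeds the positive part of ln (k / p) by at most 2.6 ln p. The worst prime is 11. *)
Definition ln11_bound (k : R) : R := 26 / 10 * ln 11 + Num.max 0 (ln k - ln 11).

Lemma check2P k lhs : (0 < k)%N -> (k <= n)%N -> (11 <= n)%N ->
  check2 (lnL_tab K n) (lnU_tab K n) lhs k -> zr lhs <= zr K * (144 * ln11_bound k%:R).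
Proof.
move=> k0 kn n11.
have h1 : zr (nth 0%stdZ (lnL_tab K n) k) <= zr K * ln k%:R.
  by apply: lnL_tabP => //; apply: leq_trans (leq_addr _ _).
have h2 : zr (nth 0%stdZ (lnL_tab K n) 11) <= zr K * ln 11.
  by apply: lnL_tabP => //; apply: leq_trans (leq_addr _ _).
have h3 : zr K * ln 11 <= zr (nth 0%stdZ (lnU_tab K n) 11).
  by apply: lnU_tabP => //; apply: leq_trans (leq_addr _ _).
rewrite /check2 /ln11_bound => h; have s0 := zrK_gt0 R K0.
have [m1 m2] : 0 <= Num.max 0 (ln k%:R - ln 11) :> R /\ ln k%:R - ln 11 <= Num.max 0 (ln k%:R - ln 11) :> R.
  by split; rewrite le_max lexx ?orbT.
move: (Num.max _ _) m1 m2 => m m1 m2.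
have k1 := ler_wpM2l (ltW s0) m1; have k2 := ler_wpM2l (ltW s0) m2.
case/orP: h => /(@zr_le R); rewrite !(zrD, zrM, zrB) (@zr_lit _ 10 10%stdZ erefl) (@zr_lit _ 144 144%stdZ erefl) (@zr_lit _ 26 26%stdZ erefl)
  ?(@zr_lit _ 1440 1440%stdZ erefl); move: h1 h2 h3 k1 k2; rewrite mulr0 mulrBr;
  move: (zr (nth _ _ k)) (zr (nth _ _ 11%N)) (zr (nth _ _ 11%N)) (zr K) => *; lra.
Qed.

Lemma check_allP b2 b3 b5 b7 k : (11 <= n)%N -> check_all -> (0 < k)%N -> (k <= n)%N ->
  let B := Xs R (base23 b2 b3) k + gain57 b5 b7 (base23 b2 b3) k in
  B <= small_case_rhs b2 b3 b5 b7 k%:R /\ B <= ln11_bound k%:R.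
Proof.
move=> n11 hall k0 kn B; have s0 := zrK_gt0 R K0.
have mb x y : (x, y) \in check_bools by case: x; case: y.
have := allP hall _ (mb b2 b3) => /allP /(_ k); rewrite mem_iota k0 add1n ltnS kn => /(_ isT).
move=> /allP /(_ _ (mb b5 b7)) /andP[c1 c2].
have h := check_lhsP b5 b7 b2 b3 kn.
have h1 := check1P k0 kn (leq_trans (isT : 7 <= 11)%N n11) c1; have h2 := check2P k0 kn n11 c2.
have := le_trans h h1; have := le_trans h h2.
by rewrite !ler_pM2l.
Qed.

(** The logarithm is taken at k + 1 because a real x with integer part k is only known to be below k
    + 1. *)
Definition check_log (m : nat) : bool :=
  let tu := lnU_tab K n in
  let tL := six_Xs_tab false false (xL_tab K n) n in
  all (fun k => Z.leb (6 * nth 0%stdZ tu k.+1) (nth 0%stdZ tL k)) (iota 1 m).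

Lemma check_logP m k : (m < n)%N -> check_log m -> (0 < k)%N -> (k <= m)%N -> ln k.+1%:R <= Xs R [::] k.
Proof.
move=> mn /allP /(_ k); rewrite mem_iota add1n ltnS => h k0 km; move: h; rewrite k0 km => /(_ isT) /(@zr_le R).
have kn : (k.+1 <= n)%N by apply: leq_trans mn.
have h1 := lnU_tabP R K0 (isT : 0 < k.+1)%N (leq_trans kn (leq_addr 1 n)) => h2.
have h3 := @six_Xs_tabL false false k (ltnW kn); have s0 := zrK_gt0 R K0.
have : zr K * (6 * ln k.+1%:R) <= zr K * (6 * Xs R [::] k).
  apply: le_trans h3; apply: le_trans h2.
  by rewrite zrM (@zr_lit _ 6 6%stdZ erefl) mulrCA ler_pM2l.
by rewrite ler_pM2l // ler_pM2l.
Qed.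

End SmallCases.

Definition scale : Z := 1000000%stdZ.

Lemma check_all_1000 : check_all scale 1000.
Proof. by vm_compute. Qed.

Lemma check_log_40 : check_log scale 50 40.
Proof. by vm_compute. Qed.

Section SmallCasesConclusion.
Variable R : realType.

Lemma small_cases b2 b3 b5 b7 k : (0 < k)%N -> (k <= 1000)%N ->
  let B := Xs R (base23 b2 b3) k + gain57 R b5 b7 (base23 b2 b3) k in
  B <= small_case_rhs b2 b3 b5 b7 k%:R /\ B <= ln11_bound k%:R.
Proof. exact: (check_allP R (isT : Z.ltb 0 scale) b2 b3 b5 b7 (isT : 11 <= 1000)%N check_all_1000). Qed.

Lemma ln_succ_le_Xs k : (0 < k)%N -> (k <= 40)%N -> ln k.+1%:R <= Xs R [::] k.
Proof. exact: (check_logP R (isT : Z.ltb 0 scale) (isT : 40 < 50)%N check_log_40). Qed.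

End SmallCasesConclusion.

(** * Sums and products over primes: tails and tables *)

Section PrimeTails.
Variable R : realType.
Implicit Types (k m n p : nat) (S : seq nat).

(** The sum over odd primes is enlarged to all odd numbers, where consecutive terms differ by 2;
    hence the telescoping condition with [n.+2]. *)
Lemma odd_primes_tail_le (f t : nat -> R) (a k m : nat) :
  (forall n, (a <= n)%N -> 0 <= t n) -> (forall n, (a <= n)%N -> 0 <= f n <= t n - t n.+2) ->
  (a <= k)%N -> odd k -> \sum_(p <- odd_primes_upto k m) f p <= t k.
Proof.
move=> t0 ft; elim/ltn_ind: m k => m IH k ak ok.
have t2 : 0 <= t k.+2 by apply: t0; apply: leq_trans ak _; rewrite -addn2 leq_addr.
have /andP[f0 fk] := ft k ak.
have head m' : \sum_(p <- odd_primes_upto k m'.+1) f p <= f k + \sum_(p <- odd_primes_upto k.+1 m') f p.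
  rewrite /odd_primes_upto /=; case: ifP => _; first by rewrite big_cons.
  by rewrite lerDr.
case: m IH => [|[|m]] IH; first by rewrite big_nil t0.
  by apply: le_trans (head _) _; rewrite big_nil; lra.
apply: le_trans (head _) _.
have -> : odd_primes_upto k.+1 m.+1 = odd_primes_upto k.+2 m.
  by rewrite /odd_primes_upto /= ok andbF.
have := IH m (ltnW (ltnSn _)) k.+2 (leq_trans ak (leq_trans (leqnSn _) (leqnSn _))).
by rewrite /= negbK ok => /(_ isT); lra.
Qed.

Lemma prod_1D_le (f : nat -> R) (s : seq nat) : (forall p, p \in s -> 0 <= f p) ->
  (\sum_(p <- s) f p) < 1 -> \prod_(p <- s) (1 + f p) <= (1 - \sum_(p <- s) f p)^-1.
Proof.
move=> f0 s1; suff : \prod_(p <- s) (1 + f p) * (1 - \sum_(p <- s) f p) <= 1.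
  by move=> h; rewrite -[leRHS]div1r ler_pdivlMr ?subr_gt0.
elim: s f0 {s1} => [|p s IH] f0; first by rewrite !big_nil subr0 mulr1.
have fp := f0 p (mem_head _ _).
have fs q : q \in s -> 0 <= f q by move=> h; apply: f0; rewrite inE h orbT.
have P0 : 0 <= \prod_(q <- s) (1 + f q).
  by rewrite big_seq; apply: prodr_ge0 => q /fs; lra.
have S0 : 0 <= \sum_(q <- s) f q by rewrite big_seq; apply: sumr_ge0 => q /fs.
apply: le_trans (IH fs); rewrite !big_cons mulrC mulrA [X in _ <= X]mulrC; apply: ler_wpM2r => //.
nra.
Qed.

Definition kappa_term p : R := up R p * ln p%:R.
(** Half the integral of ln t / t^2 from n - 2 on, the half because only odd numbers are counted.
    Likewise [cp_tail] is half the integral of t^(-3/2) + t^(-2). *)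
Definition kappa_tail n : R := (ln (n%:R - 2) + 1) / (n%:R - 2) / 2.
Definition cp_tail n : R := (Num.sqrt (n%:R - 2))^-1 + (n%:R - 2)^-1 / 2.

Lemma kappa_tail_step n : (20 <= n)%N -> 0 <= kappa_term n <= kappa_tail n - kappa_tail n.+2.
Proof.
move=> n20; have nR : 20 <= n%:R :> R by rewrite ler_nat.
have L25 : 25 / 10 <= ln (n%:R : R).
  have /andP[l2 _] := ln2_bounds R.
  have : ln 16 <= ln (n%:R : R) by rewrite ler_ln ?posrE //; lra.
  by rewrite (_ : 16 = 4 * 4) ?lnM ?posrE // ?ln4E; lra.
rewrite /kappa_term /kappa_tail /up.
have -> : n.+2%:R - 2 = n%:R :> R by rewrite -addn2 natrD addrK.
have h : ln (n%:R : R) - 2 / (n%:R - 2) <= ln (n%:R - 2).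
  have z0 : 0 < n%:R - 2 :> R by lra.
  have q0 : 0 < n%:R / (n%:R - 2) :> R by rewrite divr_gt0 //; lra.
  have := ln_le_sub1 q0; rewrite ln_div ?posrE //; last by lra.
  have -> : n%:R / (n%:R - 2) - 1 = 2 / (n%:R - 2) :> R by field; rewrite gt_eqF.
  lra.
move: (ln (n%:R - 2)) (ln n%:R) h L25 => M L h L25; move: (n%:R : R) nR h => z z20 h.
have [z0 z1 z2] : [/\ 0 < z, 0 < z - 1 & 0 < z - 2] by split; lra.
apply/andP; split; first by rewrite mulr_ge0 ?invr_ge0 ?mulr_ge0 //; lra.
apply: (@le_trans _ _ ((L - 2 / (z - 2) + 1) / (z - 2) / 2 - (L + 1) / z / 2)); last first.
  by rewrite lerD2r ler_pM2r // ler_pM2r ?invr_gt0 //; lra.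
rewrite -subr_ge0.
have -> : (L - 2 / (z - 2) + 1) / (z - 2) / 2 - (L + 1) / z / 2 - (z * (z - 1))^-1 * L
  = (L * (z - 2) - 2 * (z - 1)) / (z * (z - 1) * (z - 2) ^+ 2).
  by field; rewrite !gt_eqF.
by rewrite divr_ge0 ?mulr_ge0 ?sqr_ge0 //; nra.
Qed.

Lemma cp_tail_step n : (20 <= n)%N -> 0 <= cp R n <= cp_tail n - cp_tail n.+2.
Proof.
move=> n20; have nR : 20 <= n%:R :> R by rewrite ler_nat.
rewrite /cp /cp_tail /up.
have -> : n.+2%:R - 2 = n%:R :> R by rewrite -addn2 natrD addrK.
move: (n%:R : R) nR => z z20.
have [z0 z1 z2] : [/\ 0 < z, 0 < z - 1 & 0 < z - 2] by split; lra.
have hs : Num.sqrt z ^+ 2 = z by rewrite sqr_sqrtr // ltW.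
have hw : Num.sqrt (z - 2) ^+ 2 = z - 2 by rewrite sqr_sqrtr // ltW.
have s0 : 0 < Num.sqrt z by rewrite sqrtr_gt0.
have w0 : 0 < Num.sqrt (z - 2) by rewrite sqrtr_gt0.
move: (Num.sqrt z) (Num.sqrt (z - 2)) hs hw s0 w0 => s w hs hw s0 w0.
apply/andP; split; first by rewrite addr_ge0 // invr_ge0 mulr_ge0 // ltW.
have e1 : (z * (z - 1))^-1 <= (z - 2)^-1 / 2 - z^-1 / 2.
  rewrite -subr_ge0.
  have -> : (z - 2)^-1 / 2 - z^-1 / 2 - (z * (z - 1))^-1 = (z * (z - 1) * (z - 2))^-1.
    by field; rewrite !gt_eqF.
  by rewrite invr_ge0 !mulr_ge0 // ltW.
have e2 : (s * (z - 1))^-1 <= w^-1 - s^-1.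
  have -> : w^-1 - s^-1 = 2 / (s * (w * (s + w))).
    have -> : 2 = (s - w) * (s + w) by ring: hs hw.
    by field; rewrite !gt_eqF // addr_gt0.
  rewrite ler_pdivlMr ?mulr_gt0 ?addr_gt0 // -(ler_pM2l (_ : 0 < s * (z - 1))) ?mulr_gt0 //.
  rewrite mulVKf; last by rewrite gt_eqF // mulr_gt0.
  have sw : w * (s + w) <= 2 * (z - 1) by have := sqr_ge0 (s - w); nra.
  by have := ler_wpM2l (ltW s0) sw; lra.
lra.
Qed.

Definition kappa_table (K : Z) (tu : seq Z) (ps : seq nat) : Z :=
  foldr (fun p acc => (acc + (nth 0 tu p / (Z.of_nat p * (Z.of_nat p - 1)) + 1))%stdZ) 0%stdZ ps.

(** [Z.sqrt] rounds K sqrt p down and stands in a denominator, so the result is still an upper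
    bound. *)
Definition cp_table (K : Z) (p : nat) : Z :=
  let z := Z.of_nat p in
  (K / (z * (z - 1)) + 1 + (K * K / (Z.sqrt (K * K * z) * (z - 1)) + 1))%stdZ.

Definition Cprod_table (K : Z) (ps : seq nat) : Z :=
  foldr (fun p acc => (acc * (K + cp_table K p) / K + 1)%stdZ) K ps.

Local Notation zr := (@zr R).
Variable K : Z.
Hypothesis K0 : Z.ltb 0 K.

Lemma zr_pp p : prime p -> zr (Z.of_nat p * (Z.of_nat p - 1))%stdZ = p%:R * (p%:R - 1).
Proof. by move=> pp; rewrite zrM zrB zr_nat (@zr_lit _ 1 1%stdZ erefl). Qed.

Lemma pp_gt0 p : prime p -> Z.ltb 0 (Z.of_nat p * (Z.of_nat p - 1)).
Proof. by move=> /prime_gt1 p1; have : (1 < Z.of_nat p)%stdZ by [lia]; nia. Qed.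

Lemma kappa_tableP n ps : (forall p, p \in ps -> prime p && (p <= n + 1)%N) ->
  zr K * kappaS R ps <= zr (kappa_table K (lnU_tab K n) ps).
Proof.
elim: ps => [|p ps IH] h; first by rewrite /kappaS big_nil mulr0 (@zr_lit _ 0 0%stdZ erefl).
have /andP[pp pn] := h p (mem_head _ _); have p0 := prime_gt0 pp.
have {}IH := IH (fun q hq => h q (@mem_behead _ (p :: ps) q hq)).
rewrite /kappaS big_cons mulrDr addrC zrD; apply: lerD; first exact: IH.
apply: le_trans (zr_div_ge _ _ _); last exact: pp_gt0.
have := lnU_tabP R K0 p0 pn; rewrite zr_pp // /up; move: (nth _ _ _) => v hv.
by rewrite mulrCA mulrC ler_pM2r // invr_gt0 mulr_gt0 ?prime_sub1_gt0 ?ltr0n.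
Qed.

Lemma cp_tableP p : prime p -> zr K * cp R p <= zr (cp_table K p).
Proof.
move=> pp; have p0 := prime_gt0 pp; have p1 := prime_gt1 pp; have s0 := zrK_gt0 R K0.
have pR : 0 < p%:R :> R by rewrite ltr0n.
have q0 := prime_sub1_gt0 R pp.
rewrite /cp_table /cp /up mulrDr zrD; apply: lerD.
  by apply: le_trans (zr_div_ge _ _ _); [rewrite zr_pp|apply: pp_gt0].
set S := Z.sqrt _.
have S0 : Z.ltb 0 S.
  have : (0 < K * K * Z.of_nat p)%stdZ by move: K0; nia.
  by move=> /Z.sqrt_pos; rewrite /S; lia.
have hS : zr S ^+ 2 <= zr K ^+ 2 * p%:R.
  rewrite !expr2 -!zrM -zr_nat -zrM; apply: zr_le.
  have n0 : (0 <= K * K * Z.of_nat p)%stdZ by move: K0; nia.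
  by have [h _] := Z.sqrt_spec _ n0; apply/Z.leb_spec0.
apply: le_trans (zr_div_ge _ _ _); last by nia.
rewrite !zrM zrB zr_nat (@zr_lit _ 1 1%stdZ erefl).
have SR : 0 < zr S by move: S0 => /(@zrK_gt0 R).
have w0 : 0 < Num.sqrt p%:R :> R by rewrite sqrtr_gt0.
have hw : zr S <= zr K * Num.sqrt p%:R.
  by rewrite -ler_sqr ?nnegrE ?mulr_ge0 ?(ltW SR) ?(ltW s0) ?(ltW w0) // exprMn sqr_sqrtr // ltW.
rewrite !invfM mulrA [leRHS]mulrA ler_pM2r ?invr_gt0 // ler_pdivrMr // mulrAC ler_pdivlMr //.
by rewrite -mulrA ler_pM2l.
Qed.

Lemma Cprod_tableP ps : (forall p, p \in ps -> prime p) -> zr K * Cprod R ps <= zr (Cprod_table K ps).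
Proof.
have s0 := zrK_gt0 R K0.
elim: ps => [|p ps IH] h; first by rewrite /Cprod big_nil mulr1.
have pp := h p (mem_head _ _); have {}IH := IH (fun q hq => h q (@mem_behead _ (p :: ps) q hq)).
rewrite /Cprod big_cons -/(Cprod R ps) /=.
apply: le_trans (zr_div_ge _ _ _) => //; rewrite zrM zrD ler_pdivlMr //.
have hc := cp_tableP pp.
have c0 : 0 <= cp R p.
  by rewrite /cp addr_ge0 // ?(ltW (up_gt0 R pp)) // invr_ge0 mulr_ge0 ?sqrtr_ge0 // ltW // prime_sub1_gt0.
have P0 : 0 <= Cprod R ps.
  rewrite /Cprod big_seq; apply: prodr_ge0 => q qs; have qp := h q (@mem_behead _ (p :: ps) q qs).
  by rewrite addr_ge0 // addr_ge0 // ?(ltW (up_gt0 R qp)) // invr_ge0 mulr_ge0 ?sqrtr_ge0 // ltW // prime_sub1_gt0.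
have -> : zr K * ((1 + cp R p) * Cprod R ps) * zr K = (zr K * Cprod R ps) * (zr K + zr K * cp R p) by ring.
apply: ler_pM => //; first by rewrite mulr_ge0 // ltW.
  by rewrite addr_ge0 ?mulr_ge0 // ltW.
by rewrite lerD2l.
Qed.

Lemma table_bound (x : R) (t c d : Z) : zr K * x <= zr t -> Z.ltb 0 c ->
  Z.leb (c * t) (d * K) -> x <= zr d / zr c.
Proof.
move=> h c0 /(@zr_le R); rewrite !zrM => ht; have s0 := zrK_gt0 R K0.
have z0 : 0 < zr c := zrK_gt0 R c0.
rewrite ler_pdivlMr // -(ler_pM2l s0) mulrA [leRHS]mulrC; apply: le_trans ht.
by rewrite mulrC ler_pM2l.
Qed.

End PrimeTails.

Lemma kappa_check : Z.leb (10000 * kappa_table scale (lnU_tab scale 600) (odd_primes_upto 5 596)) (2248 * scale).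
Proof. by vm_compute. Qed.

Lemma Cprod_check : Z.leb (1000 * Cprod_table scale (odd_primes_upto 5 596)) (1526 * scale).
Proof. by vm_compute. Qed.

(** * Bounds for c_E and for the products over primes *)

Section Constants.
Variable R : realType.
Implicit Types (k m n p N : nat).

Lemma odd_primes_upto_cat k m n : odd_primes_upto k (m + n) = odd_primes_upto k m ++ odd_primes_upto (k + m) n.
Proof. by rewrite /odd_primes_upto iotaD filter_cat. Qed.

Lemma cp_ge0 p : prime p -> 0 <= cp R p.
Proof.
move=> pp; rewrite addr_ge0 // ?(ltW (up_gt0 R pp)) // invr_ge0 mulr_ge0 ?sqrtr_ge0 //.
exact: ltW (prime_sub1_gt0 R pp).
Qed.

Lemma kappa_term_ge0 p : prime p -> 0 <= kappa_term R p.
Proof.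
by move=> pp; rewrite mulr_ge0 ?(ltW (up_gt0 R pp)) // ln_ge0 // ler1n prime_gt0.
Qed.

Definition kappa5 N : R := kappaS R (odd_primes_upto 5 N).

Lemma kappa5_mono m n : (m <= n)%N -> kappa5 m <= kappa5 n.
Proof.
move=> /subnKC <-; rewrite /kappa5 odd_primes_upto_cat /kappaS big_cat lerDl big_seq.
by apply: sumr_ge0 => p /odd_primes_uptoP /andP[pp _]; apply: kappa_term_ge0.
Qed.

Lemma ln599_le : ln (599 : R) <= 641 / 100.
Proof.
have /andP[_ l2] := ln2_bounds R.
have h : 0 < 599 / 512 :> R by lra.
have E : ln 599 = ln 8 + ln 8 + ln 8 + ln (599 / 512) :> R.
  have p8 : 8 \is @Num.pos R by rewrite posrE; lra.
  have p82 : 8 * 8 \is @Num.pos R by rewrite posrE; lra.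
  have p83 : 8 * 8 * 8 \is @Num.pos R by rewrite posrE; lra.
  by rewrite -(lnM p8 p8) -(lnM p82 p8) -lnM ?(p83) ?posrE ?h //; congr ln; lra.
by rewrite E ln8E; have := ln_le_sub1 h; move: (ln (599 / 512)) => l; lra.
Qed.

(** Primes up to 600 contribute at most .2248 by the table, the later ones at most .0062 by the tail
    at 601. *)
Lemma kappa5_le N : kappa5 N <= 2310 / 10000.
Proof.
apply: le_trans (kappa5_mono (leq_addl 596 N)) _.
rewrite /kappa5 (odd_primes_upto_cat 5 596 N : _ = _ ++ odd_primes_upto 601 N) /kappaS big_cat /=.
have tl : \sum_(p <- odd_primes_upto 601 N) kappa_term R p <= kappa_tail R 601.
  apply: (@odd_primes_tail_le R (kappa_term R) (kappa_tail R) 20 601 N) => // n n20; last exact: kappa_tail_step.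
  have nR : 20 <= n%:R :> R by rewrite ler_nat.
  have l0 : 0 <= ln (n%:R - 2) :> R by apply: ln_ge0; lra.
  rewrite /kappa_tail !mulr_ge0 ?invr_ge0 //; lra.
have tl' : kappa_tail R 601 <= 62 / 10000.
  rewrite /kappa_tail (_ : 601%:R - 2 = 599 :> R); last by ring.
  by have := ln599_le; move: (ln _) => l; lra.
have ps p : p \in odd_primes_upto 5 596 -> prime p && (p <= 600 + 1)%N.
  rewrite mem_filter mem_iota => /andP[/andP[-> _] /andP[_ h]].
  exact: leq_trans (ltnW h) (isT : 5 + 596 <= 600 + 1)%N.
have := table_bound (isT : Z.ltb 0 scale) (@kappa_tableP R scale isT 600 _ ps) (isT : Z.ltb 0 10000) kappa_check.
rewrite (@zr_lit _ 2248 2248%stdZ erefl).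
have -> : zr R 10000%stdZ = 10000.
  by rewrite (_ : 10000%stdZ = (100 * 100)%stdZ) // zrM (@zr_lit _ 100 100%stdZ erefl); ring.
by rewrite -/(kappaS R _); move: (kappaS R _) (kappa_tail R _) tl tl' => k t tl tl' hk; rewrite /kappa_term in tl; lra.
Qed.

Lemma Cprod5_le N : Cprod R (odd_primes_upto 5 N) <= 166 / 100.
Proof.
have ge1 k n : 1 <= Cprod R (odd_primes_upto k n).
  rewrite /Cprod big_seq; elim/big_ind: _ => // [x y x1 y1|p /odd_primes_uptoP /andP[pp _]].
    by rewrite -[1]mulr1; apply: ler_pM.
  by rewrite lerDl cp_ge0.
have catE k m n : Cprod R (odd_primes_upto k (m + n)) = Cprod R (odd_primes_upto k m) * Cprod R (odd_primes_upto (k + m) n).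
  by rewrite odd_primes_upto_cat /Cprod big_cat.
have pos k n : 0 < Cprod R (odd_primes_upto k n) by apply: lt_le_trans (ge1 k n).
have : Cprod R (odd_primes_upto 5 N) <= Cprod R (odd_primes_upto 5 (N + 596)).
  by rewrite catE ler_peMr // ltW.
move=> /le_trans; apply; rewrite addnC.
rewrite (catE 5%N 596%N N : _ = _ * Cprod R (odd_primes_upto 601 N)).
have cge p : p \in odd_primes_upto 601 N -> 0 <= cp R p.
  by move=> /odd_primes_uptoP /andP[pp _]; apply: cp_ge0.
have tl : \sum_(p <- odd_primes_upto 601 N) cp R p <= cp_tail R 601.
  apply: (@odd_primes_tail_le R (cp R) (cp_tail R) 20 601 N) => // n n20; last exact: cp_tail_step.
  have nR : 20 <= n%:R :> R by rewrite ler_nat.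
  by rewrite /cp_tail addr_ge0 ?mulr_ge0 ?invr_ge0 ?sqrtr_ge0 //; lra.
have tl' : cp_tail R 601 <= 426 / 10000.
  rewrite /cp_tail (_ : 601%:R - 2 = 599 :> R); last by ring.
  have : 24 <= Num.sqrt 599 :> R.
    have := @ler_wsqrtr R (24 ^+ 2) 599; rewrite sqrtr_sqr ger0_norm //; apply; lra.
  move=> h; have : (Num.sqrt 599)^-1 <= 24^-1 :> R by rewrite lef_pV2 ?posrE; lra.
  by move: (Num.sqrt 599)^-1 => v; lra.
have ps p : p \in odd_primes_upto 5 596 -> prime p by move=> /odd_primes_uptoP /andP[].
have := table_bound (isT : Z.ltb 0 scale) (@Cprod_tableP R scale isT _ ps) (isT : Z.ltb 0 1000) Cprod_check.
rewrite (@zr_lit _ 1526 1526%stdZ erefl) (@zr_lit _ 1000 1000%stdZ erefl).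
have tl2 := le_trans tl tl'.
have lt1 : \sum_(p <- odd_primes_upto 601 N) cp R p < 1 by apply: le_lt_trans tl2 _; lra.
have := prod_1D_le cge lt1; rewrite -/(Cprod R _).
have := pos 5 596%N; have := pos 601%N N; move: tl2 {lt1 tl tl' cge}.
move: (\sum_(_ <- _) _) (Cprod R _) (Cprod R _) => t k P ht P0 k0 hP hk.
have t1 : 0 < 1 - t by lra.
have hP' : P * (1 - t) <= 1 by rewrite -ler_pdivlMr // div1r.
nra.
Qed.

Lemma upto3_cons N : odd_primes_upto 3 N.+2 = 3%N :: odd_primes_upto 5 N.
Proof. by []. Qed.

(** The sum of ln p / (p (p - 1)) over the primes p >= 5: from c_E the constant gamma and the terms
    of p = 2 and p = 3 are taken off. *)
Definition kappa_inf : R := c_E R - euler_gamma R - ln 2 / 2 - ln 3 / 6.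

Let ksum (n : nat) : R := \sum_(0 <= p < n | prime p) ln p%:R / (p%:R * (p%:R - 1)).

Lemma ksum_kappa5 n : ksum (5 + n) = ln 2 / 2 + ln 3 / 6 + kappa5 n.
Proof.
rewrite /ksum (@big_cat_nat _ _ _ 5) ?leq_addr //= /kappa5 /kappaS; congr (_ + _).
  rewrite /index_iota /= !big_cons big_nil /= addr0.
  by congr (ln _ * _ + ln _ * _); field.
rewrite /odd_primes_upto big_filter [RHS]big_seq_cond [LHS]big_seq_cond /index_iota addKn.
apply: eq_big => [p|p _]; last by rewrite mulrC.
rewrite mem_iota; case: (boolP (_ <= p < _)%N) => //= /andP[p5 _]; case: (boolP (prime p)) => //= pp.
by case/even_prime: pp p5 => [->|->].
Qed.

Lemma ksum_nd : nondecreasing_seq ksum.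
Proof.
move=> m n mn; rewrite /ksum [leRHS](@big_cat_nat _ _ _ m) //= lerDl; apply: sumr_ge0 => p pp.
by have := kappa_term_ge0 pp; rewrite /kappa_term /up mulrC.
Qed.

Lemma ksum_cvg : cvgn ksum.
Proof.
apply: nondecreasing_is_cvgn; first exact: ksum_nd.
exists (ln 2 / 2 + ln 3 / 6 + 2310 / 10000) => _ [n _ <-] /=.
by apply: le_trans (ksum_nd (leq_addl 5 n)) _; rewrite ksum_kappa5 lerD2l kappa5_le.
Qed.

Lemma kappa_infE : kappa_inf = limn ksum - ln 2 / 2 - ln 3 / 6.
Proof. by rewrite /kappa_inf /c_E; congr (_ - _ - _); rewrite addrAC subrr add0r. Qed.

Lemma kappa5_le_inf N : kappa5 N <= kappa_inf.
Proof.
rewrite kappa_infE; have := nondecreasing_cvgn_le ksum_nd ksum_cvg (5 + N).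
by rewrite ksum_kappa5; move: (limn _) => l; lra.
Qed.

Lemma kappa_inf_le x M : (forall N, (M <= N)%N -> kappa5 N <= x) -> kappa_inf <= x.
Proof.
move=> h; rewrite kappa_infE.
suff : limn ksum <= x + ln 2 / 2 + ln 3 / 6 by move: (limn _) => l; lra.
apply: limr_le; first exact: ksum_cvg.
near=> n; have nM : (5 + M <= n)%N by near: n; apply: nbhs_infty_ge.
have := h (n - 5)%N; have n5 : (5 <= n)%N by lia.
by rewrite -(subnKC n5) ksum_kappa5 => /(_ ltac:(lia)); rewrite addKn; lra.
Unshelve. all: by end_near.
Qed.

Lemma c_E_le : c_E R <= 134 / 100.
Proof.
have h : kappa_inf <= 2310 / 10000 by apply: (@kappa_inf_le _ 0) => N _; apply: kappa5_le.
have /andP[l1 l2] := ln2_bounds R; have /andP[m1 m2] := ln3_bounds R.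
by have /andP[g1 g2] := gamma2_bounds R; move: h; rewrite /kappa_inf /gamma2 in g1 g2 *; lra.
Qed.

Lemma c_E_ge : 12 / 10 <= c_E R.
Proof.
have h := kappa5_le_inf 3; have /andP[l1 l2] := ln2_bounds R; have /andP[m1 m2] := ln3_bounds R.
have /andP[g1 g2] := gamma2_bounds R; move: h g1 g2.
have -> : kappa5 3 = ln 5 / 20 + ln 7 / 42.
  rewrite /kappa5 /kappaS (_ : odd_primes_upto 5 3 = [:: 5%N; 7%N]) // !big_cons big_nil addr0 /up.
  by congr (_ + _); rewrite mulrC; congr (_ * _^-1); ring.
have h5 : ln 4 <= ln 5 :> R by rewrite ler_ln ?posrE //; lra.
have h7 : ln 4 <= ln 7 :> R by rewrite ler_ln ?posrE //; lra.
rewrite ln4E in h5 h7; rewrite /kappa_inf /gamma2.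
by move: (ln 5) (ln 7) (ln 2) (ln 3) h5 h7 l1 l2 m1 m2 => *; lra.
Qed.

End Constants.

(** * X_d for the divisors d of 6, with explicit error *)

Section Asymptotics.
Variable R : realType.
Implicit Types (x : R) (N M : nat).

(** For a fixed x any list of primes reaching x represents the same sum, so the estimate holds with
    arbitrarily long lists and [kappa5 N] can be moved to its limit. *)
Lemma asymp_of_kappa5 (A e : R) M : (forall N, (M <= N)%N -> `|A - kappa5 R N| <= e) -> `|A - kappa_inf R| <= e.
Proof.
move=> h; rewrite ler_norml; apply/andP; split.
  suff : kappa_inf R <= A + e by lra.
  apply: (@kappa_inf_le _ _ M) => N /h; rewrite ler_norml => /andP[h1 h2]; lra.
have := h M (leqnn _); have := kappa5_le_inf R M; rewrite ler_norml => hk /andP[h1 h2]; lra.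
Qed.

Lemma sqrt2_bound : Num.sqrt 2 <= 99 / 70 :> R.
Proof.
have h := @ler_wsqrtr R 2 ((99 / 70) ^+ 2); rewrite sqrtr_sqr ger0_norm in h; last by lra.
by apply: h; lra.
Qed.

Lemma sqrt3_bounds : 71 / 41 <= Num.sqrt (3 : R) <= 97 / 56.
Proof.
have h1 := @ler_wsqrtr R ((71 / 41) ^+ 2) 3; have h2 := @ler_wsqrtr R 3 ((97 / 56) ^+ 2).
rewrite !sqrtr_sqr !ger0_norm in h1 h2; [|lra|lra].
by apply/andP; split; [apply: h1|apply: h2]; lra.
Qed.

Lemma inv_sqrt_div x (c : R) : 0 < x -> 0 < c -> (Num.sqrt (x / c))^-1 = Num.sqrt c / Num.sqrt x.
Proof.
move=> x0 c0; rewrite sqrtrM ?ltW // sqrtrV ?ltW // invfM invrK mulrC //.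
Qed.

(** X_6(x) = 3 W(x) - W(x / 3), where W is the weighted sum without the prime 3. The errors add up
    to 1.71 (3 + sqrt 3), just below 8.1. *)
Lemma Xs6_asymp x : 0 < x ->
  `|Xs R (base23 true true) (Num.truncn x) - (ln x + c_E R + ln 2 / 2 + ln 3 / 3)| <= 81 / 10 / Num.sqrt x.
Proof.
move=> x0; pose X := Xs R (base23 true true) (Num.truncn x).
have -> : X - (ln x + c_E R + ln 2 / 2 + ln 3 / 3) = X - (ln x + gamma2 R + ln 3 / 2) - kappa_inf R.
  by rewrite /kappa_inf /gamma2; lra.
apply: (@asymp_of_kappa5 _ _ (Num.truncn x)) => N xN.
have hS := @odd_primes_uptoP 5 N; have uS := uniq_odd_primes_upto 5 N.
have x3 : 0 < x / 3 by rewrite divr_gt0.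
have d1 := wdefect_le hS uS x0; have d3 := wdefect_le hS uS x3.
rewrite /X Xs_23 (Gn6_wsum _ xN).
move: d1 d3; rewrite /wdefect -/(kappa5 R N) (@truncn_divn _ _ 3) ?(ltW x0) // ln_div ?posrE //.
rewrite inv_sqrt_div // => d1 d3.
have /andP[_ s3] := sqrt3_bounds; have C := Cprod5_le R N.
have sx : 0 < (Num.sqrt x)^-1 by rewrite invr_gt0 sqrtr_gt0.
have C0 : 0 <= Cprod R (odd_primes_upto 5 N).
  rewrite /Cprod big_seq; apply: prodr_ge0 => p /hS /andP[pp _].
  by rewrite addr_ge0 // cp_ge0.
have e1 : 103 / 100 * Cprod R (odd_primes_upto 5 N) <= 171 / 100 by lra.
have d1' := le_trans d1 (ler_wpM2r (ltW sx) e1).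
have e3 : 103 / 100 * Cprod R (odd_primes_upto 5 N) * Num.sqrt 3 <= 171 / 100 * (97 / 56).
  by apply: ler_pM => //; lra.
rewrite mulrA in d3; have d3' := le_trans d3 (ler_wpM2r (ltW sx) e3).
move: (Num.sqrt x)^-1 sx d1' d3' => v v0 {d1 d3 e1 e3 C C0 s3 hS uS X}.
move: (wsum R _ _) (wsum R _ _) (kappa5 R N) (gamma2 R) (ln x) (ln 3) => a b k g l l3.
by rewrite !ler_norml => /andP[a1 a2] /andP[b1 b2]; apply/andP; split; lra.
Qed.

Lemma Xs2_asymp x : 0 < x ->
  `|Xs R (base23 true false) (Num.truncn x) - (ln x + c_E R + ln 2 / 2)| <= 498 / 100 / Num.sqrt x.
Proof.
move=> x0; pose X := Xs R (base23 true false) (Num.truncn x).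
have -> : X - (ln x + c_E R + ln 2 / 2) = X - (ln x + gamma2 R + ln 3 / 6) - kappa_inf R.
  by rewrite /kappa_inf /gamma2; lra.
apply: (@asymp_of_kappa5 _ _ (Num.truncn x)) => N xN.
have hS := @odd_primes_uptoP 3 N.+2; have uS := uniq_odd_primes_upto 3 N.+2.
have hS5 := @odd_primes_uptoP 5 N.
have d1 := wdefect_le hS uS x0.
have -> : X = 2 * Gn R 2 (Num.truncn x).
  rewrite /X -(@Gn_Xs R 2) //; congr (_ * _).
  by rewrite (_ : totient 2 = 1%N) //; field.
rewrite (@Gn2_wsum _ N.+2) ?(leq_trans xN) //; last by rewrite -addn2 leq_addr.
have kE : kappaS R (odd_primes_upto 3 N.+2) = ln 3 / 6 + kappa5 R N.
  rewrite upto3_cons /kappaS big_cons; congr (_ + _); rewrite /up mulrC; congr (_ * _^-1); ring.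
(* 1.456 bounds 1 + cp(3) = 1 + 1/6 + 1 / (2 sqrt 3). Then 1.03 * 1.456 * 1.66 is below 2.49, half
   of the stated 4.98. *)
have cE : Cprod R (odd_primes_upto 3 N.+2) <= 1456 / 1000 * (166 / 100).
  rewrite upto3_cons /Cprod big_cons; apply: ler_pM; rewrite ?Cprod5_le //.
  - by rewrite addr_ge0 // cp_ge0.
  - rewrite big_seq; apply: prodr_ge0 => p /hS5 /andP[pp _].
    by rewrite addr_ge0 // cp_ge0.
  have /andP[s3 _] := sqrt3_bounds.
  rewrite /cp /up (_ : 3%:R - 1 = 2 :> R); last by ring.
  have h : (Num.sqrt 3 * 2)^-1 <= (142 / 41)^-1 :> R by rewrite lef_pV2 ?posrE; lra.
  by move: (Num.sqrt 3 * 2)^-1 h => v h; lra.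
move: d1; rewrite /wdefect kE => d1.
have sx : 0 < (Num.sqrt x)^-1 by rewrite invr_gt0 sqrtr_gt0.
have e1 : 103 / 100 * Cprod R (odd_primes_upto 3 N.+2) <= 249 / 100 by lra.
have := le_trans d1 (ler_wpM2r (ltW sx) e1).
move: (Num.sqrt x)^-1 sx => v v0 {d1 e1 cE kE hS uS X}.
move: (wsum R _ _) (kappa5 R N) (gamma2 R) (ln x) (ln 3) => a k g l l3.
by rewrite !ler_norml => /andP[a1 a2]; apply/andP; split; lra.
Qed.

(** Removing the prime 2 averages the values at x and x / 2, so the error is multiplied by (1 + sqrt
    2) / 2 <= 169 / 140. This takes 8.1 to 9.8 and 4.98 to 6.02, the values of [err3]. *)
Lemma halve_asymp (A A2 X M M2 l2 v w e : R) : 0 <= e -> w <= 99 / 70 * v -> 2 * X = A + A2 ->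
  M2 = M - l2 -> `|A - M| <= e * v -> `|A2 - M2| <= e * w -> `|X - (M - l2 / 2)| <= e * (169 / 140) * v.
Proof.
move=> e0 wv hX ->; have := ler_wpM2l e0 wv; rewrite !ler_norml => h /andP[a1 a2] /andP[b1 b2].
by apply/andP; split; lra.
Qed.

Definition h23 (b2 b3 : bool) : R := b2%:R * (ln 2 / 2) + b3%:R * (ln 3 / 3).
Definition err3 (b3 : bool) : R := if b3 then 98 / 10 else 602 / 100.

Lemma Xs23_asymp b2 b3 x : 0 < x ->
  `|Xs R (base23 b2 b3) (Num.truncn x) - (ln x + c_E R + h23 b2 b3)| <= err3 b3 / Num.sqrt x.
Proof.
move=> x0; have x2 : 0 < x / 2 by rewrite divr_gt0.
have sx : 0 < (Num.sqrt x)^-1 by rewrite invr_gt0 sqrtr_gt0.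
have t2 : Num.truncn (x / 2) = (Num.truncn x %/ 2)%N by apply: (@truncn_divn R x 2) => //; apply: ltW.
have l2 : ln (x / 2) = ln x - ln 2 by rewrite ln_div ?posrE.
have s2 : (Num.sqrt (x / 2))^-1 <= 99 / 70 * (Num.sqrt x)^-1.
  by rewrite inv_sqrt_div // ler_pM2r // sqrt2_bound.
have a6 := Xs6_asymp x0; have b6 := Xs6_asymp x2; have a2 := Xs2_asymp x0; have b2' := Xs2_asymp x2.
have E3 := Xs_3 R (Num.truncn x); have E1 := Xs_1_2 R (Num.truncn x).
rewrite -!Xs_23 in E3.
rewrite t2 l2 in b6 b2'; rewrite /h23 /err3; case: b2; case: b3; rewrite /= ?mul1r ?mul0r ?addr0 ?add0r.
- rewrite addrA; apply: le_trans a6 _; rewrite ler_pM2r //; lra.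
- by apply: le_trans a2 _; rewrite ler_pM2r //; lra.
- have -> : ln x + c_E R + ln 3 / 3 = ln x + c_E R + ln 2 / 2 + ln 3 / 3 - ln 2 / 2 by move: (c_E R) => c; lra.
  apply: le_trans (halve_asymp _ s2 E3 _ a6 b6) _; last by rewrite ler_pM2r //; lra.
    by lra.
  by move: (c_E R) => c; lra.
have -> : ln x + c_E R = ln x + c_E R + ln 2 / 2 - ln 2 / 2 by move: (c_E R) => c; lra.
apply: le_trans (halve_asymp _ s2 E1 _ a2 b2') _; last by rewrite ler_pM2r //; lra.
  by lra.
by move: (c_E R) => c; lra.
Qed.

End Asymptotics.

(** * Adding the primes from 11 on *)

Section PrimeReduction.
Variable R : realType.
Implicit Types (S T L : seq nat) (p q d N : nat) (x : R).

Lemma Xs_nil_le S N : uniq S -> (forall p, p \in S -> prime p) -> Xs R [::] N <= Xs R S N.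
Proof.
elim: S => // p S IH /= /andP[pS uS] hS.
have hS' q : q \in S -> prime q by move=> h; apply: hS; rewrite inE h orbT.
apply: le_trans (IH uS hS') _; apply: Xs_le_cons => //; exact: hS (mem_head _ _).
Qed.

(** From 41 on the error is at most 6.02 / 6.4, less than c_E >= 1.2; below that the table
    decides. *)
Lemma ln_le_Xs_nil x : 0 < x -> ln x <= Xs R [::] (Num.truncn x).
Proof.
move=> x0; have [x1|x1] := ltP x 1; first by apply: le_trans (Xs_ge0 _ _ _) => //; rewrite ln_le0 // ltW.
have /andP[n1 n2] := Num.Theory.truncn_itv (ltW x0).
have n0 : (0 < Num.truncn x)%N by rewrite Num.Theory.truncn_gt0.
have [n40|n40] := leqP (Num.truncn x) 40.
  by apply: le_trans (ln_succ_le_Xs R n0 n40); rewrite ler_ln ?posrE // ltW.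
have := @Xs23_asymp R false false x x0; rewrite /h23 !mul0r !addr0 ler_norml => /andP[h _].
have x41 : 41 <= x by apply: le_trans n1; rewrite (ler_nat R 41).
have s6 : 64 / 10 <= Num.sqrt x.
  have := @ler_wsqrtr R ((64 / 10) ^+ 2) x; rewrite sqrtr_sqr ger0_norm; last by lra.
  by apply; lra.
have v1 : (Num.sqrt x)^-1 <= (64 / 10)^-1 by rewrite lef_pV2 ?posrE //; lra.
have := c_E_ge R; move: h v1; rewrite /err3; move: (c_E R) (Num.sqrt x)^-1 => c v; lra.
Qed.

Definition large_primes d := [seq p <- primes d | (11 <= p)%N].

Lemma primes_split d : (0 < d)%N ->
  perm_eq (primes d) (large_primes d ++ (base57 (5 %| d)%N (7 %| d)%N ++ base23 (2 %| d)%N (3 %| d)%N)).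
Proof.
move=> d0; apply: uniq_perm; first exact: primes_uniq.
  rewrite cat_uniq filter_uniq ?primes_uniq //=.
  have -> : uniq (base57 (5 %| d)%N (7 %| d)%N ++ base23 (2 %| d)%N (3 %| d)%N).
    by case: (5 %| d)%N; case: (7 %| d)%N; case: (2 %| d)%N; case: (3 %| d)%N.
  rewrite andbT; apply/hasPn => p; rewrite !mem_cat /base57 /base23 mem_filter negb_and -ltnNge.
  set b := (X in X -> _); suff : b -> (p < 11)%N by move=> h /h ->.
  by rewrite /b; case: (5 %| d)%N; case: (7 %| d)%N; case: (2 %| d)%N; case: (3 %| d)%N;
    rewrite /= ?inE //; lia.
move=> p; rewrite !mem_cat mem_filter; case: (boolP (11 <= p)%N) => p11 /=.
  set c := (X in _ = _ || X); suff -> : c = false by rewrite orbF.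
  by rewrite /c; case: (5 %| d)%N; case: (7 %| d)%N; case: (2 %| d)%N; case: (3 %| d)%N;
    rewrite /= ?inE //; lia.
rewrite mem_primes d0 /=; move: p11; rewrite -ltnNge.
case: p => [|[|[|[|[|[|[|[|[|[|[|p]]]]]]]]]]] //= _;
  by rewrite /base57 /base23; case: (5 %| d)%N; case: (7 %| d)%N; case: (2 %| d)%N; case: (3 %| d)%N.
Qed.

(* The primes of [L] are at least 11 and below [p], so there are at most [p - 11] of them and they
   contribute at most [.26 (p - 11) ln p]: this is where the slope .26 = 2.6 / 10 comes from. *)
Lemma slope_algebra (x0 x1 x2 A sg l z : R) : x1 <= A + 26 / 100 * sg -> x0 <= x2 -> sg <= (z - 11) * l ->
  0 < z - 1 -> A - x0 <= 26 / 10 * l -> x1 + (x1 - x2) / (z - 1) <= A + 26 / 100 * (sg + l).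
Proof.
move=> IH lo sg_le z1 hx.
have num : x1 - x2 <= 26 / 100 * l * (z - 1) by lra.
have : (x1 - x2) / (z - 1) <= 26 / 100 * l by rewrite ler_pdivrMr.
lra.
Qed.

(** The induction appends the largest prime last, so that all primes already present lie in [11, p).
    The subtracted value at N / p is bounded below by that of the empty list, which makes the
    hypothesis on A independent of L. *)
Lemma Xs_large_le T L N (A : R) : uniq T -> (forall p, p \in T -> prime p && (p < 11)%N) ->
  sorted ltn L -> (forall p, p \in L -> prime p && (11 <= p)%N) ->
  Xs R T N <= A -> (forall p, prime p -> (11 <= p)%N -> A - Xs R [::] (N %/ p)%N <= 26 / 10 * ln p%:R) ->
  Xs R (L ++ T) N <= A + 26 / 100 * \sum_(q <- L) ln q%:R.
Proof.
move=> uT hT; elim/last_ind: L => [|L p IH] sL hL hA hp; first by rewrite big_nil mulr0 addr0.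
have /andP[pp p11] : prime p && (11 <= p)%N by apply: hL; rewrite mem_rcons mem_head.
have hL' q : q \in L -> prime q && (11 <= q)%N by move=> h; apply: hL; rewrite mem_rcons inE h orbT.
have sL' : sorted ltn L by move: sL; rewrite -cats1 => /(subseq_sorted ltn_trans (prefix_subseq L [:: p])).
have Lp q : q \in L -> (q < p)%N.
  move: sL; rewrite (sorted_pairwise ltn_trans) pairwise_rcons => /andP[/allP h _]; exact: h.
have {}IH := IH sL' hL' hA hp.
have uL : uniq L := sorted_uniq ltn_trans ltnn sL'.
have pLT : p \notin L ++ T.
  rewrite mem_cat negb_or; apply/andP; split; first by apply/negP => /Lp; rewrite ltnn.
  by apply/negP => /hT /andP[_]; rewrite ltnNge p11.
have hLT q : q \in L ++ T -> prime q by rewrite mem_cat => /orP[/hL'|/hT] /andP[].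
have uLT : uniq (L ++ T).
  rewrite cat_uniq uL uT andbT; apply/hasPn => q /hT /andP[_ q11].
  by apply/negP => /hL' /andP[_]; rewrite leqNgt q11.
have -> : Xs R (rcons L p ++ T) N = Xs R (p :: (L ++ T)) N.
  by apply: Xs_perm; rewrite -cats1 -catA perm_catCA.
apply: le_trans (Xs_cons_le R pp hLT pLT N) _.
have lo := @Xs_nil_le _ (N %/ p)%N uLT hLT; have := hp p pp p11.
rewrite -cats1 big_cat /= big_cons big_nil addr0.
have lp0 : 0 <= ln p%:R :> R by rewrite ln_ge0 // ler1n prime_gt0.
have szL : (size L <= p - 11)%N.
  rewrite -[X in (_ <= X)%N](size_iota 11); apply: uniq_leq_size => // q qL.
  by have /andP[_ q11] := hL' q qL; rewrite mem_iota q11 subnKC // Lp.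
have sum_le : \sum_(q <- L) ln q%:R <= (p%:R - 11) * ln p%:R :> R.
  apply: (@le_trans _ _ (\sum_(q <- L) ln p%:R)).
    rewrite big_seq [leRHS]big_seq; apply: ler_sum => q qL.
    have /andP[qp _] := hL' q qL.
    by rewrite ler_ln ?posrE ?ltr0n ?prime_gt0 // ler_nat ltnW // Lp.
  rewrite big_const_seq count_predT iter_addr_0 -[leLHS]mulr_natl; apply: ler_wpM2r => //.
  by rewrite -(natrB _ p11) ler_nat.
have p1 : 0 < p%:R - 1 :> R by apply: prime_sub1_gt0.
exact: slope_algebra IH lo sum_le p1.
Qed.

(** X(x / p) is at least 0 and at least ln x - ln p. The first serves the branch 0 of the maximum in
    [ln11_bound]; in the other branch what remains is 1.6 ln 11 + ln p. *)
Lemma slope_condition x (A : R) p : 1 <= x -> prime p -> (11 <= p)%N -> A <= ln11_bound x ->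
  A - Xs R [::] (Num.truncn x %/ p)%N <= 26 / 10 * ln p%:R.
Proof.
move=> x1 pp p11 hA; have p0 := prime_gt0 pp; have pR : 0 < p%:R :> R by rewrite ltr0n.
have x0 : 0 < x by lra.
have h := @ln_le_Xs_nil (x / p%:R) (divr_gt0 x0 pR); rewrite truncn_divn ?(ltW x0) // ln_div ?posrE // in h.
have h0 : 0 <= Xs R [::] (Num.truncn x %/ p)%N by apply: Xs_ge0.
have lp : ln 11 <= ln p%:R :> R by rewrite ler_ln ?posrE // (ler_nat R 11).
move: hA; rewrite /ln11_bound; move: (Xs R _ _) (ln x) (ln 11) (ln p%:R) h h0 lp => X lx l11 l h h0 lp.
by rewrite /Num.max; case: ifP => _; lra.
Qed.

Lemma prod_primes_gt0 S : all prime S -> (0 < \prod_(p <- S) p)%N.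
Proof.
elim: S => [|p S IH] /=; first by rewrite big_nil.
by case/andP=> /prime_gt0 p0 /IH; rewrite big_cons muln_gt0 p0.
Qed.

Lemma sum_ln_primes_le d : (0 < d)%N -> \sum_(p <- primes d) ln p%:R <= ln d%:R :> R.
Proof.
move=> d0.
have ap : all prime (primes d) by apply/allP => p; rewrite mem_primes => /and3P[].
have -> : \sum_(p <- primes d) ln p%:R = ln (\prod_(p <- primes d) p)%:R :> R.
  elim: (primes d) (ap) => [|p s IH] /=; first by rewrite !big_nil ln1.
  case/andP=> pp hs; by rewrite !big_cons natrM lnM ?posrE ?ltr0n ?(prime_gt0 pp) ?prod_primes_gt0 // (IH hs).
have P0 := prod_primes_gt0 ap.
rewrite ler_ln ?posrE ?ltr0n // ler_nat.
rewrite [leqRHS](prod_prime_decomp d0) prime_decompE big_map /= big_seq [leqRHS]big_seq.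
apply: leq_prod => p pd; rewrite -{1}[p]expn1 leq_pexp2l ?logn_gt0 //.
by move: pd; rewrite mem_primes => /and3P[/prime_gt0].
Qed.

End PrimeReduction.

(** * The upper bound for X_d, d > 1 *)

Section TargetBound.
Variable R : realType.
Implicit Types (x v l : R).

Lemma ln5_bounds : 1609 / 1000 <= ln (5 : R) <= 161 / 100.
Proof.
have /andP[l1 l2] := ln2_bounds R.
have a4 : 1 / 9 * (2 * 4%:R + 1) = 1 :> R by field.
have b4 : 1 / 120 * (6 * 4%:R * (4%:R + 1)) = 1 :> R by field.
have /andP[h1 h2] := ln_succ_num (isT : 0 < 4)%N a4 b4; rewrite ln4E in h1 h2.
by apply/andP; split; lra.
Qed.

Lemma ln7_bounds : 1945 / 1000 <= ln (7 : R) <= 1947 / 1000.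
Proof.
have /andP[l1 l2] := ln2_bounds R.
have a7 : 1 / 15 * (2 * 7%:R + 1) = 1 :> R by field.
have b7 : 1 / 336 * (6 * 7%:R * (7%:R + 1)) = 1 :> R by field.
have /andP[h1 h2] := ln_succ_num (isT : 0 < 7)%N a7 b7; rewrite ln8E in h1 h2.
by apply/andP; split; lra.
Qed.

Lemma ln10E : ln (10 : R) = ln 2 + ln 5.
Proof. by rewrite -lnM ?posrE //; congr ln; ring. Qed.

Lemma ln11_ge : 239 / 100 <= ln (11 : R).
Proof.
have /andP[l1 l2] := ln2_bounds R; have /andP[l3 l4] := ln5_bounds.
have a : 1 / 21 * (2 * 10%:R + 1) = 1 :> R by field.
have b : 1 / 660 * (6 * 10%:R * (10%:R + 1)) = 1 :> R by field.
have /andP[h1 h2] := ln_succ_num (isT : 0 < 10)%N a b; rewrite ln10E in h1 h2.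
lra.
Qed.

Definition ln_base (b2 b3 b5 b7 : bool) : R :=
  b2%:R * ln 2 + b3%:R * ln 3 + b5%:R * ln 5 + b7%:R * ln 7.

Definition gain_main (b5 b7 : bool) : R :=
  match b5, b7 with
  | false, false => 0
  | true, false => ln 5 / 4
  | false, true => ln 7 / 6
  | true, true => (4 * ln 7 + 7 * ln 5) / 24
  end.

Definition gain_err (b5 b7 : bool) : R :=
  match b5, b7 with
  | false, false => 0
  | true, false => 13 / 16
  | false, true => 11 / 18
  | true, true => 449 / 288
  end.

Lemma err3_bounds b3 : 0 <= err3 R b3 <= 98 / 10.
Proof. by rewrite /err3; case: b3; lra. Qed.

Lemma gain_err_bounds b5 b7 : 0 <= gain_err b5 b7 <= 156 / 100.
Proof. by rewrite /gain_err; case: b5; case: b7; lra. Qed.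

(** The number r is a rational upper bound for sqrt p: the error at x / p is sqrt p times that at x.
    With 9/4 for 5 and 8/3 for 7 the factors 1 + r yield the constants of [gain_err]. *)
Lemma drop_at_le b2 b3 (p : nat) (r : R) x : 0 < x -> (0 < p)%N -> 0 <= r -> p%:R <= r ^+ 2 ->
  drop_at R (base23 b2 b3) p (Num.truncn x) <= ln p%:R + (1 + r) * (err3 R b3 / Num.sqrt x).
Proof.
move=> x0 p0 r0 pr; have pR : 0 < p%:R :> R by rewrite ltr0n.
have h := Xs23_asymp b2 b3 x0; have hp := Xs23_asymp b2 b3 (divr_gt0 x0 pR).
rewrite truncn_divn ?(ltW x0) // ln_div ?posrE // inv_sqrt_div // in hp.
have sr : Num.sqrt p%:R <= r.
  by have := ler_wsqrtr pr; rewrite sqrtr_sqr ger0_norm.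
have e0 : 0 <= err3 R b3 / Num.sqrt x.
  have /andP[e0 _] := err3_bounds b3; apply: mulr_ge0 => //; by rewrite invr_ge0 sqrtr_ge0.
have := ler_wpM2r e0 sr; rewrite /drop_at.
move: h hp; rewrite [err3 R b3 * (_ / _)]mulrCA; move: (err3 R b3 / Num.sqrt x) (c_E R) => e c.
rewrite !ler_norml => /andP[h1 h2] /andP[h3 h4] h5.
by lra.
Qed.

Lemma gain57_le b2 b3 b5 b7 x : 0 < x ->
  gain57 R b5 b7 (base23 b2 b3) (Num.truncn x)
  <= gain_main b5 b7 + gain_err b5 b7 * (err3 R b3 / Num.sqrt x).
Proof.
move=> x0; have h5 : drop_at R (base23 b2 b3) 5 (Num.truncn x) <= ln 5 + (1 + 9 / 4) * (err3 R b3 / Num.sqrt x).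
  by apply: drop_at_le => //; lra.
have h7 : drop_at R (base23 b2 b3) 7 (Num.truncn x) <= ln 7 + (1 + 8 / 3) * (err3 R b3 / Num.sqrt x).
  by apply: drop_at_le => //; lra.
move: (err3 R b3 / Num.sqrt x) h5 h7 => e; rewrite /gain57 /gain_main /gain_err.
by move: (drop_at _ _ _ _) (drop_at _ _ _ _) (ln 5) (ln 7) => *; case: b5; case: b7; lra.
Qed.

Lemma ln23_bounds : [/\ 693 / 1000 <= ln (2 : R), ln (2 : R) <= 7 / 10, 1098 / 1000 <= ln (3 : R) & ln (3 : R) <= 1099 / 1000].
Proof. by have /andP[] := ln2_bounds R; have /andP[] := ln3_bounds R; split; lra. Qed.

(** The gains ln 5 / 4 and ln 7 / 6 stay below .26 ln p; the slack is recorded because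
    [region_numeric] spends it on the larger error. *)
Lemma gain_main_le b5 b7 : gain_main b5 b7 <= 26 / 100 * (b5%:R * ln 5 + b7%:R * ln 7)
  + (if b7 then if b5 then - (13 / 100) else - (18 / 100) else if b5 then - (16 / 1000) else 0).
Proof.
have /andP[] := ln5_bounds; have /andP[] := ln7_bounds.
rewrite /gain_main; move: (ln 5) (ln 7) => l5 l7 *.
by case: b5; case: b7; rewrite ?mul1r ?mul0r; lra.
Qed.

Lemma h23_le b2 b3 : 375 / 1000 * h23 R b2 b3 <= 26 / 100 * (b2%:R * ln 2 + b3%:R * ln 3) + (if b3 then - (148 / 1000) else 0).
Proof.
have [h1 h2 h3 h4] := ln23_bounds.
rewrite /h23; move: (ln 2) (ln 3) h1 h2 h3 h4 => l2 l3 *.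
by case: b2; case: b3; rewrite ?mul1r ?mul0r; lra.
Qed.

(* The three alternatives are the ranges up to 3000, up to 10 ^ 4 and beyond, with [v = 1 / sqrt x]
   and [l = ln d]. *)
Lemma region_numeric b3 b5 b7 (v l : R) : 0 <= v -> (b3 && b5 && b7 -> 46 / 10 <= l) ->
  (v <= 5 / 158 /\ 35 / 10 <= l) \/ (v <= 10 / 547 /\ 23 / 10 <= l) \/ (v <= 1 / 100 /\ 69 / 100 <= l) ->
  134 / 100 + (if b3 then - (148 / 1000) else 0)
  + (if b7 then if b5 then - (13 / 100) else - (18 / 100) else if b5 then - (16 / 1000) else 0)
  + (1 + gain_err b5 b7) * (err3 R b3 * v) <= 136 / 100 + 115 / 1000 * l - 44 / 1000 * v.
Proof.
rewrite /gain_err /err3 => v0.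
by case: b3; case: b5; case: b7 => /= hl [[h1 h2]|[[h1 h2]|[h1 h2]]]; try (have := hl isT); clear hl; lra.
Qed.

(** If 3, 5 and 7 all divide d, the error is largest, but then ln d >= ln 105, above 4.6, and .115
    ln d covers it. *)
Lemma large_numeric b2 b3 b5 b7 (v l : R) : 0 <= v -> ln_base b2 b3 b5 b7 <= l ->
  (v <= 5 / 158 /\ 35 / 10 <= l) \/ (v <= 10 / 547 /\ 23 / 10 <= l) \/ (v <= 1 / 100 /\ 69 / 100 <= l) ->
  c_E R + h23 R b2 b3 + gain_main b5 b7 + (1 + gain_err b5 b7) * (err3 R b3 * v)
  <= 136 / 100 + 115 / 1000 * l + 260 / 1000 * ln_base b2 b3 b5 b7 + 625 / 1000 * h23 R b2 b3 - 44 / 1000 * v.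
Proof.
move=> v0 hl hr.
have h46 : b3 && b5 && b7 -> 46 / 10 <= l.
  have [h1 h2 h3 h4] := ln23_bounds; have /andP[h5 _] := ln5_bounds; have /andP[h7 _] := ln7_bounds.
  case/andP=> /andP[e3 e5] e7; move: hl; rewrite /ln_base e3 e5 e7 !mul1r.
  have : 0 <= b2%:R * ln 2 :> R by rewrite mulr_ge0 // ln_ge0 // (ler_nat R 1).
  by move: (b2%:R * _) (ln 3) (ln 5) (ln 7) h3 h5 h7 => *; lra.
have := region_numeric v0 h46 hr; have := h23_le b2 b3; have := gain_main_le b5 b7; have := c_E_le R.
rewrite /ln_base; move: (_ * (_ * v)) (h23 _ _ _) (gain_main _ _) (c_E R) => e h g c.
move: (if b3 then _ else _) (if b7 then _ else _) => t u.
move: (b2%:R * _) (b3%:R * _) (b5%:R * _) (b7%:R * _) => *; lra.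
Qed.

Lemma large_numeric11 b2 b3 b5 b7 (v : R) : 0 <= v -> v <= 5 / 158 ->
  c_E R + h23 R b2 b3 + gain_main b5 b7 + (1 + gain_err b5 b7) * (err3 R b3 * v) <= 16 / 10 * ln 11.
Proof.
move=> v0 v1; have hh : h23 R b2 b3 <= 717 / 1000.
  have [h1 h2 h3 h4] := ln23_bounds; clear v1.
  by rewrite /h23; case: b2; case: b3; rewrite ?mul1r ?mul0r; lra.
have hg : gain_main b5 b7 <= 8 / 10.
  have /andP[_ c5] := ln5_bounds; have /andP[_ c7] := ln7_bounds.
  rewrite /gain_main {hh v1 v0}; move: (ln 5) (ln 7) c5 c7 => l5 l7 c5 c7.
  by case: (b5); case: (b7); lra.
have he : (1 + gain_err b5 b7) * (err3 R b3 * v) <= 256 / 100 * (98 / 10 * (5 / 158)).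
  have /andP[g0 g1] := gain_err_bounds b5 b7; have /andP[e0 e1] := err3_bounds b3.
  apply: ler_pM; [|exact: mulr_ge0| |exact: ler_pM]; by move: (gain_err _ _) g0 g1 {hh hg v0 v1 e0 e1} => *; lra.
have := c_E_le R; have := ln11_ge; move: (_ * (_ * v)) (h23 _ _ _) (gain_main _ _) (c_E R) (ln 11) he hh hg {v0 v1} => *; lra.
Qed.

Lemma inv_sqrt_le x (c : R) : 0 < c -> c ^+ 2 <= x -> (Num.sqrt x)^-1 <= c^-1.
Proof.
move=> c0 cx; have := ler_wsqrtr cx; rewrite sqrtr_sqr gtr0_norm // => h.
by rewrite lef_pV2 ?posrE //; apply: lt_le_trans h.
Qed.

(** The bounds on v come from 31.6^2 <= 1000, 54.7^2 <= 3000 and 100^2. Those on ln d come from x d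
    >= 10^5 when x <= 3000 or x <= 10^4, and from d >= 2 beyond. *)
Lemma large_region x (l : R) : 0 < x -> 1000 <= x -> 5 * ln 10 <= ln x + l -> ln 2 <= l ->
  let v := (Num.sqrt x)^-1 in
  (v <= 5 / 158 /\ 35 / 10 <= l) \/ (v <= 10 / 547 /\ 23 / 10 <= l) \/ (v <= 1 / 100 /\ 69 / 100 <= l).
Proof.
move=> x0 x1000 lx l2l v; have [h1 _ _ h4] := ln23_bounds; have /andP[a5 _] := ln5_bounds.
have lnX k (y : R) : 0 < y -> x <= y * 10 ^+ k -> ln x <= ln y + k%:R * (ln 2 + ln 5).
  move=> y0 xy; rewrite -ln10E mulr_natl -lnXn // -lnM ?posrE ?exprn_gt0 //.
  by rewrite ler_ln ?posrE ?mulr_gt0 ?exprn_gt0.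
rewrite ln10E in lx.
have [x3|x3] := lerP x (3 * 10 ^+ 3).
  left; split.
    have c0 : 0 < 158 / 5 :> R by clear; lra.
    by rewrite /v -(invf_div 158 5); apply: (inv_sqrt_le c0); apply: le_trans x1000; clear; lra.
  have := lnX _ _ (ltr0Sn R 2) x3; clear x3 x1000 lnX x0 v.
  by move: (ln x) (ln 2) (ln 3) (ln 5) lx h1 h4 a5 {l2l} => *; lra.
have [x4|x4] := lerP x (1 * 10 ^+ 4).
  right; left; split.
    have c0 : 0 < 547 / 10 :> R by clear; lra.
    by rewrite /v -(invf_div 547 10); apply: (inv_sqrt_le c0); apply: le_trans (ltW x3); clear; lra.
  have := lnX _ _ ltr01 x4; rewrite ln1 add0r; clear x3 x4 x1000 lnX x0 v.
  by move: (ln x) (ln 2) (ln 5) lx h1 a5 {l2l h4} => *; lra.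
right; right; split; last by apply: le_trans l2l; apply: le_trans h1; clear; lra.
have c0 : 0 < 100 :> R by rewrite ltr0n.
by rewrite /v div1r; apply: (inv_sqrt_le c0); apply: le_trans (ltW x4); clear; lra.
Qed.

Lemma base_bounds b2 b3 b5 b7 x (l : R) : 1 <= x -> 5 * ln 10 <= ln x + l -> ln 2 <= l ->
  ln_base b2 b3 b5 b7 <= l ->
  let A := Xs R (base23 b2 b3) (Num.truncn x) + gain57 R b5 b7 (base23 b2 b3) (Num.truncn x) in
  A <= ln x + 136 / 100 + 115 / 1000 * l + 260 / 1000 * ln_base b2 b3 b5 b7 + 625 / 1000 * h23 R b2 b3
     - 44 / 1000 / Num.sqrt x
  /\ A <= ln11_bound x.
Proof.
move=> x1 lx l2l hl A; have x0 : 0 < x by lra.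
have /andP[n1 n2] := Num.Theory.truncn_itv (ltW x0).
have n0 : (0 < Num.truncn x)%N by rewrite Num.Theory.truncn_gt0.
have [n1000|n1000] := leqP (Num.truncn x) 1000.
  have [h1 h2] := small_cases R b2 b3 b5 b7 n0 n1000.
  have lnx : ln (Num.truncn x)%:R <= ln x by rewrite ler_ln ?posrE // ltr0n.
  have v1 : (Num.sqrt x)^-1 <= 1 by rewrite -[leRHS]invr1; apply: inv_sqrt_le; lra.
  split.
    apply: le_trans h1 _; rewrite /small_case_rhs /h23 /ln_base.
    rewrite ln10E in lx.
    move: (Num.sqrt x)^-1 v1 => v v1.
    move: (b2%:R * ln 2 + b3%:R * ln 3 + b5%:R * ln 5 + b7%:R * ln 7) => s.
    move: (b2%:R * (ln 2 / 2) + b3%:R * (ln 3 / 3)) => t.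
    lra.
  apply: le_trans h2 _; rewrite /ln11_bound lerD2l /Num.max; case: ifP; case: ifP; lra.
have x1000 : 1000 <= x by apply: le_trans n1; rewrite (ler_nat R 1000) ltnW.
have v0 : 0 <= (Num.sqrt x)^-1 by rewrite invr_ge0 sqrtr_ge0.
have vI : (Num.sqrt x)^-1 <= 5 / 158.
  by rewrite -(invf_div 158 5); apply: inv_sqrt_le; lra.
have := Xs23_asymp b2 b3 x0; rewrite ler_norml => /andP[_ hX].
have hG := gain57_le b2 b3 b5 b7 x0.
have hA : A <= ln x + (c_E R + h23 R b2 b3 + gain_main b5 b7 + (1 + gain_err b5 b7) * (err3 R b3 * (Num.sqrt x)^-1)).
  move: hX hG; rewrite /A; move: (Xs _ _ _) (gain57 _ _ _ _ _) (err3 R b3 / _) (c_E R) => X G e c.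
  by move: (gain_err _ _) (gain_main _ _) (h23 _ _ _) => *; lra.
split; apply: le_trans hA _; last first.
  have := @large_numeric11 b2 b3 b5 b7 _ v0 vI; move: (_ + _ * _) => t ht.
  apply: (@le_trans _ _ (26 / 10 * ln 11 + (ln x - ln 11))); first by lra.
  by rewrite /ln11_bound lerD2l le_max lexx orbT.
have := large_numeric v0 hl (large_region x0 x1000 lx l2l).
by rewrite -!addrA lerD2l.
Qed.

End TargetBound.

(** * Comparing the sums at Q0 / d and Q / d *)

Section RatioBound.
Variable R : realType.
Implicit Types (x y : R) (d : nat).

Lemma Xs_sub_le S T N : uniq (S ++ T) -> (forall p, p \in S ++ T -> prime p) -> Xs R T N <= Xs R (S ++ T) N.
Proof.
elim: S => // p S IH /= /andP[pS uS] hS.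
have hS' q : q \in S ++ T -> prime q by move=> h; apply: hS; rewrite inE h orbT.
apply: le_trans (IH uS hS') _; apply: Xs_le_cons => //; exact: hS (mem_head _ _).
Qed.

Lemma sum_primes_split d : (0 < d)%N ->
  ln_base R (2 %| d)%N (3 %| d)%N (5 %| d)%N (7 %| d)%N + \sum_(q <- large_primes d) ln q%:R <= ln d%:R.
Proof.
move=> d0; apply: le_trans (sum_ln_primes_le R d0).
have e1 (b : bool) p : \sum_(q <- if b then [:: p] else [::]) ln q%:R = b%:R * ln p%:R :> R.
  by case: b; rewrite ?big_nil ?mul0r // big_cons big_nil addr0 mul1r.
rewrite (perm_big _ (primes_split d0)) !big_cat /= !e1 /ln_base.
by move: (\sum_(q <- large_primes d) _) (_ * ln 2) (_ * ln 3) (_ * ln 5) (_ * ln 7) => *; lra.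
Qed.

Lemma h23_le_ln d : (0 < d)%N -> h23 R (2 %| d)%N (3 %| d)%N <= ln d%:R.
Proof.
move=> d0; apply: le_trans (sum_primes_split d0).
have s0 : 0 <= \sum_(q <- large_primes d) ln q%:R :> R.
  rewrite big_seq; apply: sumr_ge0 => q; rewrite mem_filter => /andP[q11 _].
  by rewrite ln_ge0 // ler1n (leq_trans _ q11).
have b0 (b : bool) (n : nat) : (0 < n)%N -> 0 <= b%:R * ln n%:R :> R.
  by move=> n0; rewrite mulr_ge0 // ln_ge0 // ler1n.
have := b0 (5 %| d)%N 5%N isT; have := b0 (7 %| d)%N 7%N isT.
have := b0 (2 %| d)%N 2%N isT; have := b0 (3 %| d)%N 3%N isT.
rewrite /h23 /ln_base !mulrA; move: (\sum_(q <- _) _) s0 => s s0 {b0}.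
by move: (_ * ln 2) (_ * ln 3) (_ * ln 5) (_ * ln 7) => *; lra.
Qed.

Lemma Xs_primes_ge d y : (0 < d)%N -> 0 < y ->
  ln y + c_E R + h23 R (2 %| d)%N (3 %| d)%N - err3 R (3 %| d)%N / Num.sqrt y <= Xs R (primes d) (Num.truncn y).
Proof.
move=> d0 y0; rewrite (Xs_perm _ _ (primes_split d0)) catA.
have pE : perm_eq (primes d) ((large_primes d ++ base57 (5 %| d)%N (7 %| d)%N) ++ base23 (2 %| d)%N (3 %| d)%N).
  by rewrite -catA primes_split.
apply: le_trans (@Xs_sub_le _ _ _ _ _).
- have := Xs23_asymp (2 %| d)%N (3 %| d)%N y0; rewrite ler_norml => /andP[h _].
  by move: h; move: (c_E R) (err3 R _ / _) (h23 _ _ _) (Xs _ _ _) => *; lra.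
- by rewrite -(perm_uniq pE) primes_uniq.
- by move=> p; rewrite -(perm_mem pE) mem_primes => /and3P[].
Qed.

Lemma mem_base b2 b3 b5 b7 p : p \in base57 b5 b7 ++ base23 b2 b3 -> prime p && (p < 11)%N.
Proof.
have /allP : all (fun p => prime p && (p < 11)%N) (base57 b5 b7 ++ base23 b2 b3).
  by case: b5; case: b7; case: b2; case: b3.
exact.
Qed.

Lemma Xs_primes_le d x : (1 < d)%N -> 1 <= x -> 5 * ln 10 <= ln x + ln d%:R ->
  Xs R (primes d) (Num.truncn x) <= ln x + 136 / 100 + 375 / 1000 * ln d%:R
    + 625 / 1000 * h23 R (2 %| d)%N (3 %| d)%N - 44 / 1000 / Num.sqrt x.
Proof.
move=> d1 x1 hx; have d0 : (0 < d)%N := ltnW d1.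
have hs := sum_primes_split d0.
have s0 : 0 <= \sum_(q <- large_primes d) ln q%:R :> R.
  rewrite big_seq; apply: sumr_ge0 => q; rewrite mem_filter => /andP[q11 _].
  by rewrite ln_ge0 // ler1n (leq_trans _ q11).
have l2 : ln 2 <= ln d%:R :> R by rewrite ler_ln ?posrE ?ltr0n // (ler_nat R 2).
have hb : ln_base R (2 %| d)%N (3 %| d)%N (5 %| d)%N (7 %| d)%N <= ln d%:R by lra.
have [A1 A2] := base_bounds x1 hx l2 hb.
rewrite (Xs_perm _ _ (primes_split d0)).
pose A := Xs R (base23 (2 %| d)%N (3 %| d)%N) (Num.truncn x)
  + gain57 R (5 %| d)%N (7 %| d)%N (base23 (2 %| d)%N (3 %| d)%N) (Num.truncn x).
have hT p : p \in base57 (5 %| d)%N (7 %| d)%N ++ base23 (2 %| d)%N (3 %| d)%N -> prime p && (p < 11)%N.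
  exact: mem_base.
have uT : uniq (base57 (5 %| d)%N (7 %| d)%N ++ base23 (2 %| d)%N (3 %| d)%N).
  by case: (5 %| d)%N; case: (7 %| d)%N; case: (2 %| d)%N; case: (3 %| d)%N.
have hL p : p \in large_primes d -> prime p && (11 <= p)%N.
  by rewrite mem_filter mem_primes => /andP[-> /and3P[-> _ _]].
have sL : sorted ltn (large_primes d) by apply: (sorted_filter ltn_trans); apply: sorted_primes.
have := @Xs_large_le R _ _ (Num.truncn x) A uT hT sL hL (Xs_base57_le R _ _ _ _ _)
  (fun p pp p11 => slope_condition x1 pp p11 A2).
move=> /le_trans; apply; rewrite -/A in A1; move: A1.
move: A (ln x) (h23 _ _ _) (ln_base _ _ _ _ _) (44 / 1000 / Num.sqrt x) hs s0 => A lx h b e hs s0 A1.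
move: (\sum_(q <- large_primes d) _) hs s0 => s hs s0; lra.
Qed.

(** Take the two hypotheses with weights 15/16 and 1/16: 15/16 * .6 + 1/16 = 5/8, and (ln 2 + 4 ln
    10) / 16 is about .619, which together with (5/8) * 1.2 covers 1.36. *)
Lemma sieve_ratio_le (L0 LQ : R) : L0 <= 6 / 10 * LQ -> L0 + ln 2 + 4 * ln 10 <= LQ -> 0 <= L0 ->
  0 <= (L0 + 136 / 100) / (LQ + c_E R) <= 5 / 8.
Proof.
have [h1 h2 h3 h4] := ln23_bounds R; have /andP[h5 _] := ln5_bounds R; have hc := c_E_ge R.
rewrite ln10E; move: (c_E R) (ln 2) (ln 5) hc h1 h2 h5 => c l2 l5 hc h1 h2 h5 a1 a2 a3.
have q0 : 0 < LQ + c by lra.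
apply/andP; split; first by rewrite divr_ge0 ?(ltW q0) // addr_ge0 ?divr_ge0.
by rewrite ler_pdivrMr //; lra.
Qed.

Section Ratio.
Variables (Q0 Q rho : R) (d : nat).
Hypotheses (Q00 : 0 < Q0) (d0 : (0 < d)%N) (dQ0 : d%:R <= Q0).
Hypotheses (hQ : 141 ^+ 2 * Q0 <= Q) (L5 : 5 * ln 10 <= ln Q0).
Hypotheses (r0 : 0 <= rho) (r58 : rho <= 5 / 8) (rE : rho * (ln Q + c_E R) = ln Q0 + 136 / 100).

Let dR : 0 < d%:R :> R. Proof. by rewrite ltr0n. Qed.
Let x1 : 1 <= Q0 / d%:R. Proof. by rewrite ler_pdivlMr // mul1r. Qed.
Let x0 : 0 < Q0 / d%:R. Proof. exact: divr_gt0. Qed.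
Let c141 : 0 < 141 ^+ 2 :> R. Proof. by rewrite exprn_gt0. Qed.
Let yx : 141 ^+ 2 * (Q0 / d%:R) <= Q / d%:R. Proof. by rewrite mulrA ler_pM2r // invr_gt0. Qed.
Let y0 : 0 < Q / d%:R. Proof. by apply: lt_le_trans yx; rewrite mulr_gt0. Qed.
Let lnx : ln (Q0 / d%:R) = ln Q0 - ln d%:R. Proof. by rewrite ln_div ?posrE. Qed.
Let lny : ln (Q / d%:R) = ln Q - ln d%:R.
Proof. by rewrite ln_div ?posrE //; move: y0; rewrite pmulr_lgt0 // invr_gt0. Qed.

(** 141^2 = 19881 is the square of an integer closest below 20000, so the error at Q / d is at most
    1 / 141 of the one at Q0 / d. *)
Let ey : (Num.sqrt (Q / d%:R))^-1 <= 141^-1 * (Num.sqrt (Q0 / d%:R))^-1.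
Proof.
have c : 0 < 141 :> R by [].
have s0 : 0 < Num.sqrt (Q0 / d%:R) by rewrite sqrtr_gt0.
have s1 : 0 < Num.sqrt (Q / d%:R) by rewrite sqrtr_gt0.
have s2 : 0 < 141 * Num.sqrt (Q0 / d%:R) by rewrite mulr_gt0.
rewrite -invfM lef_pV2 ?posrE //.
have := ler_wsqrtr yx.
by rewrite sqrtrM ?(ltW c141) // sqrtr_sqr gtr0_norm.
Qed.

Let lower : rho * (ln Q - ln d%:R + c_E R + h23 R (2 %| d)%N (3 %| d)%N
     - err3 R (3 %| d)%N * (141^-1 * (Num.sqrt (Q0 / d%:R))^-1))
  <= rho * Xs R (primes d) (Num.truncn (Q / d%:R)).
Proof.
apply: ler_wpM2l => //; have := Xs_primes_ge d0 y0; rewrite lny; apply: le_trans.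
by rewrite lerD2l lerN2; apply: ler_wpM2l ey; have /andP[] := err3_bounds R (3 %| d)%N.
Qed.

(** Substituting rho (LQ + c) = L0 + 1.36, the right side loses rho (l - h), at most (5/8)(l - h),
    and an error of at most (5/8) * 9.8 / 141 times w, below .044 w. These are the coefficients
    .375, .625 and .044 of the upper bound. *)
Lemma ratio_algebra (L0 LQ c l h e w X : R) : rho * (LQ + c) = L0 + 136 / 100 ->
  0 <= l -> h <= l -> 0 <= e <= 98 / 10 -> 0 <= w ->
  X <= L0 - l + 136 / 100 + 375 / 1000 * l + 625 / 1000 * h - 44 / 1000 * w ->
  X <= rho * (LQ - l + c + h - e * (141^-1 * w)).
Proof.
move=> hE l0 hl /andP[e0 e1] w0 hX.
have k1 : rho * (l - h) <= 5 / 8 * (l - h) by apply: ler_wpM2r => //; rewrite subr_ge0.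
have k2 : rho * (e * w) <= 5 / 8 * (98 / 10 * w).
  by apply: ler_pM => //; [rewrite mulr_ge0|apply: ler_wpM2r].
move: k2 k1 hE hX; rewrite !mulrBr !mulrDr mulrN => k2 k1 hE hX.
have -> : rho * (e * (141^-1 * w)) = rho * (e * w) / 141 by rewrite !mulrA mulrAC.
by move: (rho * (e * w)) (rho * LQ) (rho * l) (rho * h) (rho * c) k1 k2 hE hX => *; lra.
Qed.

Lemma Xs_ratio_gt1 : (1 < d)%N ->
  Xs R (primes d) (Num.truncn (Q0 / d%:R)) <= rho * Xs R (primes d) (Num.truncn (Q / d%:R)).
Proof.
move=> d1; apply: le_trans lower.
have hx : 5 * ln 10 <= ln (Q0 / d%:R) + ln d%:R by rewrite lnx subrK.
have := Xs_primes_le d1 x1 hx; rewrite lnx; apply: ratio_algebra => //.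
- by rewrite ln_ge0 // ler1n.
- exact: h23_le_ln.
exact: err3_bounds.
Qed.

(** With d = 1 nothing is gained from ln d, and 1.36 must cover c_E <= 1.34 and the errors alone.
    The main part is 6.02 / 316, with 316^2 <= 10^5. *)
Lemma Xs_ratio_1 : d = 1%N -> 316 ^+ 2 <= Q0 ->
  Xs R (primes d) (Num.truncn (Q0 / d%:R)) <= rho * Xs R (primes d) (Num.truncn (Q / d%:R)).
Proof.
move=> dE hQ0; apply: le_trans lower.
have hX := Xs23_asymp false false x0.
have w0 : 0 <= (Num.sqrt (Q0 / d%:R))^-1 by rewrite invr_ge0 sqrtr_ge0.
have s316 : (Num.sqrt (Q0 / d%:R))^-1 <= 316^-1 by apply: inv_sqrt_le; [rewrite ltr0n|rewrite dE divr1].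
move: hX w0 s316; rewrite lnx dE ln1 /h23 !mul0r !subr0 !addr0 ler_norml /err3 /= => /andP[_ hX].
move: (Num.sqrt _)^-1 hX => w hX w0 w1; have hc := c_E_le R.
have k2 : rho * w <= 5 / 8 * 316^-1 by apply: ler_pM.
have mE (r a b u : R) : r * (a * (b * u)) = a * b * (r * u) by ring.
have {}hX : Xs R (primes 1) (Num.truncn (Q0 / 1)) - (ln Q0 + c_E R) <= 602 / 100 * w := hX.
rewrite mulrBr rE mE; move: hX hc k2 w1; move: (rho * w) (c_E R) (Xs R _ _) (ln Q0) => *; lra.
Qed.

End Ratio.

End RatioBound.

(** * Passage to real parameters and conclusion *)

Section Assembly.
Variable R : realType.
Local Notation C := R[i].

Lemma fsbig_ge1 (V : nmodType) (D : set nat) (F : nat -> V) K :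
  (forall n, (0 < n <= K)%N -> D n) -> (forall n, D n -> ~~ (0 < n <= K)%N -> F n = 0) ->
  \sum_(n \in D) F n = \sum_(1 <= n < K.+1) F n.
Proof.
move=> DK F0; rewrite (fsbig_seq _ _ (iota_uniq _ _)) -/(index_iota 1 K.+1); apply/esym/fsbig_widen.
  by move=> n /=; rewrite mem_index_iota ltnS => /DK.
by move=> n [Dn /= /negP]; rewrite mem_index_iota ltnS; apply: F0.
Qed.

Lemma cmod_sqr (z : C) : ((cmod z) ^+ 2)%:C%C = `|z| ^+ 2.
Proof. by rewrite rmorphXn. Qed.

Lemma Gn_ratio (Q0 Q : R) d : 10 ^+ 5 <= Q0 -> 2 * 10 ^+ 4 * Q0 <= Q -> ln Q0 <= 6 / 10 * ln Q ->
  (0 < d)%N -> (d <= Num.truncn Q0)%N ->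
  0 <= (ln Q0 + 136 / 100) / (ln Q + c_E R) /\
  Gn R d (Num.truncn Q0 %/ d) <= (ln Q0 + 136 / 100) / (ln Q + c_E R) * Gn R d (Num.truncn Q %/ d).
Proof.
move=> hQ0 hQ hL d0 dK.
have Q00 : 0 < Q0 by apply: lt_le_trans hQ0; rewrite exprn_gt0.
have Qp : 0 < Q by apply: lt_le_trans hQ; rewrite !mulr_gt0 ?exprn_gt0.
have dQ0 : d%:R <= Q0.
  by have /andP[h _] := Num.Theory.truncn_itv (ltW Q00); apply: le_trans h; rewrite ler_nat.
have L5 : 5 * ln 10 <= ln Q0.
  by rewrite mulr_natl -lnXn // ler_ln ?posrE // exprn_gt0.
have LQ : ln Q0 + ln 2 + 4 * ln 10 <= ln Q.
  rewrite mulr_natl -lnXn // -!lnM ?posrE ?mulr_gt0 ?exprn_gt0 //.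
  by rewrite ler_ln ?posrE ?mulr_gt0 ?exprn_gt0 // -mulrA mulrC.
have l10 : 0 <= ln 10 :> R by rewrite ln_ge0 // (ler_nat R 1 10).
have l2 : 0 <= ln 2 :> R by rewrite ln_ge0 // (ler_nat R 1 2).
have L0 : 0 <= ln Q0 by apply: le_trans L5; rewrite mulr_ge0.
have /andP[r0 r58] := sieve_ratio_le hL LQ L0; split=> //.
have LE : 0 < ln Q + c_E R.
  have : 0 <= ln Q by apply: le_trans LQ; rewrite !addr_ge0 // mulr_ge0.
  by move=> h; apply: ltr_wpDl => //; apply: lt_le_trans (c_E_ge R); rewrite divr_gt0.
have rE : (ln Q0 + 136 / 100) / (ln Q + c_E R) * (ln Q + c_E R) = ln Q0 + 136 / 100.
  by rewrite divfK // gt_eqF.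
have h141 : 141 ^+ 2 * Q0 <= Q.
  by apply: le_trans hQ; rewrite ler_pM2r //; clear; lra.
have f0 : 0 < d%:R / (totient d)%:R :> R by rewrite divr_gt0 // ltr0n ?totient_gt0.
(* Multiplying both sides by d / phi(d) turns the claim for [Gn] into one for the normalized
   [Xs]. *)
rewrite -(ler_pM2l f0) mulrCA !Gn_Xs // -!truncn_divn ?(ltW Q00) ?(ltW Qp) //.
have [d1|d1] := leqP d 1; last exact: Xs_ratio_gt1.
apply: Xs_ratio_1 => //; first by apply/eqP; rewrite eqn_leq d1.
by apply: le_trans hQ0; clear; lra.
Qed.

Lemma energy_trig_sum (a : nat -> C) (M q : nat) : (forall n, (M < n)%N -> a n = 0) ->
  (\sum_(b < q | coprime b q) cmod (trig_sum a (b%:R / q%:R)) ^+ 2)%:C%C = energy M a q.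
Proof.
move=> aM; rewrite rmorph_sum; apply: eq_bigr => b _.
rewrite [LHS]cmod_sqr /trig_sum (@fsbig_ge1 _ _ _ M) // => [n /andP[n0 _] //|n /= n0].
by rewrite n0 -ltnNge => /aM ->; rewrite mul0r.
Qed.

End Assembly.

Theorem corollary5p8 (R : realType) (N Q0 Q : R) (a : nat -> R[i])
    (hN : 1 <= N)
    (ha_supp : forall n : nat, (0 < n)%N -> N < n%:R -> a n = 0)
    (hQ0 : 10 ^+ 5 <= Q0)
    (hQ : 20000 * Q0 <= Q)
    (ha_sieve : forall n : nat, (0 < n)%N ->
       (exists p : nat, [/\ prime p, p%:R <= Q & (p %| n)%N]) -> a n = 0)
    (hQ0Q : Q0 <= Q `^ (6 / 10)) :
  \sum_(q \in [set q : nat | (0 < q)%N /\ q%:R <= Q0])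
     \sum_(b < q | coprime b q) cmod (trig_sum a (b%:R / q%:R)) ^+ 2
  <= (ln Q0 + c_plus R) / (ln Q + c_E R) * (N + Q ^+ 2)
     * \sum_(n \in [set n : nat | (0 < n)%N]) cmod (a n) ^+ 2.
Proof.
have Q00 : 0 < Q0 by apply: lt_le_trans hQ0; rewrite exprn_gt0.
have {}hQ : 2 * 10 ^+ 4 * Q0 <= Q.
  apply: le_trans hQ; rewrite ler_pM2r // -natrX -natrM ler_nat //.
have Q0Q : Q0 <= Q.
  by apply: le_trans hQ; rewrite ler_peMl ?(ltW Q00) // -natrX -natrM (ler_nat R 1).
have Qp : 0 < Q := lt_le_trans Q00 Q0Q.
have hL : ln Q0 <= 6 / 10 * ln Q by rewrite -ln_powR ler_ln ?posrE ?powR_gt0.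
have N0 : 0 <= N := le_trans ler01 hN.
have /andP[M1 M2] := Num.Theory.truncn_itv N0.
have /andP[k1 k2] := Num.Theory.truncn_itv (ltW Q00).
have /andP[K1 K2] := Num.Theory.truncn_itv (ltW Qp).
set M := Num.truncn N in M1 M2; set K0 := Num.truncn Q0 in k1 k2; set K := Num.truncn Q in K1 K2.
have K0K : (K0 <= K)%N by apply: le_truncn.
have aM n : (M < n)%N -> a n = 0.
  move=> Mn; apply: ha_supp; first exact: leq_ltn_trans Mn.
  by apply: lt_le_trans M2 _; rewrite ler_nat.
have K0_gt0 : (0 < K0)%N.
  by rewrite Num.Theory.truncn_gt0; apply: le_trans hQ0; rewrite exprn_ege1 // (ler_nat R 1).
have [rho0 _] := Gn_ratio hQ0 hQ hL (isT : 0 < 1)%N K0_gt0.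
rewrite /c_plus; set rho := (ln Q0 + _) / _ in rho0 *.
rewrite (@fsbig_ge1 _ _ _ K0); first last.
- move=> q [q0 qQ]; rewrite q0 -ltnNge => h.
  by move: qQ; rewrite leNgt (lt_le_trans k2) // ler_nat.
- by move=> q /andP[q0 qK]; split=> //; apply: le_trans k1; rewrite ler_nat.
rewrite (@fsbig_ge1 _ _ _ M); first last.
- by move=> n /= n0; rewrite n0 -ltnNge => /aM ->; rewrite /cmod Normc.normc0 expr0n.
- by move=> n /andP[].
rewrite -lecR rmorph_sum /=.
under eq_bigr => q _ do rewrite (energy_trig_sum _ aM).
have sieved n p : (0 < n)%N -> a n != 0 -> prime p -> (p <= K)%N -> ~~ (p %| n)%N.
  move=> n0 an pp pK; apply: contra an => pn; apply/eqP/ha_sieve => //; exists p; split=> //.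
  by apply: le_trans K1; rewrite ler_nat.
have hG d : (0 < d)%N -> (d <= K0)%N -> Gn R d (K0 %/ d) <= rho * Gn R d (K %/ d).
  by move=> d0 dK; have [] := Gn_ratio hQ0 hQ hL d0 dK.
apply: le_trans (sieve_comparison M K0K sieved rho0 hG) _.
have K_gt0 := leq_trans K0_gt0 K0K.
(* The large sieve is applied with the integer parts of N and Q; since rho >= 0, replacing them by N
   and Q only increases the bound. *)
apply: (@le_trans _ _ (rho%:C%C * ((M%:R + K%:R ^+ 2)%:C%C * \sum_(1 <= n < M.+1) `|a n| ^+ 2))).
  by rewrite ler_wpM2l ?lecR //; apply: farey_large_sieve.
have -> : \sum_(1 <= n < M.+1) `|a n| ^+ 2 = (\sum_(1 <= n < M.+1) cmod (a n) ^+ 2)%:C%C.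
  by rewrite rmorph_sum; apply: eq_bigr => n _; rewrite -cmod_sqr.
rewrite -!rmorphM lecR mulrA; apply: ler_wpM2r.
  by apply: sumr_ge0 => n _; rewrite sqr_ge0.
by apply: ler_wpM2l => //; apply: lerD => //; rewrite lerXn2r ?nnegrE // ltW.
Qed.
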